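(* The following identities hold for operators on $\mathcal{F}_i$, $i=0,1$: $$\overline{X}(u)\,\overline{X}(v)=\overline{X}(v)\,\overline{X}(u),$$ $$\overline{X}(u)\,\overline{X}(u-h)=\overline{X}(u)\,\overline{X}(u+h)=0.$$
   Context: Let $\mathfrak{s}=\mathbb{C}e_{11}\oplus\mathbb{C}e_{22}$, $\varepsilon_j\in\mathfrak{s}^*$ with $\varepsilon_j(e_{kk})=\delta_{jk}$ and form $(\varepsilon_j,\varepsilon_k)=\delta_{jk}$; $\alpha=\varepsilon_1-\varepsilon_2$, $Q=\mathbb{Z}\alpha$, $\lambda_0=0$, $\lambda_1=\alpha/2$. Let $\widehat{\mathfrak{s}}$ be the Lie algebra generated by central $C$ and $a_j(r)$ ($j=1,2$, $r\in\mathbb{Z}\setminus\{0\}$) with $[a_j(r),a_k(s)]=r\delta_{jk}\delta_{r+s,0}C$, and $\widehat{\mathfrak{s}}^-$ the subalgebra generated by $a_j(r)$ with $r<0$. Let $\mathcal{F}_i=U(\widehat{\mathfrak{s}}^-)[[h]]\otimes\mathbb{C}[Q][[h]]e^{\lambda_i}$ ($h$-adically completed tensor product, over $\mathbb{C}[[h]]$). On $f\otimes e^\mu\in\mathcal{F}_i$: $C$ acts as $1$; $a_j(r)$ acts by $a_j(r)f\otimes e^\mu$ for $r<0$ and by $[a_j(r),f]\otimes e^\mu$ for $r>0$; $\partial_{\varepsilon_j}(f\otimes e^\mu)=(\varepsilon_j,\mu)f\otimes e^\mu$ ($\partial_\beta$ linear in $\beta$); $e^{\beta}(f\otimes e^\mu)=f\otimes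 e^{\beta+\mu}$. Put $$E^-(u)=\exp\Big(\sum_{r>0}\Big(-\frac{a_1(-r)}{r}\big(u-\tfrac34h\big)^r+\frac{a_2(-r)}{r}\big(u+\tfrac h4\big)^r\Big)\Big),\quad E^+(u)=\exp\Big(\sum_{r>0}\frac{a_1(r)-a_2(r)}{r}\big(u+\tfrac h4\big)^{-r}\Big),$$ $$X_\alpha(u)=E^-(0)^{-1}E^-(u)E^+(u)\,e^{\alpha}\,u^{\partial_{\alpha/2}}(u+h)^{\partial_{\alpha/2}},$$ $$\overline{E}^+(u)=\exp\Big(\sum_{r>0}\Big(\frac{a_1(r)}{r}\big(u-\tfrac74h\big)^{-r}+\frac{a_2(r)}{r}\big(u+\tfrac14h\big)^{-r}\Big)\Big),\qquad \overline{E}^0(u)=(1-h/u)^{\partial_{\alpha/2}},$$ $$\overline{X}(u)=X_\alpha(u)\,\overline{E}^+(u)\,\overline{E}^0(u).$$ Expressions such as $(u+ah)^p$ are expanded in nonnegative powers of $h$. The product $\overline{X}(u)\overline{X}(u\pm h)$ denotes the formal limit $v\to u\pm h$ of $\overline{X}(u)\overline{X}(v)$ (whose existence is part of the statement). *)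

(* Defs.v *)
From HB Require Import structures.
From mathcomp Require Import all_boot all_order all_algebra.
From mathcomp Require Export complex.
From mathcomp Require Import finmap monalg.
From mathcomp Require Import boolp classical_sets functions cardinality fsbigop.
From mathcomp Require Export reals.

Set Implicit Arguments.
Unset Strict Implicit.
Unset Printing Implicit Defensive.

Import Order.TTheory GRing.Theory Num.Theory.
Local Open Scope classical_set_scope.
Local Open Scope ring_scope.

(** * Power series in [h] and formal series in [u] over a vector space [V]

    [V[[h]]] is [nat -> V]. *)

Section Formal.
Variables (K : numFieldType) (V : lmodType K).

Definition hser := nat -> V.

Definition hmul (c : nat -> K) (w : hser) : hser :=
  fun m => \sum_(l < m.+1) c l *: w (m - l)%N.

(** A family is h-adically summable if, for each [M], all but finitely many of
    its members lie in [h^M V[[h]]]. *)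
Definition hsummable (I : choiceType) (g : I -> hser) : Prop :=
  forall m, finite_set [set t | g t m != 0].

(** Meaningful for summable families only. *)
Definition hsum (I : choiceType) (g : I -> hser) : hser :=
  fun m => \sum_(t \in [set: I]) g t m.

(** [A : ser] is the formal series [sum_(p : K) A_p u^p] whose coefficients are
    operators on [V[[h]]]. Exponents in [K] are needed because of the
    half-integral powers in [u^{partial_{alpha/2}}]. *)
Definition ser := K -> hser -> hser.

Definition sconst (T : hser -> hser) : ser :=
  fun p w => if p == 0 then T w else 0.
Definition szero : ser := fun _ _ => 0.
Definition sone : ser := sconst id.
Definition sadd (A B : ser) : ser := fun p w => A p w + B p w.
Definition sopp (A : ser) : ser := fun p w => - A p w.
Definition smul (A B : ser) : ser :=
  fun p w => hsum (fun q : K => A q (B (p - q) w)).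
Definition ssum (A : nat -> ser) : ser := fun p w => hsum (fun n => A n p w).
Definition sexpn (A : ser) (n : nat) : ser := iter n (smul A) sone.
Definition sexp (A : ser) : ser :=
  ssum (fun n p w m => (n`!%:R)^-1 *: sexpn A n p w m).

(** The inverse of a series congruent to 1 modulo [h]: [sum_n (1 - A)^n]. *)
Definition sinv (A : ser) : ser := ssum (sexpn (sadd sone (sopp A))).

(** The value at [u = 0] of a series without negative powers of [u]. *)
Definition at0 (A : ser) : ser := sconst (A 0).

Definition gbinom (x : K) (m : nat) : K := (\prod_(l < m) (x - l%:R)) / m`!%:R.

(** [upow b x p m] is the coefficient of [u^p h^m] in [(u + b h)^x]. *)
Definition upow (b x p : K) (m : nat) : K :=
  if p == x - m%:R then gbinom x m * b ^+ m else 0.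

(** [vpow b x p m] is the coefficient of [u^p h^m] in [(1 + b h / u)^x]. *)
Definition vpow (b x p : K) (m : nat) : K :=
  if p == - m%:R then gbinom x m * b ^+ m else 0.

Definition smono (c : K -> nat -> K) (T : hser -> hser) : ser :=
  fun p w => hmul (c p) (T w).

(** [F p q] is the coefficient of [u^p v^q]. *)
Definition ser2 := K -> K -> hser -> hser.

(** [A(u) B(v)] *)
Definition sprod2 (A B : ser) : ser2 := fun p q w => A p (B q w).

(** [F(v, u)] *)
Definition sswap (F : ser2) : ser2 := fun p q => F q p.

(** The formal limit of [F(u, v)] as [v -> u + b h] exists and equals [G(u)]:
    after [v^q] is replaced with the expansion of [(u + b h)^q], the
    contributions to each power [u^s], applied to any vector, form a summable
    family whose sum is the corresponding coefficient of [G]. *)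
Definition is_formal_limit (b : K) (F : ser2) (G : ser) : Prop :=
  forall (s : K) (w : hser),
    let g (pq : (K * K)%type) :=
      hmul (upow b pq.2 (s - pq.1)) (F pq.1 pq.2 w) in
    hsummable g /\ hsum g = G s w.

End Formal.

(** * Restriction of scalars *)

Section RestrictScalars.
Variables (K : comNzRingType) (A : lalgType K) (W : lmodType A).

Definition rscalars : Type := W.
HB.instance Definition _ := GRing.Zmodule.on rscalars.

Definition rscale (c : K) (v : rscalars) : rscalars := c%:A *: (v : W).

Fact rscaleA c d v : rscale c (rscale d v) = rscale (c * d) v.
Proof. by rewrite /rscale scalerA -scalerAl mul1r scalerA. Qed.

Fact rscale1 : left_id 1 rscale.
Proof. by move=> v; rewrite /rscale !scale1r. Qed.

Fact rscaleDr : right_distributive rscale +%R.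
Proof. by move=> c u v; apply: scalerDr. Qed.

Fact rscaleDl v : {morph rscale^~ v : c d / c + d}.
Proof. by move=> c d; rewrite /rscale !scalerDl. Qed.

HB.instance Definition _ := GRing.Zmodule_isLmodule.Build K rscalars
  rscaleA rscale1 rscaleDr rscaleDl.

End RestrictScalars.

Section Fock.
Variable K : numFieldType.

(** * The weight space [s^*], with basis [eps_1, eps_2] (indexed from 0) *)

Definition eps (j : 'I_2) : 'rV[K]_2 := delta_mx 0 j.
Definition form (x y : 'rV[K]_2) : K := \sum_j x 0 j * y 0 j.
Definition alpha : 'rV[K]_2 := eps 0 - eps 1.
Definition lam (i : 'I_2) : 'rV[K]_2 := (i%:R / 2%:R) *: alpha.
Definition wt (i : 'I_2) (k : int) : 'rV[K]_2 := k%:~R *: alpha + lam i.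

(** * The space [F_i]

    The subalgebra generated by the [a_j(r)], [r < 0], is abelian, so its
    enveloping algebra [Uminus] is the polynomial algebra on the [a_j(r)].
    The pair [(j, n)] stands for [a_j(-(n+1))].

    [Uminus (x) C[Q]e^{lam_i}] is the free [Uminus]-module on the
    [e^{k alpha + lam_i}], [k : int], so [<< f *g k >> : Fock0] stands for
    [f (x) e^{k alpha + lam_i}]; it is viewed as a vector space over [K].

    The h-adically completed tensor product is [Fock0[[h]]]. The index [i] only
    enters through the weights of the basis vectors. *)

Definition mode : choiceType := ('I_2 * nat)%type.
Definition monom : conomType := {cmonom mode}.
Definition gen (j : 'I_2) (n : nat) : monom := ucm ((j, n) : mode).
Definition Uminus := {malg K[monom]}.
Definition Fock0 := rscalars {malg Uminus[int]}.
Definition Fock := hser Fock0.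

(** [bracket j n f] is [[a_j(n+1), f]], where [C] acts as 1: the derivation of
    [Uminus] that maps [a_j(-(n+1))] to [n+1] and the other generators to 0.
    It is [n+1] times the partial derivative with respect to [gen j n];
    [divcm m (gen j n)] is the monomial [m] with one factor [gen j n] removed. *)
Definition bracket (j : 'I_2) (n : nat) (f : Uminus) : Uminus :=
  \sum_(m <- msupp f)
     << (n.+1 * m (j, n))%:R * f@_m *g divcm m (gen j n) >>.

(** There is no [a_j(0)]; the value at [r = 0] is never used. *)
Definition heis0 (j : 'I_2) (r : int) (v : Fock0) : Fock0 :=
  match r with
  | Posz 0 => 0
  | Posz n.+1 => \sum_(k <- msupp v) << bracket j n v@_k *g k >>
  | Negz n => (<< gen j n >> : Uminus) *: (v : {malg Uminus[int]})
  end.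

Definition a (j : 'I_2) (r : int) (w : Fock) : Fock := fun m => heis0 j r (w m).

Definition exp_alpha (w : Fock) : Fock :=
  fun m => \sum_(k <- msupp (w m)) << (w m)@_k *g (k + 1) >>.

(** [fun_partial i beta phi] is [phi(partial_beta)]: it multiplies
    [f (x) e^mu] by [phi (beta, mu)]. *)
Definition fun_partial (i : 'I_2) (beta : 'rV[K]_2) (phi : K -> K) (v : Fock0)
    : Fock0 :=
  \sum_(k <- msupp v) << phi (form beta (wt i k)) *: v@_k *g k >>.

(** [spartial i beta c] is [c(partial_beta)] for a family [c x] of scalar
    formal series in [u] and [h]. *)
Definition spartial (i : 'I_2) (beta : 'rV[K]_2) (c : K -> K -> nat -> K)
    : ser Fock0 :=
  fun p w m =>
    \sum_(l < m.+1) fun_partial i beta (fun x => c x p l) (w (m - l)%N).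

(** * The vertex operators; the summation index [n] stands for [r = n + 1] *)

(** [a_j(s) / r * (u + b h)^t] *)
Definition aterm (j : 'I_2) (s : int) (r b t : K) : ser Fock0 :=
  smono (upow b t) (fun w m => r^-1 *: a j s w m).

Definition Eminus : ser Fock0 := sexp (ssum (fun n =>
  let r : K := n.+1%:R in
  sadd (sopp (aterm 0 (- n.+1%:Z) r (- (3%:R / 4%:R)) r))
       (aterm 1 (- n.+1%:Z) r (1 / 4%:R) r))).

Definition Eplus : ser Fock0 := sexp (ssum (fun n =>
  let r : K := n.+1%:R in
  sadd (aterm 0 n.+1%:Z r (1 / 4%:R) (- r))
       (sopp (aterm 1 n.+1%:Z r (1 / 4%:R) (- r))))).

Definition Xalpha (i : 'I_2) : ser Fock0 :=
  let half_alpha := 2%:R^-1 *: alpha in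
  smul (smul (smul (smul (smul
    (sinv (at0 Eminus)) Eminus) Eplus) (sconst exp_alpha))
    (spartial i half_alpha (upow 0))) (spartial i half_alpha (upow 1)).

Definition Ebarplus : ser Fock0 := sexp (ssum (fun n =>
  let r : K := n.+1%:R in
  sadd (aterm 0 n.+1%:Z r (- (7%:R / 4%:R)) (- r))
       (aterm 1 n.+1%:Z r (1 / 4%:R) (- r)))).

Definition Ebar0 (i : 'I_2) : ser Fock0 :=
  spartial i (2%:R^-1 *: alpha) (vpow (- 1)).

Definition Xbar (i : 'I_2) : ser Fock0 := smul (smul (Xalpha i) Ebarplus) (Ebar0 i).

End Fock.

(* Main.v *)
Require Import Defs.
From HB Require Import structures.
From mathcomp Require Import all_boot all_order all_algebra complex reals.
From mathcomp Require Import finmap monalg ring zify.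
From mathcomp Require Import boolp classical_sets functions cardinality fsbigop.

Set Implicit Arguments.
Unset Strict Implicit.
Unset Printing Implicit Defensive.

Import Order.TTheory GRing.Theory Num.Theory.
Local Open Scope ring_scope.

(** Let [D] be [partial_(alpha/2)], with value [k + i/2] on
    [e^(k alpha + lam_i)]. In [Xbar(u)] the factor [e^alpha] commutes with
    [E^+(u)], and the zero modes commute with all Heisenberg modes, so that

      [Xbar(u) = M(u) e^alpha t(u)],  [M(u) = E^-(0)^-1 E^-(u)],
      [t(u) = E^+(u) Ebar^+(u) u^D (u + h)^D (1 - h/u)^D].

    Here [M(u)] contains creation modes only, and [t(u)] annihilation modes and
    zero modes only. Moving [t(u)] to the right of [M(v) e^alpha] produces a
    scalar: the zero modes give [u (u + h) (1 - h/u) = u^2 - h^2], the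
    Heisenberg modes give [(u - v + h) (u - v - h) / (u^2 - h^2)], whence

      [Xbar(u) Xbar(v) = ((u - v)^2 - h^2) M(u) M(v) e^(2 alpha) t(u) t(v)].

    The normally ordered product on the right is symmetric in [u] and [v], and so
    is the scalar: this is the commutativity. On a given vector and modulo a given
    power of [h], the normally ordered product has finitely many negative powers
    of [u] and of [v], so that [v = u + b h] can be substituted in it; for
    [b = 1] and [b = -1] the scalar vanishes.

    The formal series are organized as follows. The operator series in [u] of
    which, on each vector and modulo each power of [h], only finitely many
    coefficients are nonzero form a ring [fser] under [smul]. It contains [t(u)],
    the scalar series [(u + b h)^x], which are central, and constant operators,
    but not [M(u)], which enters through its coefficients. The contraction
    is obtained without logarithms. The coefficients [M_n] satisfy the Newton
    recursion [n M_n = sum_k y_k M_(n-k)], where [y_k / k] is the coefficient of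
    [v^k] in the exponent of [E^-(v)], and the Heisenberg relations yield
    [t(u) y_k = (y_k - (u + h)^-k - (u - h)^-k) t(u)] ([vplus_dlogEminus]).
    Subtracting the powers [I^k] from the [y_k] amounts to multiplying the
    generating series of the [M_n] by [1 - I v] ([newton_lag]), and a Newton
    recursion determines its solution ([newton_intertwine]); this gives the
    exchange relation [vannih_fvminus_fexp_alpha] and then the displayed formula,
    in coefficients, as [Xbar_Xbar]. The substitution [v = u + b h] is carried
    out in [formal_limit0]. *)

(** * Linear operators and summable families on [V[[h]]] *)

Section Series.
Variables (K : numFieldType) (V : lmodType K).
Implicit Types (w : hser V) (c d : nat -> K) (T : hser V -> hser V).

(** Membership in [h^n V[[h]]]. *)
Definition vanish n w := forall m, (m < n)%N -> w m = 0.

(** Linearity over [K[[h]]]. It entails continuity for the h-adic topology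
    ([hlin_vanish]), so that these operators commute with [hsum]. *)
Definition hlin T :=
  (forall w w', T (w + w') = T w + T w') /\
  (forall c w, T (hmul c w) = hmul c (T w)).

Definition hmono n : nat -> K := fun l => (l == n)%:R.

Lemma hmul_hmono n w m : hmul (hmono n) w m = if (n <= m)%N then w (m - n)%N else 0.
Proof.
rewrite /hmul /hmono; case: leqP => [nm|mn].
  rewrite (bigD1 (Ordinal (nm : n < m.+1)%N)) //= eqxx scale1r big1 ?addr0 // => i.
  by rewrite -val_eqE /= => /negbTE ->; rewrite scale0r.
rewrite big1 // => i _; case: eqP => [E|_]; last by rewrite scale0r.
by have := ltn_ord i; rewrite E ltnS leqNgt mn.
Qed.

Lemma hmul1 c w : (forall l, c l = (l == 0%N)%:R) -> hmul c w = w.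
Proof.
move=> cE; apply/funext => m; rewrite -[RHS]/(w m) -[in RHS](subn0 m).
rewrite -[RHS](hmul_hmono 0 w m) /hmul.
by apply: eq_bigr => l _; rewrite cE.
Qed.

(** Both sides are sums of [c_l d_k w_(m - l - k)] over [l + k <= m]. *)
Lemma hmulC c d w : hmul c (hmul d w) = hmul d (hmul c w).
Proof.
apply/funext => m; rewrite /hmul.
have H (c' d' : nat -> K) : \sum_(l < m.+1) c' l *: (\sum_(k < (m - l).+1) d' k *: w (m - l - k)%N)
   = \sum_(l < m.+1) \sum_(k < m.+1 | (l + k <= m)%N) (c' l * d' k) *: w (m - (l + k))%N.
  apply: eq_bigr => l _; rewrite scaler_sumr.
  rewrite (big_ord_widen m.+1 (fun k => c' l *: (d' k *: w (m - l - k)%N))) ?ltnS ?leq_subr //.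
  apply: eq_big => [k|k _]; last by rewrite scalerA subnDA.
  by rewrite ltnS leq_subRL // -ltnS ltn_ord.
rewrite !H (exchange_big_dep predT) //=; apply: eq_bigr => k _.
by apply: eq_big => [l|l _]; rewrite 1?addnC // mulrC.
Qed.

Lemma hmulDr c w w' : hmul c (w + w') = hmul c w + hmul c w'.
Proof.
apply/funext => m; rewrite /hmul -[RHS]big_split /=.
by apply: eq_bigr => l _; rewrite -scalerDr.
Qed.

Lemma hmulDl c d w : hmul (c + d) w = hmul c w + hmul d w.
Proof.
apply/funext => m; rewrite /hmul -[RHS]big_split /=.
by apply: eq_bigr => l _; rewrite -scalerDl.
Qed.

Lemma hmulZ (x : K) w : x *: w = hmul (fun l => x * (l == 0%N)%:R) w.
Proof.
apply/funext => m; rewrite -[LHS]/(x *: w m) /hmul big_ord_recl /= mulr1 subn0.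
by rewrite big1 ?addr0 // => i _; rewrite mulr0 scale0r.
Qed.

Lemma hlin_hmul c : hlin (hmul c).
Proof. by split=> [w w'|d w]; [rewrite hmulDr|rewrite hmulC]. Qed.

Lemma hlin_id : hlin id. Proof. by split. Qed.
Lemma hlin_comp T T' : hlin T -> hlin T' -> hlin (fun w => T (T' w)).
Proof. by move=> [a b] [a' b']; split=> *; rewrite ?a' ?a ?b' ?b. Qed.

Section Lin.
Variables (T : hser V -> hser V) (hT : hlin T).
Lemma hlinD w w' : T (w + w') = T w + T w'. Proof. by case: hT. Qed.
Lemma hlinM c w : T (hmul c w) = hmul c (T w). Proof. by case: hT. Qed.
Lemma hlinZ x w : T (x *: w) = x *: T w. Proof. by rewrite !hmulZ hlinM. Qed.
Lemma hlin0 : T 0 = 0. Proof. by have := hlinZ 0 0; rewrite !scale0r. Qed.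
Lemma hlinN w : T (- w) = - T w. Proof. by rewrite -scaleN1r hlinZ scaleN1r. Qed.
Lemma hlinB w w' : T (w - w') = T w - T w'. Proof. by rewrite hlinD hlinN. Qed.
Lemma hlin_sum I (r : seq I) (F : I -> hser V) :
  T (\sum_(i <- r) F i) = \sum_(i <- r) T (F i).
Proof. by elim/big_rec2: _ => [|i x y _ <-]; rewrite ?hlin0 ?hlinD. Qed.

(** An element of [h^n V[[h]]] is [h^n w], and [T] commutes with [h^n]. *)
Lemma hlin_vanish n w : vanish n w -> vanish n (T w).
Proof.
move=> wn; have -> : w = hmul (hmono n) (fun m => w (m + n)%N).
  apply/funext => m; rewrite hmul_hmono; case: leqP => [nm|]; first by rewrite subnK.
  exact: wn.
by move=> m mn; rewrite hlinM hmul_hmono leqNgt mn.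
Qed.

Lemma hlin_eq n w w' : (forall m, (m < n)%N -> w m = w' m) ->
  forall m, (m < n)%N -> T w m = T w' m.
Proof.
move=> E m mn; apply/eqP; rewrite -subr_eq0; apply/eqP.
have -> : T w m - T w' m = T (w - w') m by rewrite hlinB.
apply: (@hlin_vanish n) => // m' m'n.
by rewrite -[LHS]/(w m' - w' m') E // subrr.
Qed.
End Lin.

Lemma hlinDf T T' : hlin T -> hlin T' -> hlin (fun w => T w + T' w).
Proof.
move=> hT hT'; split=> [w w'|c w]; first by rewrite (hlinD hT) (hlinD hT') addrACA.
by rewrite (hlinM hT) (hlinM hT') hmulDr.
Qed.
Lemma hlinNf T : hlin T -> hlin (fun w => - T w).
Proof.
move=> hT; split=> [w w'|c w]; first by rewrite (hlinD hT) opprD.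
by rewrite (hlinM hT) (hlinN (hlin_hmul c)).
Qed.
Lemma hlin0f : hlin (fun _ => 0).
Proof. by split=> [*|c _]; rewrite ?addr0 ?(hlin0 (hlin_hmul c)). Qed.
Lemma hlinZf x T : hlin T -> hlin (fun w => x *: T w).
Proof.
move=> hT; split=> [w w'|c w]; first by rewrite (hlinD hT) scalerDr.
by rewrite (hlinM hT) (hlinZ (hlin_hmul c)).
Qed.

Section Sums.
Variable I : choiceType.
Implicit Types (g : I -> hser V).

Lemma hsum_seq g (s : seq I) m : (forall t, t \notin s -> g t m = 0) ->
  hsum g m = \sum_(t <- undup s) g t m.
Proof.
move=> gs; rewrite /hsum (fsbigTE [fset x in s]%fset) /=; last first.
  by move=> t; rewrite inE /= => /gs.
apply: perm_big; apply: uniq_perm; rewrite ?undup_uniq ?fset_uniq // => t.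
by rewrite !inE mem_undup.
Qed.

(** One finite set of exceptions serves for all the coefficients below [h^n];
    in this form summability passes to images and to double families. *)
Lemma hsummableP g : hsummable g <->
  forall n, exists s : seq I, forall t, t \notin s -> vanish n (g t).
Proof.
split=> [gs n|gs m].
  elim: n => [|n [s sP]]; first by exists [::].
  have /finite_seqP[r rE] := gs n; exists (s ++ r) => t.
  rewrite mem_cat negb_or => /andP[ts tr] m; rewrite ltnS leq_eqVlt => /orP[/eqP ->|].
    apply/eqP; apply: contraNT tr => gt; have : [set t | g t n != 0]%classic t by [].
    by rewrite rE.
  exact: sP.
have [s sP] := gs m.+1; apply/finite_seqP.
exists (filter (fun t => g t m != 0) (undup s)); apply/seteqP; split=> t /=.
  move=> gt; rewrite mem_filter gt mem_undup; apply: contraNT gt => /sP -> //.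
  by rewrite mem_filter => /andP[].
Qed.

Lemma eq_hsum g g' : g =1 g' -> hsum g = hsum g'.
Proof. by move=> /funext ->. Qed.

Lemma eq_hsummable g g' : g =1 g' -> hsummable g -> hsummable g'.
Proof. by move=> /funext ->. Qed.

(** Modulo [h^(m+1)] the sum is finite, and [T] does not lower the order in [h]. *)
Lemma hsum_lin T g : hlin T -> hsummable g -> T (hsum g) = hsum (fun t => T (g t)).
Proof.
move=> hT /hsummableP gs; apply/funext => m; have [s sP] := gs m.+1.
rewrite (@hsum_seq (fun t => T (g t)) s); last first.
  by move=> t /sP /(hlin_vanish hT) ->.
rewrite (@hlin_eq _ hT m.+1 (hsum g) (\sum_(t <- undup s) g t)) //; last first.
  move=> m' m'm; rewrite (@hsum_seq _ s) ?fct_sumE // => t /sP; exact.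
by rewrite (hlin_sum hT) fct_sumE.
Qed.

Lemma hsummable_lin (T : I -> hser V -> hser V) g : (forall t, hlin (T t)) ->
  hsummable g -> hsummable (fun t => T t (g t)).
Proof.
move=> hT /hsummableP gs; apply/hsummableP => n; have [s sP] := gs n.
by exists s => t /sP /(hlin_vanish (hT t)).
Qed.

Lemma hsummableD g g' : hsummable g -> hsummable g' ->
  hsummable (fun t => g t + g' t).
Proof.
move=> /hsummableP gs /hsummableP gs'; apply/hsummableP => n.
have [s sP] := gs n; have [s' sP'] := gs' n; exists (s ++ s') => t.
rewrite mem_cat negb_or => /andP[/sP h /sP' h'] m mn.
by rewrite -[LHS]/(g t m + g' t m) h // h' // addr0.
Qed.

Lemma hsumD g g' : hsummable g -> hsummable g' ->
  hsum (fun t => g t + g' t) = hsum g + hsum g'.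
Proof.
move=> /hsummableP gs /hsummableP gs'; apply/funext => m.
have [s sP] := gs m.+1; have [s' sP'] := gs' m.+1.
rewrite -[RHS]/(hsum g m + hsum g' m) !(@hsum_seq _ (s ++ s')).
- by rewrite -big_split.
- by move=> t; rewrite mem_cat negb_or => /andP[_ /sP' ->].
- by move=> t; rewrite mem_cat negb_or => /andP[/sP ->].
move=> t; rewrite mem_cat negb_or => /andP[/sP h /sP' h'].
by rewrite -[LHS]/(g t m + g' t m) h // h' // addr0.
Qed.

Lemma hsumN g : hsummable g -> hsum (fun t => - g t) = - hsum g.
Proof. by move=> gs; rewrite (hsum_lin (hlinNf hlin_id) gs). Qed.

Lemma hsum0 : hsum (fun _ : I => 0 : hser V) = 0.
Proof. by apply/funext => m; rewrite (@hsum_seq _ [::]) ?big_nil. Qed.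

Lemma hsummable0 : hsummable (fun _ : I => 0 : hser V).
Proof. by apply/hsummableP => n; exists [::]. Qed.

Lemma hsummable1 (g : I -> hser V) t0 : (forall t, t != t0 -> g t = 0) -> hsummable g.
Proof.
move=> g0; apply/hsummableP => n; exists [:: t0] => t; rewrite inE => /g0 -> //.
Qed.

Lemma hsum1 (g : I -> hser V) t0 : (forall t, t != t0 -> g t = 0) -> hsum g = g t0.
Proof.
move=> g0; apply/funext => m; rewrite (@hsum_seq _ [:: t0]) /= ?big_seq1 // => t.
by rewrite inE => /g0 ->.
Qed.

Lemma hlin_hsum (T : I -> hser V -> hser V) :
  (forall t, hlin (T t)) -> (forall w, hsummable (fun t => T t w)) ->
  hlin (fun w => hsum (fun t => T t w)).
Proof.
move=> hT sT; split=> [w w'|c w].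
  by rewrite -hsumD //; apply: eq_hsum => t; rewrite (hlinD (hT t)).
rewrite (hsum_lin (hlin_hmul c)) //.
by apply: eq_hsum => t; rewrite (hlinM (hT t)).
Qed.
End Sums.

Lemma hsummable_inj (I J : choiceType) (h : J -> I) (h' : I -> J) (g : I -> hser V) :
  cancel h h' -> hsummable g -> hsummable (fun t => g (h t)).
Proof.
move=> hK /hsummableP gs; apply/hsummableP => n; have [s sP] := gs n.
exists (map h' s) => t ts; apply: sP; apply: contra ts => hs.
by apply/mapP; exists (h t).
Qed.

Lemma hsum_bij (I J : choiceType) (h : J -> I) (h' : I -> J) (g : I -> hser V) :
  cancel h h' -> cancel h' h -> hsummable g -> hsum g = hsum (fun t => g (h t)).
Proof.
move=> hK h'K /hsummableP gs; apply/funext => m; have [s sP] := gs m.+1.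
rewrite (@hsum_seq _ g s); last by move=> t /sP ->.
rewrite (@hsum_seq _ (fun t => g (h t)) (map h' s)); last first.
  move=> t ts; rewrite sP //; apply: contra ts => hs.
  by apply/mapP; exists (h t).
rewrite (undup_map_inj (can_inj h'K)) big_map.
by apply: eq_bigr => t _; rewrite h'K.
Qed.

Lemma hsummable_pair (I J : choiceType) (g : I * J -> hser V) : hsummable g ->
  (forall i, hsummable (fun j => g (i, j))) /\
  hsummable (fun i => hsum (fun j => g (i, j))).
Proof.
move=> /hsummableP gs; split=> [i|]; apply/hsummableP => n; have [s sP] := gs n.
  exists (map snd s) => j js; apply: sP; apply: contra js => hs.
  by apply/mapP; exists (i, j).
exists (map fst s) => i js m mn; rewrite (@hsum_seq _ _ [::]) ?big_nil // => j _.
by rewrite sP //; apply: contra js => hs; apply/mapP; exists (i, j).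
Qed.

Lemma hsum_pair (I J : choiceType) (g : I * J -> hser V) : hsummable g ->
  hsum g = hsum (fun i => hsum (fun j => g (i, j))).
Proof.
move=> gs; have /hsummableP gs' := gs; apply/funext => m; have [s sP] := gs' m.+1.
set s1 := undup (map fst s); set s2 := undup (map snd s).
have g0 i j : (i \notin s1) || (j \notin s2) -> g (i, j) m = 0.
  rewrite !mem_undup => h; rewrite sP //; apply: contraL h => h; rewrite negb_or !negbK.
  by apply/andP; split; apply/mapP; exists (i, j).
rewrite (@hsum_seq _ _ s1); last first.
  move=> i h; rewrite (@hsum_seq _ _ [::]) ?big_nil // => j _.
  by rewrite g0 // h.
rewrite (@hsum_seq _ _ [seq (i, j) | i <- s1, j <- s2]); last first.
  move=> [i j] h; rewrite g0 // -negb_and; apply: contra h => /andP[h1 h2].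
  by apply/allpairsP; exists (i, j).
have us1 : uniq s1 by exact: undup_uniq.
have us2 : uniq s2 by exact: undup_uniq.
rewrite undup_id; last by apply: allpairs_uniq => // -[? ?] [? ?].
rewrite big_allpairs undup_id //; apply: eq_bigr => i _.
rewrite (@hsum_seq _ _ s2) ?undup_id // => j js.
by rewrite g0 // js orbT.
Qed.

Lemma hsum_exchange (I J : choiceType) (g : I -> J -> hser V) :
  hsummable (fun t : I * J => g t.1 t.2) ->
  hsum (fun i => hsum (fun j => g i j)) = hsum (fun j => hsum (fun i => g i j)).
Proof.
move=> gs; rewrite -(hsum_pair gs).
pose sw (A B : choiceType) (t : (A * B)%type) : (B * A)%type := (t.2, t.1).
have e1 : cancel (sw J I) (sw I J) by case.
have e2 : cancel (sw I J) (sw J I) by case.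
rewrite (hsum_bij e1 e2 gs) hsum_pair //=.
exact: (hsummable_inj e1 gs).
Qed.

Lemma hsum_recl (g : nat -> hser V) : hsummable g ->
  hsum g = g 0%N + hsum (fun n => g n.+1).
Proof.
move=> gs; have /hsummableP gs' := gs.
pose g0 n := if n == 0%N then g 0%N else 0; pose g1 n := if n is n'.+1 then g n else 0.
have E : g =1 (fun n => g0 n + g1 n) by case=> [|n]; rewrite /g0 /g1 /= ?addr0 ?add0r.
have s1 : hsummable g1.
  apply/hsummableP => n; have [s sP] := gs' n; exists s => -[|t] // ts; exact: sP.
have s0 : hsummable g0 by apply: (@hsummable1 _ _ 0%N) => -[].
rewrite (eq_hsum E) hsumD //; congr (_ + _).
  by rewrite (@hsum1 _ _ 0%N) // => -[].
apply/funext => m; have /hsummableP s1' := s1; have [s sP] := s1' m.+1.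
have pred0 t : t.+1 \notin s -> g t.+1 m = 0 by move=> /sP h; exact: h.
rewrite (@hsum_seq _ _ (0%N :: map S (map predn s))); last first.
  case=> // t; rewrite inE /= (mem_map succn_inj) => h; apply: pred0.
  by apply: contra h => h; apply/mapP; exists t.+1.
rewrite (@hsum_seq _ _ (map predn s)); last first.
  by move=> t h; apply: pred0; apply: contra h => h; apply/mapP; exists t.+1.
rewrite /= ifF; last by apply/mapP => -[].
by rewrite big_cons add0r (undup_map_inj succn_inj) big_map.
Qed.
End Series.

(** * The ring of operator series with locally finite exponents *)

Section LaurentSeries.
Variables (K : numFieldType) (V : lmodType K).
Implicit Types (w : hser V) (A B C : ser V).

Definition coef_lin A := forall p, hlin (A p).

(** On a given vector and modulo a given power of [h], only finitely many powers
    of [u] occur. This makes the products of such series converge, in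
    contrast to [E^+(u) E^-(u)]. *)
Definition ufin A := coef_lin A /\ forall w, hsummable (fun p => A p w).

(** Finitely many [g i] matter modulo [h^n], and for each of them finitely many
    [j] do. *)
Lemma hsummable_dep (I J : choiceType) (T : I -> J -> hser V -> hser V)
    (g : I -> hser V) :
  (forall i j, hlin (T i j)) -> (forall i w, hsummable (fun j => T i j w)) ->
  hsummable g -> hsummable (fun t : I * J => T t.1 t.2 (g t.1)).
Proof.
move=> hT sT /hsummableP gs; apply/hsummableP => n; have [s sP] := gs n.
have /choice[f fP] : forall i, exists r : seq J, forall j, j \notin r ->
    vanish n (T i j (g i)) by move=> i; have /hsummableP := sT i (g i); apply.
exists [seq (i, j) | i <- s, j <- f i] => -[i j] ij /=.
have [is_|/sP] := boolP (i \in s); last exact: hlin_vanish.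
by apply: fP; apply: contra ij => jf; apply/allpairsPdep; exists i, j.
Qed.

Lemma smul_summable A B p w : coef_lin A -> ufin B ->
  hsummable (fun q => A q (B (p - q) w)).
Proof.
move=> hA [_ sB]; apply: (hsummable_lin hA).
by apply: (@hsummable_inj _ _ _ _ (fun q => p - q) (fun q => p - q) (B^~ w))
  => // q; rewrite opprB addrC subrK.
Qed.

Lemma smul2_summable A B w : ufin A -> ufin B ->
  hsummable (fun t : K * K => A t.2 (B t.1 w)).
Proof.
move=> [hA sA] [hB sB].
by apply: (@hsummable_dep _ _ (fun _ => A) (B^~ w)).
Qed.

Lemma smul_lin A B : coef_lin A -> ufin B -> coef_lin (smul A B).
Proof.
move=> hA fB p; apply: (@hlin_hsum _ _ _ (fun q w => A q (B (p - q) w))) => [q|w].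
  by apply: hlin_comp => //; case: fB.
exact: (smul_summable _ _ hA fB).
Qed.

Lemma smul_ufin A B : ufin A -> ufin B -> ufin (smul A B).
Proof.
move=> fA fB; have [hA _] := fA; split; first exact: smul_lin.
move=> w; rewrite /smul.
apply: (proj2 (@hsummable_pair _ _ _ _ (fun t : K * K => A t.2 (B (t.1 - t.2) w)) _)).
apply: (@hsummable_inj _ _ _ _ (fun t : K * K => (t.1 - t.2, t.2))
   (fun t => (t.1 + t.2, t.2)) (fun t => A t.2 (B t.1 w))) => [[x y]|] /=.
  by rewrite subrK.
exact: (smul2_summable w fA fB).
Qed.

(** Both sides sum the family [A_r B_s C_t w], which is summable because [B] and
    [C] are locally finite. The factor [A] may involve infinitely many powers of
    [u], as [E^-(u)] does. *)
Lemma smulA_lin A B C : coef_lin A -> ufin B -> ufin C ->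
  smul (smul A B) C = smul A (smul B C).
Proof.
move=> hA fB fC; apply/funext => p; apply/funext => w.
have [hB _] := fB; have [hC _] := fC.
rewrite /smul hsum_exchange /=; last first.
  apply: (hsummable_lin (fun t : K * K => hA t.2)).
  apply: (@hsummable_inj _ _ _ _ (fun t : K * K => (p - t.1, t.1 - t.2))
    (fun t => (p - t.1, p - t.1 - t.2)) (fun t => B t.2 (C t.1 w))) => [[x y]|] /=.
    by congr pair; ring.
  exact: (smul2_summable w fB fC).
apply: eq_hsum => q; rewrite (hsum_lin (hA q)); last exact: (smul_summable _ _ hB fC).
have e1 : cancel (fun s => s - q) (fun s => s + q) by move=> s; rewrite subrK.
have e2 : cancel (fun s => s + q) (fun s => s - q) by move=> s; rewrite addrK.
rewrite [RHS](hsum_bij e1 e2); last first.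
  apply: (@hsummable_lin _ _ _ (fun=> A q) (fun s => B s (C (p - q - s) w))) => //.
  exact: (smul_summable _ _ hB fC).
by apply: eq_hsum => s; congr (A q (B _ (C _ w))); ring.
Qed.

Lemma smulDl A A' B : coef_lin A -> coef_lin A' -> ufin B ->
  smul (sadd A A') B = sadd (smul A B) (smul A' B).
Proof.
move=> hA hA' fB; apply/funext => p; apply/funext => w.
by rewrite /smul /sadd hsumD //; [exact: (smul_summable _ _ hA fB)|exact: (smul_summable _ _ hA' fB)].
Qed.

Lemma smulDr A B B' : coef_lin A -> ufin B -> ufin B' ->
  smul A (sadd B B') = sadd (smul A B) (smul A B').
Proof.
move=> hA fB fB'; apply/funext => p; apply/funext => w.
rewrite /smul /sadd -hsumD; [|exact: (smul_summable _ _ hA fB)|exact: (smul_summable _ _ hA fB')].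
by apply: eq_hsum => q; rewrite (hlinD (hA q)).
Qed.

Lemma smul_constl T B p w : (smul (sconst T) B) p w = T (B p w).
Proof.
rewrite /smul (@hsum1 _ _ _ _ 0) /sconst ?eqxx ?subr0 // => q /negbTE ->.
by [].
Qed.

Lemma smul_constr T A p w : coef_lin A -> (smul A (sconst T)) p w = A p (T w).
Proof.
move=> hA; rewrite /smul (@hsum1 _ _ _ _ p) /sconst ?subrr ?eqxx // => q.
by rewrite eq_sym -subr_eq0 => /negbTE ->; rewrite (hlin0 (hA q)).
Qed.

Lemma const_ufin T : hlin T -> ufin (sconst T).
Proof.
move=> hT; split=> [p|w]; first by rewrite /sconst; case: eqP => // _; exact: hlin0f.
by apply: (@hsummable1 _ _ _ _ 0) => p /negbTE; rewrite /sconst => ->.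
Qed.

Lemma add_ufin A B : ufin A -> ufin B -> ufin (sadd A B).
Proof.
by move=> [hA sA] [hB sB]; split=> [p|w]; [exact: hlinDf|exact: hsummableD].
Qed.

Lemma opp_ufin A : ufin A -> ufin (sopp A).
Proof.
move=> [hA sA]; split=> [p|w]; first exact: hlinNf.
exact: (@hsummable_lin _ _ _ (fun=> -%R) _ (fun=> hlinNf (@hlin_id _ _))).
Qed.

Lemma zero_ufin : ufin (@szero K V).
Proof. by split=> [p|w]; [exact: hlin0f|exact: hsummable0]. Qed.

Record fser := FSer { fval :> K -> hser V -> hser V; fvalP : ufin fval }.

Lemma fserP (A B : fser) : (forall p w, A p w = B p w) -> A = B.
Proof.
case: A B => [A fA] [B fB] /= AB.
have E : A = B by apply/funext => p; apply/funext => w.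
by subst B; congr FSer; exact: Prop_irrelevance.
Qed.

HB.instance Definition _ := gen_eqMixin fser.
HB.instance Definition _ := gen_choiceMixin fser.

Definition fadd (A B : fser) := FSer (add_ufin (fvalP A) (fvalP B)).
Definition fopp (A : fser) := FSer (opp_ufin (fvalP A)).
Definition fmul (A B : fser) := FSer (smul_ufin (fvalP A) (fvalP B)).
Definition fconst T (hT : hlin T) := FSer (const_ufin hT).

Lemma faddA : associative fadd.
Proof. by move=> A B C; apply: fserP => p w; apply: addrA. Qed.
Lemma faddC : commutative fadd.
Proof. by move=> A B; apply: fserP => p w; apply: addrC. Qed.
Lemma fadd0 : left_id (FSer zero_ufin) fadd.
Proof. by move=> A; apply: fserP => p w; apply: add0r. Qed.
Lemma faddN : left_inverse (FSer zero_ufin) fopp fadd.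
Proof. by move=> A; apply: fserP => p w; apply: addNr. Qed.
HB.instance Definition _ := GRing.isZmodule.Build fser faddA faddC fadd0 faddN.

Lemma coefP (A : fser) : coef_lin A. Proof. by case: (fvalP A). Qed.
Hint Resolve coefP fvalP : core.

Lemma fmulA : associative fmul.
Proof.
by move=> A B C; apply: fserP => p w /=; rewrite smulA_lin.
Qed.
Lemma fmul1 : left_id (fconst (@hlin_id K V)) fmul.
Proof. by move=> A; apply: fserP => p w /=; rewrite smul_constl. Qed.
Lemma fmulr1 : right_id (fconst (@hlin_id K V)) fmul.
Proof. by move=> A; apply: fserP => p w /=; rewrite smul_constr. Qed.
Lemma fmulDl : left_distributive fmul fadd.
Proof. by move=> A B C; apply: fserP => p w /=; rewrite smulDl. Qed.
Lemma fmulDr : right_distributive fmul fadd.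
Proof. by move=> A B C; apply: fserP => p w /=; rewrite smulDr. Qed.
HB.instance Definition _ := GRing.Zmodule_isPzRing.Build fser fmulA fmul1 fmulr1
  fmulDl fmulDr.

Lemma fvalD (A B : fser) p w : (A + B) p w = A p w + B p w. Proof. by []. Qed.
Lemma fvalN (A : fser) p w : (- A) p w = - A p w. Proof. by []. Qed.
Lemma fvalM (A B : fser) p w : (A * B) p w = smul A B p w. Proof. by []. Qed.
Lemma fvalMn (A : fser) n p w : (A *+ n) p w = n%:R *: A p w.
Proof.
elim: n => [|n IH]; first by rewrite mulr0n scale0r.
by rewrite mulrS fvalD IH -natr1 scalerDl scale1r addrC.
Qed.
Lemma fval_sum I (r : seq I) P (F : I -> fser) p w :
  (\sum_(i <- r | P i) F i) p w = \sum_(i <- r | P i) F i p w.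
Proof. by elim/big_rec2: _ => // i x y _ <-. Qed.
Lemma fvalX (A : fser) n : fval (A ^+ n) = sexpn A n.
Proof. by elim: n => //= n IH; rewrite exprS /= -IH. Qed.

Lemma fmulrI n : injective (fun A : fser => A *+ n.+1).
Proof.
move=> A B AB; apply: fserP => p w.
have n0 : n.+1%:R != 0 :> K by rewrite pnatr_eq0.
have := fvalMn A n.+1 p w; rewrite AB fvalMn => E.
by rewrite -[LHS]scale1r -[RHS]scale1r -(mulVf n0) -!scalerA E.
Qed.

End LaurentSeries.
#[global] Hint Resolve coefP fvalP : core.

(** * Newton recursions *)

Section Newton.
Variable R : pzRingType.
Hypothesis mulnI : forall n, injective (fun x : R => x *+ n.+1).
Implicit Types (y z mu : nat -> R) (T I : R).

(** This says that [sum_n mu_n v^n] is the exponential of [sum_k y_k v^k / k]: it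
    is the coefficient of [v^n] in [v d/dv mu(v) = (sum_k y_k v^k) mu(v)]. *)
Definition newton y mu :=
  mu 0%N = 1 /\ forall n, mu n *+ n = \sum_(k < n) y k.+1 * mu (n - k.+1)%N.

(** The coefficients of [(1 - I v) mu(v)]. *)
Definition lag I mu n := if n is n'.+1 then mu n - I * mu n' else mu 0%N.

(** The inverse of [1 - I v] is [sum_k I^k v^k]. *)
Lemma lag_sum I mu n : \sum_(k < n.+1) I ^+ k * lag I mu (n - k)%N = mu n.
Proof.
elim: n => [|n IH]; first by rewrite big_ord1 expr0 mul1r.
rewrite big_ord_recl expr0 mul1r subn0 /=.
under eq_bigr => k _ do rewrite exprS -mulrA /bump /= add1n subSS.
by rewrite -mulr_sumr IH subrK.
Qed.

(** The factor [1 - I v] is the exponential of [- sum_k I^k v^k / k]. *)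
Lemma newton_lag I y mu : (forall k, GRing.comm I (y k)) ->
  newton y mu -> newton (fun k => y k - I ^+ k) (lag I mu).
Proof.
move=> cI [mu0 muS]; split=> // -[|n]; first by rewrite big_ord0 mulr0n.
under eq_bigr => k _ do rewrite subSS mulrBl exprS -mulrA.
rewrite sumrB -mulr_sumr lag_sum /= mulrnBl muS.
rewrite -[I * mu n *+ n.+1]mulrnAr mulrS muS mulrDr opprD addrA addrAC; congr (_ - _).
rewrite mulr_sumr !big_ord_recr /= subSS subnn /= addrAC; congr (_ + _).
rewrite -sumrB; apply: eq_bigr => k _.
rewrite subSS mulrA cI -mulrA -mulrBr; congr (_ * _).
by rewrite -[(n - k)%N]prednK ?subn_gt0 //= subnS.
Qed.

(** The recursion determines [mu_n] from the [y_k], and [T] carries the recursion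
    for [mu] to that for [nu]; [mulnI] cancels the factor [n]. *)
Lemma newton_intertwine T y z mu nu : newton y mu -> newton z nu ->
  (forall k, T * y k.+1 = z k.+1 * T) -> forall n, T * mu n = nu n * T.
Proof.
move=> [mu0 muS] [nu0 nuS] Ty n; have [m] := ubnP n; elim: m n => // m IH [|n] nm.
  by rewrite mu0 nu0 mulr1 mul1r.
apply: (@mulnI n) => /=.
rewrite -mulrnAr muS -mulrnAl nuS mulr_sumr mulr_suml; apply: eq_bigr => k _.
rewrite mulrA Ty -!mulrA IH // subSS.
by rewrite ltnS in nm; apply: leq_ltn_trans nm; apply: leq_subr.
Qed.
End Newton.

(** * Exponentials of locally nilpotent series *)

Section Exponential.
Variables (K : numFieldType) (V : lmodType K).
Implicit Types (w : hser V) (A B x c : fser V).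

Lemma summable_subl B p w : hsummable (fun q => B (p - q) w).
Proof.
apply: (@hsummable_inj _ _ _ _ (fun q => p - q) (fun q => p - q) (B^~ w)).
  by move=> q; rewrite opprB addrC subrK.
by case: (fvalP B).
Qed.

(** On a given vector and modulo a given power of [h], the high powers of [A]
    vanish, whatever the power of [u]. *)
Definition pronil A := forall w n, exists d, forall N p, (d <= N)%N ->
  vanish n ((A ^+ N) p w).

Local Notation eterm A N p w := ((N`!%:R : K)^-1 *: (A ^+ N) p w).

Lemma exp_summable A : pronil A -> forall w,
  hsummable (fun t : nat * K => eterm A t.1 t.2 w).
Proof.
move=> nA w; apply: (@hsummable_lin _ _ _ (fun t w => (t.1`!%:R)^-1 *: w)) => [t|].
  exact: hlinZf (@hlin_id _ _).
apply/hsummableP => n; have [d dP] := nA w n.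
have /choice[f fP] : forall N, exists r : seq K, forall p, p \notin r ->
    vanish n ((A ^+ N) p w).
  by move=> N; have [_ /(_ w)/hsummableP] := fvalP (A ^+ N); apply.
exists [seq (N, p) | N <- iota 0 d, p <- f N] => -[N p] /= h.
have [dN|Nd] := leqP d N; first exact: dP.
apply: fP; apply: contra h => h; apply/allpairsPdep; exists N, p.
by rewrite mem_iota.
Qed.

Lemma sexpE A p w : sexp A p w = hsum (fun N => eterm A N p w).
Proof. by rewrite /sexp /ssum; apply: eq_hsum => N; rewrite fvalX. Qed.

Lemma exp_summable1 A : pronil A -> forall p w, hsummable (fun N => eterm A N p w).
Proof.
move=> nA p w; apply: (@hsummable_inj _ _ _ _ (fun N => (N, p)) fst _ _ (exp_summable nA w)).
by [].
Qed.

Lemma sexp_ufin A : pronil A -> ufin (sexp A).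
Proof.
move=> nA; split=> [p|w].
  rewrite (_ : sexp A p = fun w => hsum (fun N => eterm A N p w)); last first.
    by apply/funext => w; rewrite sexpE.
  apply: (@hlin_hsum _ _ _ (fun N w => eterm A N p w)) => [N|w].
    by apply: hlinZf; apply: coefP.
  exact: exp_summable1.
apply: (eq_hsummable (g := fun p => hsum (fun N => eterm A N p w))).
  by move=> p; rewrite sexpE.
apply: (proj2 (@hsummable_pair _ _ _ _ (fun t : K * nat => eterm A t.2 t.1 w) _)).
by apply: (@hsummable_inj _ _ _ _ (fun t : K * nat => (t.2, t.1)) (fun t => (t.2, t.1))
  _ _ (exp_summable nA w)) => -[].
Qed.

Definition fexp A (nA : pronil A) : fser V := FSer (sexp_ufin nA).

Lemma fexpE A (nA : pronil A) p w : fexp nA p w = hsum (fun N => eterm A N p w).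
Proof. exact: sexpE. Qed.

(** Summability of the double family that defines [exp A] times [B] allows its two
    summations to be exchanged in [fexp_mulr]. *)
Lemma exp_mulr_summable2 A (nA : pronil A) B p w :
  hsummable (fun t : K * nat => eterm A t.2 t.1 (B (p - t.1) w)).
Proof.
apply: (@hsummable_dep _ _ _ _ (fun q N w => eterm A N q w) (fun q => B (p - q) w)) => [q N|q w'|].
- by apply: hlinZf; apply: coefP.
- exact: exp_summable1.
exact: summable_subl.
Qed.

Lemma exp_mull_summable2 A (nA : pronil A) B p w :
  hsummable (fun t : K * nat => B t.1 (eterm A t.2 (p - t.1) w)).
Proof.
apply: (@hsummable_inj _ _ _ _ (fun t : K * nat => ((t.2, p - t.1), t.1))
  (fun t => (t.2, t.1.1)) (fun t => B t.2 (eterm A t.1.1 t.1.2 w))) => [[q N] //|].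
apply: (@hsummable_dep _ _ _ _ (fun _ => B) (fun t : nat * K => eterm A t.1 t.2 w)).
- by move=> *; apply: coefP.
- by case: (fvalP B).
by apply: exp_summable.
Qed.

Lemma hsummable_swap (I J : choiceType) (g : I * J -> hser V) :
  hsummable g -> hsummable (fun t : J * I => g (t.2, t.1)).
Proof.
by apply: (@hsummable_inj _ _ _ _ (fun t : J * I => (t.2, t.1)) (fun t => (t.2, t.1))) => -[].
Qed.

Lemma exp_mulrE A N B p w : (N`!%:R : K)^-1 *: (A ^+ N * B) p w =
  hsum (fun q => eterm A N q (B (p - q) w)).
Proof.
rewrite -(hsum_lin (hlinZf _ (@hlin_id _ _))) //.
exact: smul_summable.
Qed.

Lemma exp_mullE A N B p w : (N`!%:R : K)^-1 *: (B * A ^+ N) p w =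
  hsum (fun q => B q (eterm A N (p - q) w)).
Proof.
rewrite (eq_hsum (fun q => hlinZ (@coefP _ _ B q) _ _)).
rewrite -(hsum_lin (hlinZf _ (@hlin_id _ _))) //.
exact: smul_summable.
Qed.

Lemma exp_mulr_summable A (nA : pronil A) B p w :
  hsummable (fun N => (N`!%:R : K)^-1 *: (A ^+ N * B) p w).
Proof.
apply: (eq_hsummable (g := fun N => hsum (fun q => eterm A N q (B (p - q) w)))).
  by move=> N; rewrite exp_mulrE.
exact: (proj2 (hsummable_pair (hsummable_swap (exp_mulr_summable2 nA B p w)))).
Qed.

Lemma exp_mull_summable A (nA : pronil A) B p w :
  hsummable (fun N => (N`!%:R : K)^-1 *: (B * A ^+ N) p w).
Proof.
apply: (eq_hsummable (g := fun N => hsum (fun q => B q (eterm A N (p - q) w)))).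
  by move=> N; rewrite exp_mullE.
exact: (proj2 (hsummable_pair (hsummable_swap (exp_mull_summable2 nA B p w)))).
Qed.

Lemma fexp_mulr A (nA : pronil A) B p w :
  (fexp nA * B) p w = hsum (fun N => (N`!%:R : K)^-1 *: (A ^+ N * B) p w).
Proof.
rewrite (eq_hsum (fun N => exp_mulrE A N B p w)).
rewrite -hsum_exchange; last exact: exp_mulr_summable2.
by rewrite fvalM /smul; apply: eq_hsum => q; rewrite fexpE.
Qed.

Lemma fexp_mull A (nA : pronil A) B p w :
  (B * fexp nA) p w = hsum (fun N => (N`!%:R : K)^-1 *: (B * A ^+ N) p w).
Proof.
rewrite (eq_hsum (fun N => exp_mullE A N B p w)).
rewrite -hsum_exchange; last exact: exp_mull_summable2.
rewrite fvalM /smul; apply: eq_hsum => q.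
by rewrite fexpE (hsum_lin (@coefP _ _ B q)) //; exact: exp_summable1.
Qed.

(** Moving [x] through the [N + 1] factors [a] creates [N + 1] times the term
    [c a^N], as [c] commutes with [a]. *)
Lemma exprn_conj (R : pzRingType) (a x c : R) : a * x = x * a + c -> c * a = a * c ->
  forall N, a ^+ N.+1 * x = x * a ^+ N.+1 + c * a ^+ N *+ N.+1.
Proof.
move=> ax ca; have cX N : c * a ^+ N = a ^+ N * c by apply: commrX.
elim=> [|N IH]; first by rewrite !expr1 expr0 mulr1.
have -> : a ^+ N.+2 * x = (x * a ^+ N.+1 + c * a ^+ N *+ N.+1) * a + c * a ^+ N.+1.
  by rewrite -IH exprSr -!mulrA ax mulrDr cX.
rewrite mulrDl mulrnAl -!mulrA -!exprSr -addrA; congr (_ + _).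
by rewrite [RHS]mulrSr.
Qed.

(** Divide [A^N x = x A^N + N c A^(N-1)] by [N!] and sum over [N]. *)
Lemma fexp_conj A (nA : pronil A) x c : A * x = x * A + c -> c * A = A * c ->
  fexp nA * x = (x + c) * fexp nA.
Proof.
move=> Ax cA; apply: fserP => p w.
have sB B := exp_mull_summable nA B p w.
rewrite mulrDl fvalD !fexp_mull fexp_mulr hsum_recl; last exact: exp_mulr_summable.
rewrite [hsum (fun N => _ *: (x * _) p w)]hsum_recl // -addrA -hsumD //; last first.
  exact: (@hsummable_inj _ _ _ _ succn predn _ _ (sB x)).
rewrite expr0 mul1r mulr1; congr (_ + _); apply: eq_hsum => N.
rewrite (exprn_conj Ax cA) fvalD scalerDr fvalMn scalerA; congr (_ + _ *: _).
rewrite factS natrM invfM mulrC mulrA mulfV ?mul1r //.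
by rewrite pnatr_eq0.
Qed.
End Exponential.

(** * Generalized binomial coefficients *)

Section Binomial.
Variable K : numFieldType.
Implicit Types (b x p : K).

Lemma gbinom0 x : gbinom x 0 = 1.
Proof. by rewrite /gbinom big_ord0 fact0 divr1. Qed.

Lemma fact_neq0 m : m`!%:R != 0 :> K.
Proof. by rewrite pnatr_eq0 -lt0n fact_gt0. Qed.

Lemma gbinom_pascal x m : gbinom (x + 1) m.+1 = gbinom x m.+1 + gbinom x m.
Proof.
rewrite /gbinom big_ord_recl /= subr0.
under eq_bigr => l _ do rewrite /bump /= natrD opprD addrA addrK.
rewrite [\prod_(l < m.+1) _]big_ord_recr /= factS natrM.
have := fact_neq0 m; have : m.+1%:R != 0 :> K by rewrite pnatr_eq0.
by rewrite -natr1 => h h'; field; rewrite h' h.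
Qed.

(** Both sides are [x (x - 1) ... (x - j - l + 1) / (j! l!)]. *)
Lemma gbinom_split x j l : gbinom x j * gbinom (x - j%:R) l = gbinom x (j + l) * 'C(j + l, j)%:R.
Proof.
rewrite /gbinom big_split_ord /=.
under [X in X / l`!%:R]eq_bigr => i _ do rewrite -addrA -opprD -natrD.
have E : 'C(j + l, j)%:R * (j`!%:R * l`!%:R) = (j + l)`!%:R :> K.
  by rewrite -!natrM -{2}(addKn j l) bin_fact // leq_addr.
rewrite -E; have := fact_neq0 j; have := fact_neq0 l => h h'.
have h'' : 'C(j + l, j)%:R != 0 :> K by rewrite pnatr_eq0 -lt0n bin_gt0 leq_addr.
by field; rewrite h h' h''.
Qed.

(** Both sides are the ordinary binomial coefficient of [k + j] over [j]. *)
Lemma gbinom_nat k j : k.+1%:R / (k.+1 + j)%:R * gbinom (k.+1 + j)%:R j =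
  (-1) ^+ j * gbinom (- k.+1%:R) j :> K.
Proof.
rewrite /gbinom mulrA [RHS]mulrA; congr (_ / _).
have -> : (-1) ^+ j = \prod_(i < j) (-1) :> K by rewrite prodr_const card_ord.
rewrite -big_split /=.
have -> : \prod_(i < j) ((k.+1 + j)%:R - i%:R) = \prod_(i < j) (k.+1%:R + i.+1%:R) :> K.
  rewrite [RHS](reindex_inj rev_ord_inj) /=; apply: eq_bigr => i _.
  by rewrite subnSK // natrB ?natrD ?addrA // ltnW.
have -> : \prod_(i < j) (-1 * (- k.+1%:R - i%:R)) = \prod_(i < j) (k.+1%:R + i%:R) :> K.
  by apply: eq_bigr => i _; rewrite mulN1r opprB opprK addrC.
have E : k.+1%:R * \prod_(i < j) (k.+1%:R + i.+1%:R) =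
    (k.+1 + j)%:R * \prod_(i < j) (k.+1%:R + i%:R) :> K.
  have := big_ord_recl j (fun i : 'I_j.+1 => k.+1%:R + i%:R : K) (op := *%R) (idx := 1).
  by rewrite big_ord_recr /= addr0 -natrD mulrC => ->.
have n0 : (k.+1 + j)%:R != 0 :> K by rewrite pnatr_eq0.
by apply: (mulfI n0); rewrite -E [LHS]mulrA [_ * (_ / _)]mulrC divfK.
Qed.

(** The expansion of [(u + b h)^(x+1) = (u + b h) (u + b h)^x]. *)
Lemma upow_pascal b x p l : upow b (x + 1) p l =
  upow b x (p - 1) l + b * (if l is l'.+1 then upow b x p l' else 0).
Proof.
rewrite /upow subr_eq addrAC; case: l => [|l].
  by rewrite mulr0 addr0; case: ifP => // _; rewrite !gbinom0.
have -> : x - l.+1%:R + 1 = x - l%:R by rewrite -natr1; ring.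
by case: eqP => _; rewrite ?gbinom_pascal ?exprS; ring.
Qed.

(** The expansion of [(1 + b h/u)^(x+1) = (1 + b h/u) (1 + b h/u)^x]. *)
Lemma vpow_pascal b x p l : vpow b (x + 1) p l =
  vpow b x p l + b * (if l is l'.+1 then vpow b x (p + 1) l' else 0).
Proof.
rewrite /vpow; case: l => [|l].
  by rewrite mulr0 addr0; case: ifP => // _; rewrite !gbinom0.
have -> : (p + 1 == - l%:R) = (p == - l.+1%:R).
  by rewrite -natr1 opprD -subr_eq opprK.
by case: eqP => _; rewrite ?gbinom_pascal ?exprS; ring.
Qed.

Lemma upowE b x l l' : upow b x (x - l%:R) l' = if l' == l then gbinom x l * b ^+ l else 0.
Proof.
rewrite /upow (inj_eq (addrI x)) (inj_eq oppr_inj) eqr_nat eq_sym.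
by case: eqP => // ->.
Qed.
End Binomial.

(** * Central scalar series *)

Section Scalars.
Variables (K : numFieldType) (V : lmodType K).
Implicit Types (w : hser V) (A : fser V) (b x p k : K) (c : K -> nat -> K).

Lemma eq_hmul (c d : nat -> K) w : c =1 d -> hmul c w = hmul d w.
Proof. by move=> /funext ->. Qed.

Lemma hmulZl b (c : nat -> K) w : b *: hmul c w = hmul (fun l => b * c l) w.
Proof.
apply/funext => m; rewrite -[LHS]/(b *: _) /hmul scaler_sumr.
by apply: eq_bigr => i _; rewrite scalerA.
Qed.

Lemma hmul0l w : hmul (fun _ : nat => 0 : K) w = 0.
Proof. by apply/funext => m; rewrite /hmul big1 // => i _; rewrite scale0r. Qed.

Definition sfin c := forall n, exists s : seq K, forall p, p \notin s ->
  forall l, (l < n)%N -> c p l = 0.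

Lemma smono_ufin c T : sfin c -> hlin T -> ufin (smono c T : ser V).
Proof.
move=> fc hT; split=> [p|w]; first by apply: hlin_comp => //; exact: hlin_hmul.
apply/hsummableP => n; have [s sP] := fc n; exists s => p /sP cp m mn.
rewrite /smono /hmul big1 // => l _; rewrite cp ?scale0r //.
by apply: leq_trans mn; rewrite ltnS -ltnS ltn_ord.
Qed.

Definition fscal c (fc : sfin c) : fser V := FSer (smono_ufin fc (@hlin_id K V)).

(** The coefficients of [A] are linear over [K[[h]]]. *)
Lemma fscal_comm c (fc : sfin c) A : fscal fc * A = A * fscal fc.
Proof.
apply: fserP => p w; rewrite !fvalM /smul /= /smono.
rewrite (@hsum_bij _ _ _ _ (fun q => p - q) (fun q => p - q)); last 1 first.
- by apply: (@smul_summable _ _ (fscal fc)).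
- by apply: eq_hsum => q; rewrite (hlinM (coefP _ _)); congr (hmul _ (A _ _)); ring.
- by move=> q; ring.
by move=> q; ring.
Qed.

Lemma upow_sfin b x : sfin (upow b x).
Proof.
move=> n; exists [seq x - l%:R | l <- iota 0 n] => p ps l ln.
rewrite /upow; case: eqP => // E; case/mapP: ps; exists l => //.
by rewrite mem_iota.
Qed.

Lemma uhmono_sfin b k l : sfin (fun p m => if (p == k) && (m == l) then b else 0).
Proof.
by move=> n; exists [:: k] => p; rewrite inE => /negbTE ->.
Qed.

(** The scalar [b u^k h^l]. *)
Definition uhmono b k l := fscal (uhmono_sfin b k l).

(** The scalar [(u + b h)^x]. *)
Definition fupow b x := fscal (upow_sfin b x).

Lemma uhmono_mul b k l A p w : (uhmono b k l * A) p w = b *: hmul (hmono K l) (A (p - k) w).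
Proof.
rewrite fvalM /smul (@hsum1 _ _ _ _ k) /= /smono => [|q qk].
  rewrite eqxx /=; apply/funext => m; rewrite -[RHS]/(b *: _) /hmul scaler_sumr.
  apply: eq_bigr => i _; rewrite scalerA /hmono; congr (_ *: _).
  by case: eqP; rewrite ?mulr1 ?mulr0.
by apply/funext => m; rewrite /hmul (negbTE qk) big1 // => i _; rewrite scale0r.
Qed.

Lemma hmul_hmono_hmul l (c : nat -> K) w : hmul (hmono K l) (hmul c w) =
  hmul (fun m => if (l <= m)%N then c (m - l)%N else 0) w.
Proof.
apply/funext => m; rewrite hmul_hmono /hmul; case: leqP => [lm|ml]; last first.
  by rewrite big1 // => i _; rewrite leqNgt (leq_trans _ ml) ?scale0r // ltnS -ltnS.
rewrite -(subnK lm) addnK; set d := (m - l)%N.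
have E : (l + d.+1 = (d + l).+1)%N by rewrite addnS addnC.
rewrite -[in RHS]E big_split_ord /= [X in _ = X + _]big1 ?add0r => [|i _]; last first.
  by rewrite leqNgt ltn_ord scale0r.
by apply: eq_bigr => i _; rewrite leq_addr addKn addnC subnDl.
Qed.

Lemma uhmonoM b b' k k' l l' : uhmono b k l * uhmono b' k' l' = uhmono (b * b') (k + k') (l + l')%N.
Proof.
apply: fserP => p w; rewrite uhmono_mul /= /smono hmul_hmono_hmul hmulZl; apply: eq_hmul => m.
rewrite subr_eq [k' + k]addrC; case: (p == _); rewrite /= ?if_same ?mulr0 //.
case: leqP => lm; last by rewrite mulr0 ltn_eqF // ltn_addr.
by rewrite -(eqn_add2l l) subnKC //; case: eqP; rewrite ?mulr0.
Qed.

Lemma hmul_hmono0 w : hmul (hmono K 0) w = w. Proof. exact: hmul1. Qed.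

(** The scalar [u + b h]. *)
Definition uplus b := uhmono 1 1 0 + uhmono b 0 1.

Lemma fupow0 b : fupow b 0 = 1.
Proof.
apply: fserP => p w; rewrite /= /smono /sconst.
case: eqP => [->|p0].
  apply: hmul1 => -[|l]; rewrite /upow ?sub0r; first by rewrite mulr0n oppr0 !eqxx gbinom0 expr0 mulr1.
  by rewrite eq_sym oppr_eq0 pnatr_eq0.
rewrite -[RHS](hmul0l w); apply: eq_hmul => -[|l]; rewrite /upow.
  by rewrite subr0; case: eqP.
by rewrite /gbinom big_ord_recl subrr !mul0r if_same.
Qed.

Lemma fupowD1 b x : fupow b (x + 1) = uplus b * fupow b x.
Proof.
apply: fserP => p w; rewrite mulrDl fvalD !uhmono_mul /= /smono scale1r.
rewrite hmul_hmono0 hmul_hmono_hmul hmulZl subr0 -hmulDl; apply: eq_hmul => -[|l] //.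
  exact: upow_pascal.
by rewrite upow_pascal -[RHS]/(_ + b * _) /= subn1.
Qed.

Lemma fupowN b n : fupow b (- n%:R) = fupow b (-1) ^+ n.
Proof.
have U1 : fupow b (-1) * uplus b = 1 by rewrite fscal_comm -fupowD1 addNr fupow0.
elim: n => [|n IH]; first by rewrite oppr0 fupow0.
by rewrite exprS -IH -[in RHS](subrK 1 (- n%:R)) fupowD1 mulrA U1 mul1r -natr1 opprD.
Qed.
End Scalars.

(** * Exponentials of series in nonnegative powers of [u] *)

Section TaylorSeries.
Variables (K : numFieldType) (V : lmodType K).
Implicit Types (w : hser V) (A B : ser V).

Definition nat_supp A := forall p, (exists n : nat, p = n%:R) \/ forall w, A p w = 0.

Lemma hsum_nat (g : K -> hser V) n :
  (forall q, (exists2 k : nat, (k <= n)%N & q = k%:R) \/ g q = 0) ->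
  hsum g = \sum_(k < n.+1) g k%:R.
Proof.
move=> g0; apply/funext => m.
rewrite (@hsum_seq _ _ _ _ [seq k%:R | k <- iota 0 n.+1]).
  rewrite (undup_map_inj (mulrIn (oner_neq0 K))) undup_id ?iota_uniq // big_map.
  by rewrite fct_sumE -[iota _ _]/(index_iota 0 n.+1) big_mkord.
move=> q qs; case: (g0 q) => [[k kn E]|-> //]; case/mapP: qs; exists k => //.
by rewrite mem_iota ltnS.
Qed.

Lemma smul_nat_supp A B n w : coef_lin A -> nat_supp A -> nat_supp B ->
  smul A B n%:R w = \sum_(k < n.+1) A k%:R (B (n - k)%:R w).
Proof.
move=> hA sA sB; rewrite /smul (@hsum_nat _ n).
  by apply: eq_bigr => k _; rewrite natrB // -ltnS.
move=> q; case: (sA q) => [[k ->]|]; last by move=> ->; right.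
case: (sB (n%:R - k%:R)) => [[j]|->]; last by right; rewrite (hlin0 (hA _)).
move/eqP; rewrite subr_eq -natrD eqr_nat => /eqP ->; left; exists k => //.
exact: leq_addl.
Qed.

Lemma nat_supp_smul A B : coef_lin A -> nat_supp A -> nat_supp B -> nat_supp (smul A B).
Proof.
move=> hA sA sB p.
have [|np] := pselect (exists n : nat, p = n%:R); first by left.
right=> w; rewrite /smul -[RHS](hsum0 V K); apply: eq_hsum => q.
case: (sA q) => [[k ->]|//]; case: (sB (p - k%:R)) => [[j E]|->]; last exact: hlin0.
by case: np; exists (j + k)%N; rewrite natrD -E subrK.
Qed.

Lemma nat_supp_one : nat_supp (@sone K V).
Proof.
move=> p; rewrite /sone /sconst; have [->|_] := eqVneq p 0; last by right.
by left; exists 0%N.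
Qed.

Lemma hsum_bigsum (I : choiceType) (n : nat) (g : 'I_n -> I -> hser V) :
  (forall k, hsummable (g k)) ->
  hsum (fun t => \sum_(k < n) g k t) = \sum_(k < n) hsum (g k).
Proof.
elim: n g => [|n IH] g gs.
  by rewrite big_ord0 -[RHS](hsum0 V I); apply: eq_hsum => t; rewrite big_ord0.
rewrite big_ord_recl -IH // -hsumD //; last first.
  elim: n g gs {IH} => [|n IH] g gs.
    by apply: eq_hsummable (hsummable0 V I) => t; rewrite big_ord0.
  have := hsummableD (gs (lift ord0 ord0)) (IH (fun k => g (lift ord0 k)) (fun k => gs _)).
  by apply: eq_hsummable => t; rewrite big_ord_recl.
by apply: eq_hsum => t; rewrite big_ord_recl.
Qed.

Section Exp.
Variable A : ser V.
Hypotheses (hA : coef_lin A) (sA : nat_supp A) (A0 : forall w, A 0 w 0%N = 0).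
Hypothesis AC : forall k l w, A k (A l w) = A l (A k w).

Local Notation P := (sexpn A).
Let E := sexp A.

Lemma sexpn_nat_supp N : nat_supp (P N).
Proof. by elim: N => [|N IH]; [exact: nat_supp_one|exact: nat_supp_smul]. Qed.

Lemma sexpn_natS N n w : P N.+1 n%:R w = \sum_(k < n.+1) A k%:R (P N (n - k)%:R w).
Proof. by apply: smul_nat_supp => //; exact: sexpn_nat_supp. Qed.

Lemma sexpn_nat0 n w : P 0 n%:R w = if n == 0%N then w else 0.
Proof. by rewrite /= /sone /sconst pnatr_eq0. Qed.

Lemma hlin_bigsum (I : Type) (r : seq I) (T : I -> hser V -> hser V) :
  (forall i, hlin (T i)) -> hlin (fun w => \sum_(i <- r) T i w).
Proof.
move=> hT; split=> [w w'|c w].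
  by rewrite -big_split; apply: eq_bigr => i _; exact: hlinD.
by rewrite (hlin_sum (hlin_hmul V c)); apply: eq_bigr => i _; exact: hlinM.
Qed.

Lemma sexpn_lin N : coef_lin (P N).
Proof.
elim: N => [|N IH] p; first by case: (const_ufin (@hlin_id K V)) => h _; apply: h.
case: (sexpn_nat_supp N.+1 p) => [[n ->]|h].
  have -> : P N.+1 n%:R = fun w => \sum_(k < n.+1) A k%:R (P N (n - k)%:R w).
    by apply/funext => w; exact: sexpn_natS.
  by apply: hlin_bigsum => k; apply: hlin_comp.
by have -> : P N.+1 p = fun _ => 0; [apply/funext|exact: hlin0f].
Qed.

(** Among the [N] factors that contribute to [u^n], at least [N - n] are the
    constant coefficient of [A], which is divisible by [h]. *)
Lemma sexpn_vanish N n w : vanish (N - n)%N (P N n%:R w).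
Proof.
elim: N n => [|N IH] n m; first by rewrite sub0n.
rewrite ltn_subRL => mn; rewrite sexpn_natS fct_sumE big1 // => -[[|k] kn] _ /=.
  rewrite subn0; have [->|m0] := posnP m; first exact: A0.
  have -> : P N n%:R w = hmul (hmono K (N - n)%N) (fun m => P N n%:R w (m + (N - n))%N).
    apply/funext => j; rewrite hmul_hmono; case: leqP => [h|]; first by rewrite subnK.
    exact: IH.
  rewrite (hlinM (hA _)) hmul_hmono; case: leqP => // h.
  by have -> : (m - (N - n) = 0)%N by lia.
apply: (hlin_vanish (hA _) (IH _)); lia.
Qed.

Lemma sexpn_summable n w : hsummable (fun N => (N`!%:R : K)^-1 *: P N n%:R w).
Proof.
apply: (@hsummable_lin _ _ _ (fun N w => (N`!%:R : K)^-1 *: w)) => [N|].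
  exact: hlinZf (@hlin_id _ _).
apply/hsummableP => M; exists (iota 0 (M + n)) => N.
rewrite mem_iota /= add0n -leqNgt => h m mM; apply: sexpn_vanish.
lia.
Qed.

Lemma sexp_natE n w : E n%:R w = hsum (fun N => (N`!%:R : K)^-1 *: P N n%:R w).
Proof. by []. Qed.

Lemma sexp_nat_supp : nat_supp E.
Proof.
move=> p; have [|np] := pselect (exists n : nat, p = n%:R); first by left.
right=> w; rewrite /E /sexp /ssum -[RHS](hsum0 V nat); apply: eq_hsum => N.
apply/funext => m; case: (sexpn_nat_supp N p) => [//|->]; exact: scaler0.
Qed.

Lemma sexp_lin : coef_lin E.
Proof.
move=> p; case: (sexp_nat_supp p) => [[n ->]|h].
  apply: (@hlin_hsum _ _ _ (fun N w => (N`!%:R : K)^-1 *: P N n%:R w)) => [N|w].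
    by apply: hlinZf; apply: sexpn_lin.
  exact: sexpn_summable.
by have -> : E p = fun _ => 0; [apply/funext|exact: hlin0f].
Qed.

Lemma sexpn_coef_comm S N p w : hlin S -> (forall q w, S (A q w) = A q (S w)) ->
  S (P N p w) = P N p (S w).
Proof.
move=> hS SA; elim: N p w => [|N IH] p w.
  by rewrite /= /sone /sconst; case: ifP => // _; exact: hlin0.
case: (sexpn_nat_supp N.+1 p) => [[n ->]|h]; last by rewrite !h hlin0.
by rewrite !sexpn_natS (hlin_sum hS); apply: eq_bigr => k _; rewrite SA IH.
Qed.

Lemma sexp_coef_comm S p w : hlin S -> (forall q w, S (A q w) = A q (S w)) ->
  S (E p w) = E p (S w).
Proof.
move=> hS SA; case: (sexp_nat_supp p) => [[n ->]|h]; last by rewrite !h hlin0.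
rewrite !sexp_natE (hsum_lin hS); last exact: sexpn_summable.
by apply: eq_hsum => N; rewrite (hlinZ hS) sexpn_coef_comm.
Qed.

(** The derivation [u d/du] maps [A^(N+1)] to [(N + 1) (u d/du A) A^N], since the
    coefficients of [A] commute. *)
Lemma sexpn_euler N n w : n%:R *: P N.+1 n%:R w =
  N.+1%:R *: \sum_(k < n.+1) k%:R *: A k%:R (P N (n - k)%:R w).
Proof.
elim: N n w => [|N IH] n w.
  rewrite sexpn_natS scale1r scaler_sumr; apply: eq_bigr => k _.
  rewrite sexpn_nat0 subn_eq0; case: leqP => nk; last by rewrite (hlin0 (hA _)) !scaler0.
  by congr (_%:R *: _); apply/eqP; rewrite eqn_leq nk -ltnS /=.
rewrite sexpn_natS scaler_sumr.
have -> : \sum_(k < n.+1) n%:R *: A k%:R (P N.+1 (n - k)%:R w) =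
  \sum_(k < n.+1) k%:R *: A k%:R (P N.+1 (n - k)%:R w) +
  \sum_(k < n.+1) A k%:R ((n - k)%:R *: P N.+1 (n - k)%:R w).
  rewrite -big_split; apply: eq_bigr => k _ /=.
  by rewrite (hlinZ (hA _)) -scalerDl -natrD subnKC // -ltnS.
rewrite -[N.+2%:R]natr1 addrC scalerDl scale1r; congr (_ + _).
transitivity (\sum_(k < n.+1) \sum_(l < n.+1 | (k + l <= n)%N)
   N.+1%:R *: (l%:R *: A k%:R (A l%:R (P N (n - (k + l))%:R w)))).
  apply: eq_bigr => k _; rewrite IH (hlinZ (hA _)) (hlin_sum (hA _)) scaler_sumr.
  rewrite (big_ord_widen n.+1 (fun l => N.+1%:R *: A k%:R (l%:R *: A l%:R (P N (n - k - l)%:R w)))) ?ltnS ?leq_subr //.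
  apply: eq_big => l; first by rewrite ltnS leq_subRL // -ltnS.
  by rewrite (hlinZ (hA _)) subnDA.
rewrite (exchange_big_dep predT) // scaler_sumr; apply: eq_bigr => l _.
rewrite sexpn_natS (hlin_sum (hA _)) !scaler_sumr.
rewrite (big_ord_widen n.+1 (fun k => N.+1%:R *: (l%:R *: A l%:R (A k%:R (P N (n - l - k)%:R w))))) ?ltnS ?leq_subr //.
apply: eq_big => [k|k _]; first by rewrite /= ltnS leq_subRL 1?addnC // -ltnS.
by rewrite AC -subnDA addnC.
Qed.

(** Divide [sexpn_euler] by the factorial of [N + 1] and sum over [N]. *)
Lemma sexp_euler n w : n%:R *: E n%:R w =
  \sum_(k < n) k.+1%:R *: A k.+1%:R (E (n - k.+1)%:R w).
Proof.
transitivity (\sum_(k < n.+1) k%:R *: A k%:R (E (n - k)%:R w)); last first.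
  by rewrite big_ord_recl scale0r add0r.
rewrite sexp_natE (hsum_lin (hlinZf _ (@hlin_id _ _))); last exact: sexpn_summable.
rewrite hsum_recl; last first.
  by apply: (hsummable_lin (fun=> hlinZf _ (@hlin_id _ _))); exact: sexpn_summable.
rewrite [X in X + _](_ : _ = 0) ?add0r; last first.
  by rewrite sexpn_nat0; case: eqP => [->|_]; rewrite ?scale0r // !scaler0.
rewrite (@eq_hsum _ _ _ _ (fun N => \sum_(k < n.+1)
    k%:R *: A k%:R ((N`!%:R : K)^-1 *: P N (n - k)%:R w))); last first.
  move=> N; rewrite scalerA mulrC -scalerA sexpn_euler scalerA factS natrM.
  rewrite invfM mulrC mulrA mulfV ?mul1r ?pnatr_eq0 // scaler_sumr.
  by apply: eq_bigr => k _; rewrite (hlinZ (hA _)) !scalerA mulrC.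
rewrite hsum_bigsum => [|k].
  apply: eq_bigr => k _; rewrite sexp_natE.
  rewrite -(hsum_lin (hlinZf _ (hA _))) //; exact: sexpn_summable.
apply: (@hsummable_lin _ _ _ (fun _ w => k%:R *: A k%:R w)) => [_|].
  exact: hlinZf.
exact: sexpn_summable.
Qed.

Lemma sexp0_mod_h w : E 0 w 0%N = w 0%N.
Proof.
have -> : E 0 w = E 0%:R w by [].
rewrite sexp_natE (@hsum_seq _ _ _ _ [:: 0%N]) => [|N].
  by rewrite [undup _]/= big_seq1 sexpn_nat0 -[LHS]/(_ *: w 0%N) fact0 invr1 scale1r.
rewrite inE -lt0n => N0; rewrite -[LHS]/(_ *: P N 0%:R w 0%N).
by rewrite sexpn_vanish ?scaler0 // subn0.
Qed.

Let U w := w - E 0 w.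
Let T0 := sinv (at0 E) 0.

Lemma one_sub_E0_lin : hlin U.
Proof. by apply: hlinDf; [exact: hlin_id|apply: hlinNf; exact: sexp_lin]. Qed.

Lemma sinv_at0_sexp p w : sinv (at0 E) p w = if p == 0 then hsum (fun N => iter N U w) else 0.
Proof.
rewrite /sinv /ssum.
have UE N : sexpn (sadd (@sone K V) (sopp (at0 E))) N p w = if p == 0 then iter N U w else 0.
  have -> : sadd (@sone K V) (sopp (at0 E)) = sconst U.
    apply/funext => q; apply/funext => w'; rewrite /sadd /sopp /sone /at0 /sconst.
    by case: ifP => // _; rewrite oppr0 addr0.
  elim: N => [|N IH] //=; rewrite smul_constl IH.
  by case: ifP => // _; exact: (hlin0 one_sub_E0_lin).
rewrite (eq_hsum UE); case: ifP => // _; exact: hsum0.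
Qed.

(** The constant coefficient [E_0] of [exp A] is 1 modulo [h]. *)
Lemma one_sub_E0_vanish N w : vanish N (iter N U w).
Proof.
elim: N => [|N IH] m //=; rewrite ltnS leq_eqVlt => /orP[/eqP ->|mN]; last first.
  by apply: (hlin_vanish one_sub_E0_lin IH).
have -> : iter N U w = hmul (hmono K N) (fun m => iter N U w (m + N)%N).
  apply/funext => j; rewrite hmul_hmono; case: leqP => [h|]; first by rewrite subnK.
  exact: IH.
rewrite (hlinM one_sub_E0_lin) hmul_hmono leqnn subnn.
by rewrite -[LHS]/(_ - _) sexp0_mod_h subrr.
Qed.

Lemma one_sub_E0_iter_lin N : hlin (iter N U).
Proof. by elim: N => [|N IH]; [exact: hlin_id|apply: hlin_comp => //; exact: one_sub_E0_lin]. Qed.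

Lemma one_sub_E0_summable w : hsummable (fun N => iter N U w).
Proof.
apply/hsummableP => M; exists (iota 0 M) => N.
rewrite mem_iota /= add0n -leqNgt => h m mM; apply: one_sub_E0_vanish.
exact: leq_trans mM h.
Qed.

Lemma sinv0E w : T0 w = hsum (fun N => iter N U w).
Proof. by rewrite /T0 sinv_at0_sexp eqxx. Qed.

Lemma sinv0_lin : hlin T0.
Proof.
have -> : T0 = fun w => hsum (fun N => iter N U w) by apply/funext => w; exact: sinv0E.
apply: (@hlin_hsum _ _ _ (fun N w => iter N U w)); [exact: one_sub_E0_iter_lin|exact: one_sub_E0_summable].
Qed.

(** The sum of the [(1 - E_0)^N E_0 = (1 - E_0)^N - (1 - E_0)^(N+1)] telescopes. *)
Lemma sinv0K w : T0 (E 0 w) = w.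
Proof.
have -> : E 0 w = w - U w by rewrite /U opprB addrC subrK.
rewrite (hlinB sinv0_lin) !sinv0E hsum_recl; last exact: one_sub_E0_summable.
by rewrite (eq_hsum (fun N => iterSr N U w)) addrK.
Qed.

Lemma sinv0_comm S w : hlin S -> (forall q w, S (A q w) = A q (S w)) ->
  S (T0 w) = T0 (S w).
Proof.
move=> hS SA; rewrite !sinv0E (hsum_lin hS); last exact: one_sub_E0_summable.
apply: eq_hsum; elim=> //= N IH.
by rewrite /U (hlinB hS) (sexp_coef_comm _ _ hS SA) IH.
Qed.

(** The series [exp (A(u) - A(0))]. *)
Definition nexp := smul (sinv (at0 E)) E.

Lemma nexpE p w : nexp p w = T0 (E p w).
Proof.
rewrite /nexp /smul (@hsum1 _ _ _ _ 0) => [|q /negbTE q0].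
  by rewrite subr0.
by rewrite sinv_at0_sexp q0.
Qed.

Lemma nexp_lin : coef_lin nexp.
Proof.
move=> p; have -> : nexp p = fun w => T0 (E p w) by apply/funext => w; exact: nexpE.
by apply: hlin_comp; [exact: sinv0_lin|exact: sexp_lin].
Qed.

Lemma nexp_nat_supp : nat_supp nexp.
Proof.
move=> p; case: (sexp_nat_supp p) => h; [by left|right=> w].
by rewrite nexpE h (hlin0 sinv0_lin).
Qed.

Lemma nexp0 w : nexp 0 w = w. Proof. by rewrite nexpE sinv0K. Qed.

Lemma nexp_comm S p w : hlin S -> (forall q w, S (A q w) = A q (S w)) ->
  S (nexp p w) = nexp p (S w).
Proof. by move=> hS SA; rewrite !nexpE sinv0_comm // sexp_coef_comm. Qed.

Lemma nexp_euler n w : n%:R *: nexp n%:R w =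
  \sum_(k < n) k.+1%:R *: A k.+1%:R (nexp (n - k.+1)%:R w).
Proof.
rewrite nexpE -(hlinZ sinv0_lin) sexp_euler (hlin_sum sinv0_lin); apply: eq_bigr => k _.
rewrite (hlinZ sinv0_lin) nexpE; congr (_ *: _).
by rewrite sinv0_comm //.
Qed.
End Exp.
End TaylorSeries.

(** * Series of oscillator modes *)

Section Oscillators.
Variables (K : numFieldType) (V : lmodType K).
Implicit Types (w : hser V) (b : K).

Definition vlin (f : V -> V) :=
  (forall x y, f (x + y) = f x + f y) /\ (forall c x, f (c *: x) = c *: f x).

Definition lev (f : V -> V) w : hser V := fun m => f (w m).

Lemma vlin0 f : vlin f -> f 0 = 0.
Proof. by move=> [_ fZ]; have := fZ 0 0; rewrite !scale0r. Qed.

Lemma vlin_sum f I (r : seq I) (F : I -> V) : vlin f ->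
  f (\sum_(i <- r) F i) = \sum_(i <- r) f (F i).
Proof.
by move=> fl; elim/big_rec2: _ => [|i x y _ <-]; [exact: vlin0|case: fl].
Qed.

Lemma lev_hlin f : vlin f -> hlin (lev f).
Proof.
move=> fl; have [fD fZ] := fl; split=> [w w'|c w]; apply/funext => m; first exact: fD.
by rewrite /lev /hmul vlin_sum //; apply: eq_bigr => i _; rewrite fZ.
Qed.

Lemma ssum_ufin (A : nat -> ser V) : (forall n, coef_lin (A n)) ->
  (forall w, hsummable (fun t : nat * K => A t.1 t.2 w)) -> ufin (ssum A).
Proof.
move=> hA sA; split=> [p|w].
  apply: (@hlin_hsum _ _ _ (fun n w => A n p w)) => [n|w]; first exact: hA.
  by apply: (@hsummable_inj _ _ _ _ (fun N => (N, p)) fst _ _ (sA w)).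
exact: (proj2 (hsummable_pair (hsummable_swap (sA w)))).
Qed.

(** The series [sum_r (H_r / r) (u + b h)^(t_r)] over [r = n + 1 > 0]. *)
Definition osc b (t : nat -> K) (H : nat -> V -> V) : ser V :=
  ssum (fun n => smono (upow b (t n)) (fun w m => n.+1%:R^-1 *: H n (w m))).

Section One.
Variables (H : nat -> V -> V).
Hypothesis Hlin : forall n, vlin (H n).

Lemma mode_hlin n : hlin (fun w => (fun m => n.+1%:R^-1 *: H n (w m)) : hser V).
Proof. exact: (hlinZf _ (lev_hlin (Hlin n))). Qed.

Lemma term_lin b (t : nat -> K) n :
  coef_lin (smono (upow b (t n)) (fun w m => n.+1%:R^-1 *: H n (w m))).
Proof. by case: (smono_ufin (upow_sfin b (t n)) (mode_hlin n)). Qed.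

Section Annihil.
Hypothesis Hfin : forall v, exists B, forall n, (B <= n)%N -> H n v = 0.

Lemma Hfin_upto w M : exists B, forall n m, (B <= n)%N -> (m < M)%N -> H n (w m) = 0.
Proof.
elim: M => [|M [B BP]]; first by exists 0%N.
have [B' BP'] := Hfin (w M); exists (maxn B B') => n m; rewrite geq_max => /andP[h h'].
rewrite ltnS leq_eqVlt => /orP[/eqP -> | ]; first exact: BP'.
exact: BP.
Qed.

(** Modulo [h^n] finitely many modes act on a given vector, and each [(u + b h)^t]
    has finitely many terms. *)
Lemma osc_ufin b (t : nat -> K) : ufin (osc b t H).
Proof.
apply: ssum_ufin => [n|w]; first exact: term_lin.
apply: (@hsummable_dep _ _ _ _ (fun n p w => hmul (upow b (t n) p) w)
  (fun n m => n.+1%:R^-1 *: H n (w m))) => [n p|n w'|].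
- exact: hlin_hmul.
- by case: (smono_ufin (upow_sfin b (t n)) (@hlin_id K V)) => _; apply.
apply/hsummableP => M; have [B BP] := Hfin_upto w M; exists (iota 0 B) => n.
by rewrite mem_iota /= add0n -leqNgt => Bn m mM; rewrite BP // scaler0.
Qed.

Lemma osc_summable b (t : nat -> K) p w : hsummable (fun n =>
  smono (upow b (t n)) (fun w m => n.+1%:R^-1 *: H n (w m)) p w).
Proof.
apply: (@hsummable_lin _ _ _ (fun n => hmul (upow b (t n) p))) => [n|].
  exact: hlin_hmul.
apply/hsummableP => M; have [B BP] := Hfin_upto w M; exists (iota 0 B) => n.
by rewrite mem_iota /= add0n -leqNgt => Bn m mM; rewrite BP // scaler0.
Qed.
End Annihil.

(** For [n] natural, [(u + b h)^n] is a polynomial in [u]. *)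
Lemma upow_nat b n p : (exists k : nat, p = k%:R) \/ forall l, upow b n%:R p l = 0.
Proof.
have [|np] := pselect (exists n : nat, p = n%:R); first by left.
right=> l; rewrite /upow; case: eqP => // E; have [ln|nl] := leqP l n.
  by case: np; exists (n - l)%N; rewrite natrB.
have -> : gbinom n%:R l = 0 :> K; last by rewrite mul0r.
by rewrite /gbinom (bigD1 (Ordinal nl)) //= subrr !mul0r.
Qed.

Local Notation cr b := (osc b (fun n => n.+1%:R) H).
Local Notation crterm b n := (smono (upow b n.+1%:R) (fun w m => n.+1%:R^-1 *: H n (w m))).

Lemma osc_creat_term_nat_supp b n : nat_supp (crterm b n).
Proof.
move=> p; case: (upow_nat b n.+1 p) => [|h]; [by left|right=> w].
by rewrite /smono (eq_hmul _ h) hmul0l.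
Qed.

Lemma osc_creat_nat_supp b : nat_supp (cr b).
Proof.
move=> p; have [|np] := pselect (exists n : nat, p = n%:R); first by left.
right=> w; rewrite /osc /ssum -[RHS](hsum0 V nat); apply: eq_hsum => N.
by case: (osc_creat_term_nat_supp b N p).
Qed.

(** In [(u + b h)^r] the power [u^k h^l] forces [r = k + l]. *)
Lemma osc_creat_summable b p w : hsummable (fun n => crterm b n p w).
Proof.
have [[k ->]|np] := pselect (exists n : nat, p = n%:R); last first.
  apply: (eq_hsummable (g := fun _ => 0)); last exact: hsummable0.
  by move=> n; case: (osc_creat_term_nat_supp b n p).
apply/hsummableP => M; exists (iota 0 (k + M)) => n.
rewrite mem_iota /= add0n -leqNgt => h m mM.
rewrite /smono /hmul big1 // => l _; rewrite /upow; case: eqP => [|_]; last by rewrite scale0r.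
move/eqP; rewrite eq_sym subr_eq -natrD eqr_nat => /eqP E.
by have := ltn_ord l; lia.
Qed.

Lemma osc_creat_lin b : coef_lin (cr b).
Proof.
move=> p; apply: (@hlin_hsum _ _ _ (fun n => crterm b n p)) => [n|w].
  exact: (@term_lin b (fun n => n.+1%:R) n).
exact: osc_creat_summable.
Qed.

Lemma osc_creat0 b w : cr b 0 w 0%N = 0.
Proof.
rewrite /osc /ssum (@hsum_seq _ _ _ _ [::]) ?big_nil // => n _.
rewrite /smono /hmul big_ord1 /upow subr0 eq_sym pnatr_eq0 scale0r //.
Qed.

Lemma osc_creat_comm b p S w : hlin S ->
  (forall n w, S (lev (H n) w) = lev (H n) (S w)) ->
  S (cr b p w) = cr b p (S w).
Proof.
move=> hS SH; rewrite /osc /ssum (hsum_lin hS); last exact: osc_creat_summable.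
apply: eq_hsum => n; rewrite /smono (hlinM hS); congr hmul.
by have := hlinZ hS n.+1%:R^-1 (lev (H n) w); rewrite SH.
Qed.
End One.

Lemma osc_comm b t H p S w : (forall n, vlin (H n)) ->
  (forall v, exists B, forall n, (B <= n)%N -> H n v = 0) -> hlin S ->
  (forall n w, S (lev (H n) w) = lev (H n) (S w)) ->
  S (osc b t H p w) = osc b t H p (S w).
Proof.
move=> Hl Hf hS SH; rewrite /osc /ssum (hsum_lin hS); last exact: osc_summable.
apply: eq_hsum => n; rewrite /smono (hlinM hS); congr hmul.
by have := hlinZ hS n.+1%:R^-1 (lev (H n) w); rewrite SH.
Qed.

Lemma hmul_upow b x l w : hmul (upow b x (x - l%:R)) w = (gbinom x l * b ^+ l) *: hmul (hmono K l) w.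
Proof.
rewrite hmulZl; apply: eq_hmul => l'; rewrite upowE /hmono.
by case: eqP; rewrite ?mulr1 ?mulr0.
Qed.

Lemma hmul_upow0 b x p w : (forall l : nat, p <> x - l%:R) -> hmul (upow b x p) w = 0.
Proof.
move=> h; rewrite -[RHS](hmul0l w); apply: eq_hmul => l; rewrite /upow.
by case: eqP => // /h.
Qed.

Lemma hmul_hmonoD l l' w : hmul (hmono K l) (hmul (hmono K l') w) = hmul (hmono K (l + l')%N) w.
Proof.
rewrite hmul_hmono_hmul; apply: eq_hmul => m; rewrite /hmono.
case: leqP => h; first by congr (_%:R); congr nat_of_bool; lia.
by rewrite ltn_eqF // ltn_addr.
Qed.

(** This is [sum_r (k/r) binom(r, k) (b' h)^(r-k) (u + b h)^-r = (u + (b - b') h)^-k]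
    with [k.+1] for [k]. By [gbinom_nat] and [gbinom_split], the coefficient of
    [h^M] on the left is [binom(-k, M)] times the binomial expansion of
    [(b - b')^M]. *)
Lemma upow_contract b b' k p w :
  k.+1%:R *: hsum (fun n => n.+1%:R^-1 *:
    hmul (upow b (- n.+1%:R) p) (hmul (upow b' n.+1%:R k.+1%:R) w))
  = hmul (upow (b - b') (- k.+1%:R) p) w.
Proof.
set g := fun n : nat => _.
have gE n j : n = (k + j)%N -> g n = n.+1%:R^-1 *: hmul (upow b (- n.+1%:R) p)
    ((gbinom n.+1%:R j * b' ^+ j) *: hmul (hmono K j) w).
  move=> E; rewrite /g; congr (_ *: hmul _ _); rewrite -hmul_upow.
  by congr (hmul (upow _ _ _) _); rewrite -natrB E ?subSn ?addnK ?leqW ?leq_addl.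
have g0 n : (n < k)%N -> g n = 0.
  move=> nk; rewrite /g (hmul_upow0 b') => [|l].
    by rewrite (hlin0 (hlin_hmul V _)) scaler0.
  by move/eqP; rewrite eq_sym subr_eq -natrD eqr_nat; lia.
have [[M pE]|np] := pselect (exists M : nat, p = - k.+1%:R - M%:R); last first.
  rewrite [RHS]hmul_upow0; last by move=> l E; apply: np; exists l.
  rewrite (_ : hsum g = 0) ?scaler0 // -(hsum0 V nat); apply: eq_hsum => n.
  have [nk|kn] := ltnP n k; first exact: g0.
  rewrite (gE _ (n - k)%N) ?subnKC // hmul_upow0 ?scaler0 // => l E.
  apply: np; exists (n - k + l)%N; rewrite E -!opprD -!natrD; congr (- _%:R); lia.
(* Powers of [u] and [h]: the terms with [n = k + j], [j <= M], contribute [h^j]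
   through the creation mode and [h^(M - j)] through the annihilation mode. *)
subst p; have gM j : (j <= M)%N -> g (k + j)%N = ((k + j).+1%:R^-1 *
    (gbinom (- (k + j).+1%:R) (M - j) * b ^+ (M - j) *
    (gbinom (k + j).+1%:R j * b' ^+ j))) *: hmul (hmono K M) w.
  move=> jM; rewrite (gE _ j) // (hlinZ (hlin_hmul V _)).
  have -> : - k.+1%:R - M%:R = - (k + j).+1%:R - (M - j)%:R :> K.
    by rewrite -!opprD -!natrD; congr (- _%:R); lia.
  rewrite hmul_upow hmul_hmonoD subnK // !scalerA; congr (_ *: _); ring.
have gM0 j : (M < j)%N -> g (k + j)%N = 0.
  move=> Mj; rewrite (gE _ j) // hmul_upow0 ?scaler0 // => l /eqP.
  by rewrite -!opprD (inj_eq oppr_inj) -!natrD eqr_nat; lia.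
have -> : hsum g = \sum_(j < M.+1) g (k + j)%N.
  apply/funext => m; rewrite (@hsum_seq _ _ _ _ [seq (k + j)%N | j <- iota 0 M.+1]).
    rewrite undup_id ?map_inj_uniq ?iota_uniq //; last exact: addnI.
    by rewrite big_map fct_sumE -[iota _ _]/(index_iota 0 M.+1) big_mkord.
  move=> n ns; have [nk|kn] := ltnP n k; first by rewrite g0.
  rewrite -(subnKC kn) gM0 // ltnNge; apply: contra ns => h.
  by apply/mapP; exists (n - k)%N; rewrite ?subnKC // mem_iota.
rewrite hmul_upow exprBn scaler_sumr mulr_sumr scaler_suml; apply: eq_bigr => j _.
have jM : (j <= M)%N by rewrite -ltnS.
rewrite gM // scalerA; congr (_ *: _).
have := gbinom_split (- k.+1%:R : K) j (M - j); rewrite subnKC // => E1.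
have := gbinom_nat K k j; rewrite addSn => E2.
rewrite -[_ *+ 'C(M, j)]mulr_natr.
have -> : gbinom (- k.+1%:R) M * ((-1) ^+ j * b ^+ (M - j) * b' ^+ j * 'C(M, j)%:R) =
  (-1) ^+ j * b ^+ (M - j) * b' ^+ j * (gbinom (- k.+1%:R) M * 'C(M, j)%:R) by ring.
rewrite -E1.
have -> : - (k + j).+1%:R = - k.+1%:R - j%:R :> K by rewrite -opprD -natrD addSn.
transitivity ((k.+1%:R / (k + j).+1%:R * gbinom (k + j).+1%:R j) * (b ^+ (M - j) * b' ^+ j *
   gbinom (- k.+1%:R - j%:R) (M - j))); first by ring.
by rewrite E2; ring.
Qed.
End Oscillators.

(** * Additive maps on monoid algebras *)

Section MalgSums.
Variables (G : zmodType) (I : choiceType) (W : zmodType).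

Lemma malg_ext (f g : {malg G[I]} -> W) :
  (forall x y, f (x + y) = f x + f y) -> (forall x y, g (x + y) = g x + g y) ->
  (forall c k, f << c *g k >> = g << c *g k >>) -> f =1 g.
Proof.
move=> fD gD fg x; have f0 : f 0 = 0 by apply: (addrI (f 0)); rewrite -fD !addr0.
have g0 : g 0 = 0 by apply: (addrI (g 0)); rewrite -gD !addr0.
rewrite [x]monalgE; elim/big_rec: _ => [|i y _ IH]; first by rewrite f0 g0.
by rewrite fD gD fg IH.
Qed.

Lemma malg_ind (P : {malg G[I]} -> Prop) :
  P 0 -> (forall x y, P x -> P y -> P (x + y)) -> (forall c k, P << c *g k >>) ->
  forall x, P x.
Proof.
move=> P0 PD PU x; rewrite [x]monalgE; elim/big_rec: _ => // i y _; exact: PD.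
Qed.

Variable F : I -> G -> W.
Hypothesis FD : forall k x y, F k (x + y) = F k x + F k y.

(** The additive extension to finite sums of an additive family [F k]. *)
Definition mext (v : {malg G[I]}) : W := \sum_(k <- msupp v) F k v@_k.

Lemma mext_coef0 k : F k 0 = 0.
Proof. by apply: (addrI (F k 0)); rewrite -FD !addr0. Qed.

Lemma mextEw (D : {fset I}) v : (msupp v `<=` D)%fset -> mext v = \sum_(k <- D) F k v@_k.
Proof.
move=> vD; rewrite /mext; apply: big_fset_incl => // k _ kv.
by rewrite mcoeff_outdom // mext_coef0.
Qed.

Lemma mextD x y : mext (x + y) = mext x + mext y.
Proof.
rewrite (mextEw (msuppD_le x y)) (mextEw (fsubsetUl (msupp x) (msupp y))).
rewrite (mextEw (fsubsetUr (msupp x) (msupp y))) -big_split /=.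
by apply: eq_bigr => k _; rewrite mcoeffD FD.
Qed.

Lemma mextU c k : mext << c *g k >> = F k c.
Proof.
by rewrite (mextEw msuppU_le) big_seq_fset1 mcoeffUU.
Qed.
End MalgSums.

(** * The operators on the Fock space *)

Section FockFacts.
Variable K : numFieldType.
Local Notation U := (Uminus K).
Local Notation F0 := (Fock0 K).
Implicit Types (f g : U) (v : F0) (m : monom).

Fact um_key : unit. Proof. by []. Qed.

(** The locked monomial [c m] of [Uminus]: unfolded monomials are too large to be
    compared by conversion. *)
Definition um : K -> monom -> U := locked_with um_key (fun c m => << c *g m >>).
Lemma umE c m : um c m = << c *g m >>. Proof. by rewrite /um unlock. Qed.

Lemma umD m c d : um (c + d) m = um c m + um d m. Proof. by rewrite !umE monalgUD. Qed.
Lemma um0 m : um 0 m = 0. Proof. by rewrite umE monalgU0. Qed.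
Lemma umZ (c d : K) m : c *: um d m = um (c * d) m.
Proof. by rewrite !umE -mul_malgC malgM_def fgmulUU mul1m. Qed.
Lemma umM (c d : K) m m' : um c m * um d m' = um (c * d) (mmul m m').
Proof. by rewrite !umE malgM_def fgmulUU. Qed.

Lemma uext (W : zmodType) (f g : U -> W) :
  (forall x y, f (x + y) = f x + f y) -> (forall x y, g (x + y) = g x + g y) ->
  (forall (c : K) m, f (um c m) = g (um c m)) -> f =1 g.
Proof.
by move=> fD gD fg; apply: malg_ext fD gD _ => c m; rewrite -umE.
Qed.

Definition brU j n m (c : K) : U := um ((n.+1 * m (j, n))%:R * c) (divcm m (gen j n)).

Lemma brUD j n m x y : brU j n m (x + y) = brU j n m x + brU j n m y.
Proof. by rewrite /brU mulrDr umD. Qed.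

Lemma bracketE j n f : bracket j n f = mext (brU j n) f.
Proof. by apply: eq_bigr => m _; rewrite /brU umE. Qed.
Lemma bracketD j n f g : bracket j n (f + g) = bracket j n f + bracket j n g.
Proof. by rewrite !bracketE; exact: (mextD (@brUD j n)). Qed.
Lemma bracketU j n c m : bracket j n (um c m) = brU j n m c.
Proof. by rewrite bracketE umE; exact: (mextU (@brUD j n)). Qed.

Lemma bracketZ j n c f : bracket j n (c *: f) = c *: bracket j n f.
Proof.
apply: (uext (f := fun f => bracket j n (c *: f)) (g := fun f => c *: bracket j n f)) => [x y|x y|d k] /=.
- by rewrite scalerDr bracketD.
- by rewrite bracketD scalerDr.
by rewrite umZ !bracketU /brU umZ mulrCA.
Qed.

Lemma genE j n (x : mode) : gen j n x = ((j, n) == x) :> nat.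
Proof. exact: cmU. Qed.

(** The Leibniz rule, as the bracket of a generator is a scalar. *)
Lemma bracket_gen j n k l f : bracket j n (um 1 (gen k l) * f) =
  um 1 (gen k l) * bracket j n f + (((j, n) == (k, l) :> mode)%:R * n.+1%:R) *: f.
Proof.
apply: (uext (f := fun f => bracket j n (um 1 (gen k l) * f)) (g := fun f =>
  um 1 (gen k l) * bracket j n f + (((j, n) == (k, l) :> mode)%:R * n.+1%:R) *: f)) => [x y|x y|c m] /=.
- by rewrite mulrDr bracketD.
- by rewrite bracketD mulrDr scalerDr addrACA.
rewrite umM !bracketU /brU umM umZ cmM genE eq_sym.
have [E|jk] := eqVneq ((j, n) : mode) (k, l); last first.
  rewrite /= add0n !mul0r um0 addr0 mulrCA; congr um.
  apply/eqP/cmP => i; rewrite divcmE !cmM divcmE !genE.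
  by have [<-|ji] := eqVneq ((j, n) : mode) i; rewrite 1?eq_sym ?(negbTE jk) /= ?subn0 ?add0n //.
case: E => <- <-.
have -> : divcm (mmul (gen j n) m) (gen j n) = m.
  by apply/eqP/cmP => i; rewrite divcmE cmM addKn.
have [m0|m0] := posnP (m (j, n)).
  by rewrite m0 muln0 !mul0r mulr0 um0 add0r addn0 muln1 !mul1r.
have -> : mmul (gen j n) (divcm m (gen j n)) = m.
  apply/eqP/cmP => i; rewrite cmM divcmE !genE.
  by have [<-|ji] := eqVneq ((j, n) : mode) i; rewrite /= ?subn0 // subnKC.
by rewrite -umD !mul1r -mulrDl -natrD mulnDr muln1 addnC.
Qed.

Lemma bracket_comm j n k l f : bracket j n (bracket k l f) = bracket k l (bracket j n f).
Proof.
apply: (uext (f := fun f => bracket j n (bracket k l f))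
  (g := fun f => bracket k l (bracket j n f))) => [x y|x y|c m] /=.
- by rewrite !bracketD.
- by rewrite !bracketD.
rewrite !bracketU /brU.
have -> : divcm (divcm m (gen k l)) (gen j n) = divcm (divcm m (gen j n)) (gen k l).
  by apply/eqP/cmP => i; rewrite !divcmE subnAC.
congr um; rewrite !divcmE !genE eq_sym.
have [[<- <-] //|_] := eqVneq ((j, n) : mode) (k, l).
by rewrite !subn0 mulrCA.
Qed.

Lemma bracket_deg j n m c : bracket j n (um c m) = 0 \/
  exists c' m', bracket j n (um c m) = um c' m' /\ mdeg m = (mdeg m').+1.
Proof.
rewrite bracketU /brU; have [m0|m0] := posnP (m (j, n)).
  by left; rewrite m0 muln0 mul0r um0.
right; eexists; exists (divcm m (gen j n)); split; first by [].
rewrite -[RHS]addn1 -(mdegU ((j, n) : mode)) -mdegM; congr mdeg.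
apply/eqP/cmP => i; rewrite cmM divcmE !genE.
by have [<-|ji] := eqVneq ((j, n) : mode) i; rewrite /= ?subn0 ?addn0 // subnK.
Qed.

Fact fk_key : unit. Proof. by []. Qed.

(** The vector [f (x) e^(k alpha + lam_i)], locked for the same reason as [um]. *)
Definition fk : U -> int -> F0 := locked_with fk_key (fun f k => << f *g k >>).
Lemma fkE f k : fk f k = << f *g k >>. Proof. by rewrite /fk unlock. Qed.
Lemma fkD f g k : fk (f + g) k = fk f k + fk g k.
Proof. by rewrite !fkE; exact: monalgUD. Qed.
Lemma fk0 k : fk 0 k = 0. Proof. by rewrite fkE; exact: monalgU0. Qed.

Lemma fscale (g f : U) k : (g *: (fk f k : {malg U[int]}) : F0) = fk (g * f) k.
Proof.
rewrite !fkE; apply: (proj1 (malgP _ _)) => l; rewrite mcoeffZ.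
rewrite (mcoeffU k f l) (mcoeffU k (g * f) l).
by case: eqP => _; rewrite ?mulr1n ?mulr0n ?mulr0.
Qed.

Lemma fkZ c f k : c *: fk f k = fk (c *: f) k.
Proof. by rewrite -[LHS]/(c%:A *: (fk f k : {malg U[int]}) : F0) fscale mulr_algl. Qed.

Lemma fext (W : zmodType) (f g : F0 -> W) :
  (forall x y, f (x + y) = f x + f y) -> (forall x y, g (x + y) = g x + g y) ->
  (forall x k, f (fk x k) = g (fk x k)) -> f =1 g.
Proof.
by move=> fD gD fg; apply: malg_ext fD gD _ => c m; rewrite -fkE.
Qed.

Lemma fock_ind (P : F0 -> Prop) :
  P 0 -> (forall x y, P x -> P y -> P (x + y)) -> (forall (c : K) m k, P (fk (um c m) k)) ->
  forall x, P x.
Proof.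
move=> P0 PD PU; apply: malg_ind => // f k; rewrite -fkE.
elim/malg_ind: f => [|x y Px Py|c m]; first by rewrite fk0.
  by rewrite fkD; apply: PD.
by rewrite -umE.
Qed.

(** Apply [h] to the component of weight [k], and shift [k] by [s]. The
    annihilation modes, [e^alpha] and the zero modes have this form. *)
Definition kmap (h : U -> int -> U) (s : int) (v : F0) : F0 :=
  mext (W := F0) (fun k f => fk (h f k) (k + s)) v.

Lemma kmapD h s : (forall k x y, h (x + y) k = h x k + h y k) ->
  forall x y, kmap h s (x + y) = kmap h s x + kmap h s y.
Proof. by move=> hD; apply: mextD => k x y; rewrite hD fkD. Qed.

Lemma kmapU h s : (forall k x y, h (x + y) k = h x k + h y k) ->
  forall f k, kmap h s (fk f k) = fk (h f k) (k + s).
Proof.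
move=> hD f k; rewrite /kmap [fk f k]fkE; apply: mextU => {}k x y.
by rewrite hD fkD.
Qed.

Lemma kmap_lin h s : (forall k x y, h (x + y) k = h x k + h y k) ->
  (forall k c x, h (c *: x) k = c *: h x k) -> vlin (kmap h s).
Proof.
move=> hD hZ; split=> [|c]; first exact: kmapD.
apply: (fext (f := fun x => kmap h s (c *: x)) (g := fun x => c *: kmap h s x)) => [x y|x y|x k] /=.
- by rewrite scalerDr kmapD.
- by rewrite kmapD // scalerDr.
by rewrite fkZ !kmapU // hZ fkZ.
Qed.

(** The action of [e^alpha] on one coefficient of a power series in [h]. *)
Definition exp_alpha0 (v : F0) : F0 := \sum_(k <- msupp v) << v@_k *g (k + 1) >>.

Lemma exp_alpha0E v : exp_alpha0 v = kmap (fun f _ => f) 1 v.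
Proof. by apply: eq_bigr => k _; rewrite fkE. Qed.

Fact hpos_key : unit. Proof. by []. Qed.

(** The annihilation mode [a_j(n+1)], locked. *)
Definition hpos j n : F0 -> F0 := locked_with hpos_key (heis0 j (Posz n.+1)).
Lemma hposE j n : hpos j n = heis0 j (Posz n.+1). Proof. by rewrite /hpos unlock. Qed.

Lemma heis_posE j n v : hpos j n v = kmap (fun f _ => bracket j n f) 0 v.
Proof. by rewrite hposE; apply: eq_bigr => k _; rewrite fkE addr0. Qed.

Lemma fun_partialE i beta phi v : fun_partial i beta phi v =
  kmap (fun f k => phi (Defs.form beta (wt K i k)) *: f) 0 v.
Proof. by apply: eq_bigr => k _; rewrite fkE addr0. Qed.

Lemma heis_pos_fk j n f k : hpos j n (fk f k) = fk (bracket j n f) k.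
Proof. by rewrite heis_posE kmapU ?addr0 // => _ x y; rewrite bracketD. Qed.

Lemma exp_alpha0_fk f k : exp_alpha0 (fk f k) = fk f (k + 1).
Proof. by rewrite exp_alpha0E kmapU. Qed.

Lemma fun_partial_fk i beta phi f k :
  fun_partial i beta phi (fk f k) = fk (phi (Defs.form beta (wt K i k)) *: f) k.
Proof. by rewrite fun_partialE kmapU ?addr0 // => l x y; rewrite scalerDr. Qed.

Fact hneg_key : unit. Proof. by []. Qed.

(** The creation mode [a_j(-n-1)], locked. *)
Definition hneg j n : F0 -> F0 := locked_with hneg_key (heis0 j (Negz n)).
Lemma hnegE j n : hneg j n = heis0 j (Negz n). Proof. by rewrite /hneg unlock. Qed.

Lemma heis_neg_fk j n f k : hneg j n (fk f k) = fk (um 1 (gen j n) * f) k.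
Proof. by rewrite hnegE umE; exact: fscale. Qed.

Lemma exp_alpha0_lin : vlin exp_alpha0.
Proof.
have -> : exp_alpha0 = kmap (fun f _ => f) 1 by apply/funext => v; exact: exp_alpha0E.
exact: kmap_lin.
Qed.

Lemma heis_pos_lin j n : vlin (hpos j n).
Proof.
have -> : hpos j n = kmap (fun f _ => bracket j n f) 0.
  by apply/funext => v; exact: heis_posE.
by apply: kmap_lin => *; rewrite ?bracketD ?bracketZ.
Qed.

Lemma fun_partial_lin i beta phi : vlin (@fun_partial K i beta phi).
Proof.
have -> : fun_partial i beta phi = kmap (fun f k => phi (Defs.form beta (wt K i k)) *: f) 0.
  by apply/funext => v; exact: fun_partialE.
apply: kmap_lin => [l x y|l c x]; first exact: scalerDr.
by rewrite scalerA mulrC -scalerA.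
Qed.

Lemma heis_neg_lin j n : vlin (hneg j n).
Proof.
have D x y : hneg j n (x + y) = hneg j n x + hneg j n y :> F0.
  rewrite hnegE; exact: (@scalerDr U {malg U[int]} (<< gen j n >> : U) x y).
split=> [|c]; first exact: D.
apply: (fext (f := fun x => hneg j n (c *: x)) (g := fun x => c *: hneg j n x)) => [x y|x y|x k].
- by rewrite scalerDr D.
- by rewrite D scalerDr.
by rewrite fkZ !heis_neg_fk fkZ -scalerAr.
Qed.

Lemma vcomm_ext (S T : F0 -> F0) : vlin S -> vlin T ->
  (forall f k, S (T (fk f k)) = T (S (fk f k))) -> forall v, S (T v) = T (S v).
Proof.
move=> [SD _] [TD _] ST; apply: (fext (f := fun v => S (T v)) (g := fun v => T (S v))) => // x y.
- by rewrite TD SD.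
- by rewrite SD TD.
Qed.

Lemma heis_pos_comm j n k l v : hpos j n (hpos k l v) = hpos k l (hpos j n v) :> F0.
Proof.
apply: vcomm_ext => [||f m]; [exact: heis_pos_lin|exact: heis_pos_lin|].
by rewrite !heis_pos_fk bracket_comm.
Qed.

Lemma heis_neg_comm j n k l v : hneg j n (hneg k l v) = hneg k l (hneg j n v) :> F0.
Proof.
apply: vcomm_ext => [||f m]; [exact: heis_neg_lin|exact: heis_neg_lin|].
by rewrite !heis_neg_fk !mulrA !umM [mmul (gen j n) _]mulmC.
Qed.

Lemma heis_pos_neg j n k l v : hpos j n (hneg k l v) =
  hneg k l (hpos j n v) + (((j, n) == (k, l) :> mode)%:R * n.+1%:R) *: v :> F0.
Proof.
have [PD _] := heis_pos_lin j n; have [ND _] := heis_neg_lin k l.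
apply: (fext (f := fun v => hpos j n (hneg k l v)) (g := fun v =>
  hneg k l (hpos j n v) + (((j, n) == (k, l) :> mode)%:R * n.+1%:R) *: v)) => [x y|x y|x m].
- by rewrite ND PD.
- by rewrite PD ND scalerDr addrACA.
by rewrite !heis_neg_fk !heis_pos_fk heis_neg_fk bracket_gen fkD fkZ.
Qed.

Lemma exp_alpha0_pos_comm j n v : exp_alpha0 (hpos j n v) = hpos j n (exp_alpha0 v).
Proof.
apply: vcomm_ext => [||f m]; [exact: exp_alpha0_lin|exact: heis_pos_lin|].
by rewrite exp_alpha0_fk !heis_pos_fk exp_alpha0_fk.
Qed.

Lemma exp_alpha0_neg_comm j n v : exp_alpha0 (hneg j n v) = hneg j n (exp_alpha0 v).
Proof.
apply: vcomm_ext => [||f m]; [exact: exp_alpha0_lin|exact: heis_neg_lin|].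
by rewrite exp_alpha0_fk !heis_neg_fk exp_alpha0_fk.
Qed.

Lemma fun_partial_pos_comm i beta phi j n v :
  fun_partial i beta phi (hpos j n v) = hpos j n (fun_partial i beta phi v).
Proof.
apply: vcomm_ext => [||f m]; [exact: fun_partial_lin|exact: heis_pos_lin|].
by rewrite fun_partial_fk !heis_pos_fk fun_partial_fk bracketZ.
Qed.

Lemma fun_partial_neg_comm i beta phi j n v :
  fun_partial i beta phi (hneg j n v) = hneg j n (fun_partial i beta phi v).
Proof.
apply: vcomm_ext => [||f m]; [exact: fun_partial_lin|exact: heis_neg_lin|].
by rewrite fun_partial_fk !heis_neg_fk fun_partial_fk -scalerAr.
Qed.

Lemma fun_partial_comm i beta phi beta' phi' v :
  fun_partial i beta phi (fun_partial i beta' phi' v) =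
  fun_partial i beta' phi' (fun_partial i beta phi v) :> F0.
Proof.
apply: vcomm_ext => [||f m]; [exact: fun_partial_lin|exact: fun_partial_lin|].
by rewrite !fun_partial_fk !scalerA mulrC.
Qed.

Local Notation half := (2%:R^-1 *: alpha K).

(** Here [(alpha/2, alpha) = 1]. *)
Lemma form_half i k : Defs.form half (wt K i (k + 1)) = Defs.form half (wt K i k) + 1.
Proof.
rewrite /wt intrD scalerDl scale1r addrAC.
set x := _ *: _ + lam _ _.
have -> : Defs.form half (x + alpha K) = Defs.form half x + Defs.form half (alpha K).
  by rewrite /Defs.form -big_split; apply: eq_bigr => j _; rewrite !mxE mulrDr.
congr (_ + _); rewrite /Defs.form !big_ord_recl big_ord0 !mxE /=.
by rewrite !mulr1n; field.
Qed.

Lemma fun_partial_exp_alpha0 i phi v : fun_partial i half phi (exp_alpha0 v) =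
  exp_alpha0 (fun_partial i half (fun x => phi (x + 1)) v).
Proof.
have [eD _] := exp_alpha0_lin; have [pD _] := fun_partial_lin i half phi.
have [qD _] := fun_partial_lin i half (fun x => phi (x + 1)).
apply: (fext (f := fun v => fun_partial i half phi (exp_alpha0 v))
  (g := fun v => exp_alpha0 (fun_partial i half (fun x => phi (x + 1)) v))) => [x y|x y|x m].
- by rewrite eD pD.
- by rewrite qD eD.
by rewrite fun_partial_fk !exp_alpha0_fk fun_partial_fk form_half.
Qed.

(** All products of [d] annihilation modes kill [v]. As a recursive condition it
    is stable under sums and scalings without any reference to degrees of
    polynomials. *)
Fixpoint lnilp (d : nat) (v : F0) : Prop :=
  if d is d'.+1 then forall j n, lnilp d' (hpos j n v) else v = 0.

Lemma lnilp0 d : lnilp d 0.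
Proof.
by elim: d => //= d IH j n; rewrite (vlin0 (heis_pos_lin j n)).
Qed.

Lemma lnilpD d x y : lnilp d x -> lnilp d y -> lnilp d (x + y).
Proof.
elim: d x y => [|d IH] x y /=; first by move=> -> ->; rewrite addr0.
by move=> nx ny j n; rewrite (proj1 (heis_pos_lin j n)); apply: IH.
Qed.

Lemma lnilpZ d c x : lnilp d x -> lnilp d (c *: x).
Proof.
elim: d x => [|d IH] x /=; first by move=> ->; rewrite scaler0.
by move=> nx j n; rewrite (proj2 (heis_pos_lin j n)); apply: IH.
Qed.

Lemma lnilpS d x : lnilp d x -> lnilp d.+1 x.
Proof.
elim: d x => [|d IH] x; first by move=> /= -> j n; rewrite (vlin0 (heis_pos_lin j n)).
by move=> nx j n; apply: IH; apply: nx.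
Qed.

Lemma lnilp_le d d' x : (d <= d')%N -> lnilp d x -> lnilp d' x.
Proof.
by move=> /subnK <-; elim: (d' - d)%N => //= e IH h; apply: lnilpS; exact: IH.
Qed.

(** An annihilation mode lowers the degree of a monomial by one. *)
Lemma lnilp_um c m k : lnilp (mdeg m).+1 (fk (um c m) k).
Proof.
move E : (mdeg m) => d; elim: d c m E => [|d IH] c m E j n; rewrite heis_pos_fk.
  case: (bracket_deg j n m c) => [->|[c' [m' [-> h]]]]; first by rewrite fk0.
  by rewrite E in h.
case: (bracket_deg j n m c) => [->|[c' [m' [-> h]]]].
  by rewrite fk0; apply: (lnilp0 d.+1).
by apply: IH; rewrite E in h; case: h.
Qed.

Lemma lnilp_ex v : exists d, lnilp d v.
Proof.
elim/fock_ind: v => [|x y [d nx] [d' ny]|c m k].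
- by exists 0%N.
- exists (maxn d d'); apply: lnilpD; first by apply: lnilp_le nx; exact: leq_maxl.
  by apply: lnilp_le ny; exact: leq_maxr.
by exists (mdeg m).+1; apply: lnilp_um.
Qed.

(** On a monomial, only the annihilation modes of the variables that occur in it
    are nonzero. *)
Lemma heis_pos_fin j v : exists B, forall n, (B <= n)%N -> hpos j n v = 0.
Proof.
elim/fock_ind: v => [|x y [d nx] [d' ny]|c m k].
- by exists 0%N => n _; rewrite (vlin0 (heis_pos_lin j n)).
- exists (maxn d d') => n; rewrite geq_max => /andP[h h'].
  by rewrite (proj1 (heis_pos_lin j n)) nx // ny // addr0.
exists (\max_(x <- finsupp m) (x.2).+1)%N => n h.
rewrite heis_pos_fk bracketU /brU.
have -> : m (j, n) = 0%N; last by rewrite muln0 mul0r um0 fk0.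
apply/eqP; rewrite cmE_eq0; apply: contraL h => jn; rewrite -ltnNge.
exact: (@leq_bigmax_seq _ _ _ (fun x : mode => x.2.+1) _ jn).
Qed.
End FockFacts.

(** * Contraction of annihilation and creation modes *)

Section Contraction.
Variables (K : numFieldType) (V : lmodType K).
Variables (H H' : nat -> V -> V) (kappa : K).
Hypotheses (Hl : forall n, vlin (H n)) (Hl' : forall n, vlin (H' n)).
Hypothesis Hfin : forall v, exists B, forall n, (B <= n)%N -> H n v = 0.
Hypothesis HH : forall n m v,
  H n (H' m v) = H' m (H n v) + (kappa * (n == m)%:R * n.+1%:R) *: v.

(** Each annihilation term commutes with all creation terms but the one of the same
    index, which leaves a scalar; no double sum has to be rearranged, because the
    annihilation term is continuous. *)
Lemma osc_contract b b' p k w :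
  osc b (fun n => - n.+1%:R) H p (osc b' (fun n => n.+1%:R) H' k w) =
  osc b' (fun n => n.+1%:R) H' k (osc b (fun n => - n.+1%:R) H p w) +
  kappa *: hsum (fun n => n.+1%:R^-1 *:
     hmul (upow b (- n.+1%:R) p) (hmul (upow b' n.+1%:R k) w)).
Proof.
set Fn := fun n w => smono (upow b (- n.+1%:R)) (fun w m => n.+1%:R^-1 *: H n (w m)) p w.
set Gm := fun n w => smono (upow b' n.+1%:R) (fun w m => n.+1%:R^-1 *: H' n (w m)) k w.
pose cn (n : nat) (w : hser V) : hser V := n.+1%:R^-1 *: hmul (upow b (- n.+1%:R) p) (hmul (upow b' n.+1%:R k) w).
have lF n : hlin (Fn n) by exact: (term_lin Hl b (fun n => - n.+1%:R) n p).
have lG n : hlin (Gm n) by exact: (term_lin Hl' b' (fun n => n.+1%:R) n k).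
have FG n m w' : Fn n (Gm m w') = Gm m (Fn n w') + (kappa * (n == m)%:R) *: cn n w'.
  pose sc (n : nat) (x : hser V) : hser V := n.+1%:R^-1 *: x.
  have -> : Fn n (Gm m w') = hmul (upow b (- n.+1%:R) p) (sc n (lev (H n)
     (hmul (upow b' m.+1%:R k) (sc m (lev (H' m) w'))))) by [].
  have -> : Gm m (Fn n w') = hmul (upow b' m.+1%:R k) (sc m (lev (H' m)
     (hmul (upow b (- n.+1%:R) p) (sc n (lev (H n) w'))))) by [].
  have h1 := lev_hlin (Hl n); have h2 := lev_hlin (Hl' m).
  rewrite /sc (hlinM h1) (hlinZ h1) (hlinM h2) (hlinZ h2).
  rewrite !(hlinZ (hlin_hmul V _)) [in RHS]hmulC.
  have -> : lev (H n) (lev (H' m) w') = lev (H' m) (lev (H n) w') +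
      (kappa * (n == m)%:R * n.+1%:R) *: w' by apply/funext => i; exact: HH.
  rewrite !hmulDr !scalerDr !(hlinZ (hlin_hmul V _)) !scalerA.
  congr (_ + _); first by rewrite mulrC.
  have [<-|_] := eqVneq n m; last by rewrite !(mulr0, mul0r) !scale0r.
  rewrite /cn; congr (_ *: _).
  have n0 : n.+1%:R != 0 :> K by rewrite pnatr_eq0.
  by rewrite /= mulr1n; field; rewrite addrC natr1 n0.
have sF w' : hsummable (fun n => Fn n w') by exact: (osc_summable Hfin).
have sG w' : hsummable (fun n => Gm n w') by exact: (osc_creat_summable H').
have lcn n : hlin (cn n).
  by apply: hlinZf; apply: hlin_comp; exact: hlin_hmul.
have E n : Fn n (osc b' (fun n => n.+1%:R) H' k w) =
    osc b' (fun n => n.+1%:R) H' k (Fn n w) + kappa *: cn n w.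
  rewrite /osc /ssum (hsum_lin (lF n)); last exact: sG.
  rewrite (eq_hsum (fun m => FG n m w)) hsumD; last 2 first.
  - exact: sG.
  - by apply: (@hsummable1 _ _ _ _ n) => m; rewrite eq_sym => /negbTE ->; rewrite mulr0 scale0r.
  congr (_ + _); rewrite (@hsum1 _ _ _ _ n) ?eqxx ?mulr1 // => m.
  by rewrite eq_sym => /negbTE ->; rewrite mulr0 scale0r.
have sFo : hsummable (fun n => Fn n (osc b' (fun n => n.+1%:R) H' k w)) by exact: sF.
have soF : hsummable (fun n => osc b' (fun n => n.+1%:R) H' k (Fn n w)).
  apply: (@hsummable_lin _ _ _ (fun _ => osc b' (fun n => n.+1%:R) H' k)) => [_|]; last exact: sF.
  exact: (osc_creat_lin Hl').
have scn : hsummable (fun n => kappa *: cn n w).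
  have := hsummableD sFo (@hsummable_lin _ _ _ (fun _ => -%R) _ (fun=> hlinNf (@hlin_id _ _)) soF).
  by apply: eq_hsummable => n; rewrite E addrC addKr.
transitivity (hsum (fun n => Fn n (osc b' (fun n => n.+1%:R) H' k w))); first by [].
rewrite (eq_hsum E) hsumD // -(hsum_lin (osc_creat_lin Hl' b' k)) //; congr (_ + _).
have [e0|e0] := eqVneq kappa 0.
  by rewrite e0 scale0r -[RHS](hsum0 V nat); apply: eq_hsum => n; rewrite scale0r.
have sc : hsummable (fun n => cn n w).
  have := @hsummable_lin _ _ _ (fun _ w => kappa^-1 *: w) _ (fun=> hlinZf _ (@hlin_id _ _)) scn.
  by apply: eq_hsummable => n; rewrite scalerA mulVf ?scale1r.
by rewrite -(hsum_lin (hlinZf kappa (@hlin_id K V)) sc).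
Qed.
End Contraction.

Lemma hsumB (K : numFieldType) (V : lmodType K) (I : choiceType) (f g : I -> hser V) :
  hsummable f -> hsummable g -> hsum (fun t => f t - g t) = hsum f - hsum g.
Proof.
move=> sf sg; rewrite hsumD ?hsumN //.
exact: (hsummable_lin (fun=> hlinNf (@hlin_id _ _))).
Qed.

Section CstComm.
Variables (K : numFieldType) (V : lmodType K).
Implicit Types (A : fser V).

Lemma fconst_mul S (hS : hlin S) A p w : (fconst hS * A) p w = S (A p w).
Proof. by rewrite fvalM smul_constl. Qed.

Lemma mul_fconst S (hS : hlin S) A p w : (A * fconst hS) p w = A p (S w).
Proof. by rewrite fvalM smul_constr. Qed.

Lemma fconst_comm S (hS : hlin S) A : (forall p w, S (A p w) = A p (S w)) ->
  GRing.comm (fconst hS) A.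
Proof. by move=> SA; apply: fserP => p w; rewrite fconst_mul mul_fconst. Qed.

Lemma fconst_commE S (hS : hlin S) A p w : GRing.comm (fconst hS) A -> S (A p w) = A p (S w).
Proof. by move=> c; rewrite -fconst_mul c mul_fconst. Qed.

Lemma comm_fexp A (nA : pronil A) B : GRing.comm B A -> GRing.comm B (fexp nA).
Proof.
move=> BA; have : fexp nA * B = (B + 0) * fexp nA.
  by apply: fexp_conj; rewrite ?mul0r ?mulr0 // addr0.
by rewrite addr0 /GRing.comm => ->.
Qed.
End CstComm.

(** * The vertex operators [E^+], [Ebar^+] and [E^-] *)

Section FockOsc.
Variable K : numFieldType.
Local Notation F0 := (Fock0 K).
Implicit Types (w : Fock K) (A B : fser F0) (b : K).

(** The series [sum_(r > 0) (a_j(r) / r) (u + b h)^-r]. *)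
Definition annih j b : fser F0 :=
  FSer (osc_ufin (@heis_pos_lin K j) (@heis_pos_fin K j) b (fun n => - n.+1%:R)).

(** The series [sum_(r > 0) (a_j(-r) / r) (u + b h)^r]. *)
Definition creat j b : ser F0 := osc b (fun n => n.+1%:R) (@hneg K j).

Lemma hsum_lnilp (I : choiceType) (g : I -> Fock K) d m : hsummable g ->
  (forall t, lnilp d (g t m)) -> lnilp d (hsum g m).
Proof.
move=> /hsummableP gs ng; have [s sP] := gs m.+1.
rewrite (@hsum_seq _ _ _ _ s) => [|t /sP]; last exact.
by elim/big_ind: _ => [|x y|t _]; [exact: lnilp0|exact: lnilpD|exact: ng].
Qed.

Definition lowering A := forall d n w, (forall m, (m < n)%N -> lnilp d.+1 (w m)) ->
  forall p m, (m < n)%N -> lnilp d (A p w m).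

Lemma annih_lowering j b : lowering (annih j b).
Proof.
move=> d n w nw p m mn; apply: hsum_lnilp.
  by have := osc_summable (@heis_pos_fin K j) b (fun n => - n.+1%:R) p w.
move=> t; rewrite /smono /hmul; elim/big_ind: _ => [|x y|l _]; [exact: lnilp0|exact: lnilpD|].
do 2!apply: lnilpZ; apply: (nw (m - l)%N).
by apply: leq_ltn_trans mn; exact: leq_subr.
Qed.

(** Below [h^n] a vector has finitely many coefficients, hence a common order of
    nilpotency. *)
Lemma lowering_pronil A : lowering A -> pronil A.
Proof.
move=> lA w n; have [d dP] : exists d, forall m, (m < n)%N -> lnilp d (w m).
  elim: n => [|n [d dP]]; first by exists 0%N.
  have [d' d'P] := lnilp_ex (w n); exists (maxn d d') => m.
  rewrite ltnS leq_eqVlt => /orP[/eqP ->|mn].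
    by apply: lnilp_le d'P; exact: leq_maxr.
  by apply: lnilp_le (dP _ mn); exact: leq_maxl.
exists d => N p dN.
have {}dP : forall m, (m < n)%N -> lnilp N (w m) by move=> m /dP; exact: lnilp_le.
elim: N {dN} w dP p => [|N IH] w dP p.
  move=> m /dP /= w0; rewrite /sone /sconst; case: ifP => // _.
rewrite exprSr fvalM /smul => m mn.
apply: (@hsum_lnilp _ _ 0) => //; first exact: smul_summable.
by move=> q; apply: (IH _ _ q) mn => m' m'n; apply: lA m'n => m''; exact: dP.
Qed.

Lemma loweringD A B : lowering A -> lowering B -> lowering (A + B).
Proof. by move=> lA lB d n w nw p m mn; apply: lnilpD; [exact: lA nw _ _ mn|exact: lB nw _ _ mn]. Qed.

Lemma loweringN A : lowering A -> lowering (- A).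
Proof.
move=> lA d n w nw p m mn; rewrite fvalN -[(- _ : Fock K) m]/(- (A p w m)) -scaleN1r.
by apply: lnilpZ; exact: lA nw _ _ mn.
Qed.

Let b14 : K := 1 / 4%:R.
Let b34 : K := - (3%:R / 4%:R).
Let b74 : K := - (7%:R / 4%:R).

Definition logEplus : fser F0 := annih 0 b14 - annih 1 b14.
Definition logEbarplus : fser F0 := annih 0 b74 + annih 1 b14.

Lemma logEplus_pronil : pronil logEplus.
Proof. by apply: lowering_pronil; apply: loweringD; [|apply: loweringN]; exact: annih_lowering. Qed.
Lemma logEbarplus_pronil : pronil logEbarplus.
Proof. by apply: lowering_pronil; apply: loweringD; exact: annih_lowering. Qed.

Definition fEplus := fexp logEplus_pronil.
Definition fEbarplus := fexp logEbarplus_pronil.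

Lemma atermE j b n : aterm j n.+1 n.+1%:R b (- n.+1%:R) =
  smono (upow b (- n.+1%:R)) (fun w m => n.+1%:R^-1 *: hpos j n (w m)) :> ser F0.
Proof. by rewrite hposE. Qed.

Lemma atermNE j b n : aterm j (- n.+1%:Z) n.+1%:R b n.+1%:R =
  smono (upow b n.+1%:R) (fun w m => n.+1%:R^-1 *: hneg j n (w m)) :> ser F0.
Proof. by rewrite hnegE. Qed.

Definition annih_term j b n p w : Fock K :=
  smono (upow b (- n.+1%:R)) (fun w m => n.+1%:R^-1 *: hpos j n (w m)) p w.

Lemma annih_term_summable j b p w : hsummable (fun n => annih_term j b n p w).
Proof. exact: (osc_summable (@heis_pos_fin K j) b (fun n => - n.+1%:R) p w). Qed.

Lemma aterm_annihE j b n p w : aterm j n.+1 n.+1%:R b (- n.+1%:R) p w = annih_term j b n p w.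
Proof. by rewrite atermE. Qed.

Lemma EplusE : @Eplus K = fval fEplus.
Proof.
congr sexp; apply/funext => p; apply/funext => w.
transitivity (hsum (fun n => annih_term 0 b14 n p w) - hsum (fun n => annih_term 1 b14 n p w)); last by [].
rewrite -hsumB; [|exact: annih_term_summable|exact: annih_term_summable].
by apply: eq_hsum => n; rewrite -(aterm_annihE 0) -(aterm_annihE 1).
Qed.

Lemma EbarplusE : @Ebarplus K = fval fEbarplus.
Proof.
congr sexp; apply/funext => p; apply/funext => w.
transitivity (hsum (fun n => annih_term 0 b74 n p w) + hsum (fun n => annih_term 1 b14 n p w)); last by [].
rewrite -hsumD; [|exact: annih_term_summable|exact: annih_term_summable].
by apply: eq_hsum => n; rewrite -(aterm_annihE 0) -(aterm_annihE 1).
Qed.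

Definition logEminus : ser F0 := sadd (sopp (creat 0 b34)) (creat 1 b14).

Definition creat_term j b n p w : Fock K :=
  smono (upow b n.+1%:R) (fun w m => n.+1%:R^-1 *: hneg j n (w m)) p w.

Lemma creat_term_summable j b p w : hsummable (fun n => creat_term j b n p w).
Proof. exact: (osc_creat_summable (@hneg K j) b p w). Qed.

Lemma aterm_creatE j b n p w : aterm j (- n.+1%:Z) n.+1%:R b n.+1%:R p w = creat_term j b n p w.
Proof. by rewrite atermNE. Qed.

Lemma EminusE : @Eminus K = sexp logEminus.
Proof.
congr sexp; apply/funext => p; apply/funext => w.
transitivity (- hsum (fun n => creat_term 0 b34 n p w) + hsum (fun n => creat_term 1 b14 n p w)); last by [].
rewrite addrC -hsumB; [|exact: creat_term_summable|exact: creat_term_summable].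
by apply: eq_hsum => n; rewrite -(aterm_creatE 0) -(aterm_creatE 1) addrC.
Qed.

Lemma logEminus_lin : coef_lin logEminus.
Proof. by move=> p; apply: hlinDf; [apply: hlinNf|]; exact: (osc_creat_lin (@heis_neg_lin K _)). Qed.

Lemma logEminus_nat_supp : nat_supp logEminus.
Proof.
move=> p; case: (osc_creat_nat_supp (@hneg K 0) b34 p) => [|h0]; first by left.
case: (osc_creat_nat_supp (@hneg K 1) b14 p) => [|h1]; [by left|right=> w].
by rewrite /logEminus /sadd /sopp /creat h0 h1 oppr0 addr0.
Qed.

Lemma logEminus0 w : logEminus 0 w 0%N = 0.
Proof.
have h j b := osc_creat0 (@hneg K j) b w.
by rewrite -[LHS]/(- (creat 0 b34 0 w 0%N) + creat 1 b14 0 w 0%N) /creat !h oppr0 addr0.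
Qed.

Lemma creat_comm S : hlin S ->
  (forall j n w, S (lev (hneg j n) w) = lev (hneg j n) (S w)) ->
  forall j b p w, S (creat j b p w) = creat j b p (S w).
Proof. by move=> hS SH j b p w; apply: osc_creat_comm => //; exact: heis_neg_lin. Qed.

Lemma logEminus_comm S : hlin S ->
  (forall j n w, S (lev (hneg j n) w) = lev (hneg j n) (S w)) ->
  forall p w, S (logEminus p w) = logEminus p (S w).
Proof.
move=> hS SH p w.
transitivity (S (- creat 0 b34 p w + creat 1 b14 p w)); first by [].
rewrite (hlinD hS) (hlinN hS).
transitivity (- creat 0 b34 p (S w) + creat 1 b14 p (S w)); last by [].
exact: (f_equal2 (fun x y => - x + y) (creat_comm hS SH 0 _ p w) (creat_comm hS SH 1 _ p w)).
Qed.

Lemma logEminusC k l w : logEminus k (logEminus l w) = logEminus l (logEminus k w).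
Proof.
apply: logEminus_comm => [|j n w']; first exact: logEminus_lin.
apply/esym/logEminus_comm => [|j' n' w'']; first exact: lev_hlin (heis_neg_lin K j n).
by apply/funext => m; exact: heis_neg_comm.
Qed.

(** The coefficients of [M(u) = E^-(0)^-1 E^-(u)]. *)
Definition vminus := nexp logEminus.
Lemma vminus_lin : coef_lin vminus. Proof. exact: (nexp_lin logEminus_lin logEminus_nat_supp logEminus0). Qed.
Lemma vminus_nat_supp : nat_supp vminus. Proof. exact: (nexp_nat_supp logEminus_lin logEminus_nat_supp logEminus0). Qed.
Lemma vminus_comm S : hlin S ->
  (forall j n w, S (lev (hneg j n) w) = lev (hneg j n) (S w)) ->
  forall p w, S (vminus p w) = vminus p (S w).
Proof.
move=> hS SH p w; apply: (nexp_comm logEminus_lin logEminus_nat_supp logEminus0) => // q w'.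
exact: logEminus_comm.
Qed.
Lemma vminusC p q w : vminus p (vminus q w) = vminus q (vminus p w).
Proof.
apply: vminus_comm => [|j n w']; first exact: vminus_lin.
apply/esym/vminus_comm => [|j' n' w'']; first exact: lev_hlin (heis_neg_lin K j n).
by apply/funext => m; exact: heis_neg_comm.
Qed.

(** The coefficient of [v^k] in [v d/dv log E^-(v)]. *)
Definition dlogEminus k : fser F0 := fconst (hlinZf k%:R (logEminus_lin k%:R)).
Definition fvminus (q : K) : fser F0 := fconst (vminus_lin q).

Lemma newton_vminus : newton dlogEminus (fun n => fvminus n%:R).
Proof.
split=> [|n]; apply: fserP => p w.
  by rewrite /= /sconst /vminus (nexp0 logEminus_lin logEminus_nat_supp logEminus0).
rewrite fvalMn fval_sum.
under eq_bigr => k _ do rewrite fconst_mul.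
rewrite /= /sconst; case: eqP => _.
  exact: (nexp_euler logEminus_lin logEminus_nat_supp logEminus0 logEminusC).
rewrite scaler0 big1 // => k _.
by rewrite (hlin0 (logEminus_lin _)) scaler0.
Qed.

Lemma scale_correction (c d : K) (x y z t : Fock K) :
  x = y + d *: z -> c *: z = t -> c *: x = c *: y + d *: t.
Proof. by move=> -> <-; rewrite scalerDr !scalerA mulrC. Qed.

(** The contraction of [sum_r (a_j(r) / r) (u + b h)^-r] with the coefficient of
    [v^k] in [v d/dv sum_r (a_j(-r) / r) (v + b' h)^r] is [(u + (b - b') h)^-k]. *)
Lemma annih_creat j j' b b' k p w :
  annih j b p (k.+1%:R *: creat j' b' k.+1%:R w) =
  k.+1%:R *: creat j' b' k.+1%:R (annih j b p w) +
  (j == j')%:R *: fupow F0 (b - b') (- k.+1%:R) p w.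
Proof.
rewrite (hlinZ (@coefP _ _ (annih j b) p)).
have C : annih j b p (creat j' b' k.+1%:R w) = creat j' b' k.+1%:R (annih j b p w) +
  (j == j')%:R *: hsum (fun n => n.+1%:R^-1 *:
     hmul (upow b (- n.+1%:R) p) (hmul (upow b' n.+1%:R k.+1%:R) w)).
  apply: (@osc_contract _ _ (@hpos K j) (@hneg K j') (j == j')%:R).
  - exact: heis_pos_lin.
  - exact: heis_neg_lin.
  - exact: heis_pos_fin.
  move=> n m v.
  have <- : ((j, n) == (j', m) :> mode)%:R * n.+1%:R = (j == j')%:R * (n == m)%:R * n.+1%:R :> K.
    by rewrite xpair_eqE; case: (j == j'); case: (n == m); rewrite /= ?mulr1 ?mulr0 ?mul0r.
  exact: heis_pos_neg.
exact: (scale_correction C (upow_contract b b' k p w)).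
Qed.
End FockOsc.

(** * Exchange of [E^+ Ebar^+] with the coefficients of [E^-] *)

Lemma fconst_eqBl (K : numFieldType) (V : lmodType K) (T T1 T2 : hser V -> hser V)
    (hT : hlin T) (h1 : hlin T1) (h2 : hlin T2) :
  (forall w, T w = - T1 w + T2 w) -> fconst hT = - fconst h1 + fconst h2.
Proof.
move=> E; apply: fserP => p w; rewrite fvalD fvalN /= /sconst.
by case: ifP => _; rewrite ?oppr0 ?addr0.
Qed.

Section Intertwining.
Variable K : numFieldType.
Local Notation F0 := (Fock0 K).
Implicit Types (w : Fock K) (A B : fser F0) (b : K).
Let b14 : K := 1 / 4%:R.
Let b34 : K := - (3%:R / 4%:R).
Let b74 : K := - (7%:R / 4%:R).

Lemma kcreat_lin j b k : hlin (fun w => k%:R *: creat j b k%:R w : Fock K).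
Proof. by apply: hlinZf; exact: (osc_creat_lin (@heis_neg_lin K j) b). Qed.
Definition kcreat j b k : fser F0 := fconst (kcreat_lin j b k).

Lemma annih_kcreat j j' b b' k :
  annih j b * kcreat j' b' k.+1 = kcreat j' b' k.+1 * annih j b + fupow F0 (b - b') (- k.+1%:R) *+ (j == j').
Proof.
apply: fserP => p w; rewrite mul_fconst fvalD fconst_mul fvalMn.
exact: annih_creat.
Qed.

Lemma dlogEminusE k : dlogEminus K k = - kcreat 0 b34 k + kcreat 1 b14 k.
Proof.
apply: fconst_eqBl => w.
transitivity (k%:R *: (- creat 0 b34 k%:R w + creat 1 b14 k%:R w)); first by [].
by rewrite scalerDr scalerN.
Qed.

Lemma comm_comb (R : pzRingType) (f0 f1 k0 k1 u0 u1 : R) :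
  f0 * k0 = k0 * f0 + u0 -> f0 * k1 = k1 * f0 -> f1 * k0 = k0 * f1 -> f1 * k1 = k1 * f1 + u1 ->
  (f0 - f1) * (- k0 + k1) = (- k0 + k1) * (f0 - f1) + (- u0 - u1) /\
  (f0 + f1) * (- k0 + k1) = (- k0 + k1) * (f0 + f1) + (- u0 + u1).
Proof.
move=> h00 h01 h10 h11.
have e0 : f0 * (- k0 + k1) = (- k0 + k1) * f0 - u0.
  by rewrite mulrDr mulrN h00 h01 opprD mulrDl mulNr addrAC.
have e1 : f1 * (- k0 + k1) = (- k0 + k1) * f1 + u1.
  by rewrite mulrDr mulrN h10 h11 mulrDl mulNr addrA.
move: (- k0 + k1) e0 e1 => y e0 e1; split.
  by rewrite mulrBl e0 e1 mulrBr opprD addrACA.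
by rewrite mulrDl e0 e1 mulrDr addrACA.
Qed.

Lemma conj_mul (R : pzRingType) (e1 e2 y u1 u2 : R) :
  e1 * y = (y + u1) * e1 -> e2 * y = (y + u2) * e2 -> GRing.comm e1 u2 ->
  (e1 * e2) * y = (y + u1 + u2) * (e1 * e2).
Proof.
by move=> h1 h2 c; rewrite -mulrA h2 mulrA mulrDr h1 c -mulrDl mulrA.
Qed.

Lemma add_telescope (R : zmodType) (y a b c : R) : y + (- a - c) + (- b + c) = y - a - b.
Proof. by rewrite -!addrA; congr (_ + (_ + _)); rewrite addrCA addNr addr0. Qed.

Lemma b14_b34 : b14 - b34 = 1. Proof. by rewrite /b14 /b34; field. Qed.
Lemma b74_b34 : b74 - b34 = -1. Proof. by rewrite /b74 /b34; field. Qed.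

(** The contractions with [a_1] and with [a_2] have shifts [1/4 + 3/4 = 1] and
    [1/4 - 1/4 = 0]. *)
Lemma logEplus_dlogEminus k : logEplus K * dlogEminus K k.+1 = dlogEminus K k.+1 * logEplus K +
  (- fupow F0 1 (- k.+1%:R) - fupow F0 0 (- k.+1%:R)).
Proof.
rewrite dlogEminusE.
have h00 := annih_kcreat 0 0 b14 b34 k; have h01 := annih_kcreat 0 1 b14 b14 k.
have h10 := annih_kcreat 1 0 b14 b34 k; have h11 := annih_kcreat 1 1 b14 b14 k.
rewrite b14_b34 mulr1n in h00; rewrite mulr0n addr0 in h01.
rewrite mulr0n addr0 in h10; rewrite subrr mulr1n in h11.
exact: (proj1 (comm_comb h00 h01 h10 h11)).
Qed.

(** The contractions with [a_1] and with [a_2] have shifts [-7/4 + 3/4 = -1] and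
    [1/4 - 1/4 = 0]. *)
Lemma logEbarplus_dlogEminus k : logEbarplus K * dlogEminus K k.+1 = dlogEminus K k.+1 * logEbarplus K +
  (- fupow F0 (-1) (- k.+1%:R) + fupow F0 0 (- k.+1%:R)).
Proof.
rewrite dlogEminusE.
have h00 := annih_kcreat 0 0 b74 b34 k; have h01 := annih_kcreat 0 1 b74 b14 k.
have h10 := annih_kcreat 1 0 b14 b34 k; have h11 := annih_kcreat 1 1 b14 b14 k.
rewrite b74_b34 mulr1n in h00; rewrite mulr0n addr0 in h01.
rewrite mulr0n addr0 in h10; rewrite subrr mulr1n in h11.
exact: (proj2 (comm_comb h00 h01 h10 h11)).
Qed.

Lemma fupow_comm b x A : GRing.comm (fupow F0 b x) A.
Proof. exact: fscal_comm. Qed.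

(** The product [E^+(u) Ebar^+(u)]. *)
Definition vplus := fEplus K * fEbarplus K.

(** The contributions [u^-k] of the modes [a_2] to [E^+(u)] and [Ebar^+(u)] cancel. *)
Lemma vplus_dlogEminus k : vplus * dlogEminus K k.+1 =
  (dlogEminus K k.+1 - fupow F0 1 (-1) ^+ k.+1 - fupow F0 (-1) (-1) ^+ k.+1) * vplus.
Proof.
have cU b x A : GRing.comm A (fupow F0 b x) by apply: commr_sym; exact: fupow_comm.
have c1 A : GRing.comm A (- fupow F0 1 (- k.+1%:R) - fupow F0 0 (- k.+1%:R)).
  by apply: commrB; [apply: commrN|]; exact: cU.
have c2 A : GRing.comm A (- fupow F0 (-1) (- k.+1%:R) + fupow F0 0 (- k.+1%:R)).
  by apply: commrD; [apply: commrN|]; exact: cU.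
have h1 := fexp_conj (@logEplus_pronil K) (logEplus_dlogEminus k) (esym (c1 _)).
have h2 := fexp_conj (@logEbarplus_pronil K) (logEbarplus_dlogEminus k) (esym (c2 _)).
have U1 := fupowN F0 1 k.+1; have U2 := fupowN F0 (-1) k.+1.
rewrite U1 in h1; rewrite U2 in h2; have c3 := c2 (fEplus K); rewrite U2 in c3.
have h := conj_mul h1 h2 c3.
transitivity ((dlogEminus K k.+1 + (- fupow F0 1 (-1) ^+ k.+1 - fupow F0 0 (- k.+1%:R)) +
  (- fupow F0 (-1) (-1) ^+ k.+1 + fupow F0 0 (- k.+1%:R))) * vplus); first exact: h.
by rewrite add_telescope.
Qed.

(** The scalar [(u + h)^-1]. *)
Definition Iu := fupow F0 1 (-1).

(** The scalar [(u - h)^-1]. *)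
Definition Ju := fupow F0 (-1) (-1).

(** The generating series of the [M_n] gets multiplied by
    [(1 - v/(u + h)) (1 - v/(u - h))]. *)
Lemma vplus_fvminus n : vplus * fvminus n%:R = lag Ju (lag Iu (fun n => fvminus n%:R)) n * vplus.
Proof.
have n1 : newton (fun k => dlogEminus K k - Iu ^+ k) (lag Iu (fun n => fvminus n%:R)).
  by apply: newton_lag (newton_vminus K) => k; exact: fupow_comm.
have n2 : newton (fun k => dlogEminus K k - Iu ^+ k - Ju ^+ k) (lag Ju (lag Iu (fun n => fvminus n%:R))).
  by apply: newton_lag n1 => k; exact: fupow_comm.
apply: (newton_intertwine _ (newton_vminus K) n2) => [m|k]; first exact: fmulrI.
exact: vplus_dlogEminus.
Qed.
End Intertwining.

(** * Zero modes *)

Section ZeroModes.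
Variables (K : numFieldType) (i : 'I_2).
Local Notation F0 := (Fock0 K).
Implicit Types (w : Fock K) (v : F0) (b : K) (c : K -> K -> nat -> K).
Local Notation half := (2%:R^-1 *: alpha K).
Local Notation fpart := (fun_partial i half).

Lemma fun_partial_linl beta phi psi b v :
  fun_partial i beta (fun x => phi x + b * psi x) v =
  fun_partial i beta phi v + b *: fun_partial i beta psi v.
Proof.
have [D _] := fun_partial_lin i beta (fun x => phi x + b * psi x).
have [D1 _] := fun_partial_lin i beta phi; have [D2 _] := fun_partial_lin i beta psi.
apply: (fext (f := fun_partial i beta (fun x => phi x + b * psi x))
  (g := fun v => fun_partial i beta phi v + b *: fun_partial i beta psi v)) => [x y|x y|x k].
- exact: D.
- by rewrite D1 D2 scalerDr addrACA.
by rewrite !fun_partial_fk fkZ -fkD scalerDl scalerA.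
Qed.

Lemma fun_partial0l beta v : fun_partial i beta (fun _ => 0) v = 0.
Proof.
have [D _] := fun_partial_lin i beta (fun _ => 0).
apply: (fext (f := fun_partial i beta (fun _ => 0)) (g := fun v => 0)) => [x y|x y|x k].
- exact: D.
- by rewrite addr0.
by rewrite fun_partial_fk scale0r fk0.
Qed.

(** The condition under which [c(partial_(alpha/2))] is locally finite, as a vector
    has finitely many weights. *)
Definition xfin c := forall x, sfin (c x).

Lemma fun_partial_fin c v n : xfin c -> exists s : seq K, forall p, p \notin s ->
  forall l, (l < n)%N -> fpart (fun x => c x p l) v = 0.
Proof.
move=> fc; elim/fock_ind: v => [|x y [s sP] [s' s'P]|d m k].
- by exists [::] => p _ l _; rewrite (vlin0 (fun_partial_lin _ _ _)).
- exists (s ++ s') => p; rewrite mem_cat negb_or => /andP[ps ps'] l ln.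
  by rewrite (proj1 (fun_partial_lin _ _ _)) sP // s'P // addr0.
have [s sP] := fc (Defs.form half (wt K i k)) n; exists s => p ps l ln.
by rewrite fun_partial_fk sP // scale0r fk0.
Qed.

(** As a sum over the powers of [h], [spartial] inherits linearity and summability
    from the operators [phi(partial_(alpha/2))]. *)
Lemma spartialE c p w : spartial i half c p w =
  hsum (fun l => hmul (hmono K l) (lev (fpart (fun x => c x p l)) w)).
Proof.
apply/funext => m; rewrite (@hsum_seq _ _ _ _ (iota 0 m.+1)).
  rewrite undup_id ?iota_uniq // -[iota _ _]/(index_iota 0 m.+1) big_mkord.
  by apply: eq_bigr => l _; rewrite hmul_hmono -ltnS ltn_ord.
by move=> l; rewrite mem_iota /= add0n ltnS => h; rewrite hmul_hmono (negbTE h).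
Qed.

Lemma spartial_summable c p w : hsummable (fun l => hmul (hmono K l) (lev (fpart (fun x => c x p l)) w)).
Proof.
apply/hsummableP => n; exists (iota 0 n) => l; rewrite mem_iota /= add0n -leqNgt => nl m mn.
by rewrite hmul_hmono leqNgt (leq_trans mn nl).
Qed.

Lemma spartial_lin c : coef_lin (spartial i half c).
Proof.
move=> p; have -> : spartial i half c p = fun w =>
    hsum (fun l => hmul (hmono K l) (lev (fpart (fun x => c x p l)) w)).
  by apply/funext => w; exact: spartialE.
apply: (@hlin_hsum _ _ _ (fun l w => hmul (hmono K l) (lev (fpart (fun x => c x p l)) w))) => [l|w].
  apply: hlin_comp; [exact: hlin_hmul|exact: lev_hlin (fun_partial_lin _ _ _)].
exact: spartial_summable.
Qed.

Lemma spartial_ufin c : xfin c -> ufin (spartial i half c).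
Proof.
move=> fc; split=> [|w]; first exact: spartial_lin.
apply/hsummableP => n.
have [s sP] : exists s : seq K, forall p, p \notin s -> forall l m, (l < n)%N -> (m < n)%N ->
    fpart (fun x => c x p l) (w m) = 0.
  elim: {2}n => [|j [s sP]]; first by exists [::].
  have [s' s'P] := fun_partial_fin (w j) n fc; exists (s ++ s') => p.
  rewrite mem_cat negb_or => /andP[ps ps'] l m ln; rewrite ltnS leq_eqVlt => /orP[/eqP ->|mj].
    exact: s'P.
  exact: sP.
exists s => p ps m mn; rewrite /spartial big1 // => l _; apply: sP => //.
  by apply: leq_trans mn; rewrite ltnS -ltnS ltn_ord.
by apply: leq_ltn_trans mn; exact: leq_subr.
Qed.

Definition zmode c (fc : xfin c) : fser F0 := FSer (spartial_ufin fc).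

Lemma zmode_comm c (fc : xfin c) S : hlin S ->
  (forall phi w, S (lev (fpart phi) w) = lev (fpart phi) (S w)) ->
  forall p w, S (zmode fc p w) = zmode fc p (S w).
Proof.
move=> hS SF p w; rewrite /= !spartialE (hsum_lin hS); last exact: spartial_summable.
by apply: eq_hsum => l; rewrite (hlinM hS) SF.
Qed.

Definition fexp_alpha : fser F0 := fconst (lev_hlin (exp_alpha0_lin K)).

Lemma upow_xfin b : xfin (upow b). Proof. by move=> x; exact: upow_sfin. Qed.
Lemma vpow_xfin b : xfin (vpow b).
Proof.
move=> x n; exists [seq - l%:R | l <- iota 0 n] => p ps l ln.
rewrite /vpow; case: eqP => // E; case/mapP: ps; exists l => //.
by rewrite mem_iota.
Qed.

(** The operator [e^alpha] raises [partial_(alpha/2)] by one, and [cS] is the rule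
    [c(x+1) = (u^k + b u^k' h) c(x)]. *)
Lemma zmode_fexp_alpha c (fc : xfin c) b k k' :
  (forall x p l, c (x + 1) p l = c x (p - k) l + b * (if l is l'.+1 then c x (p - k') l' else 0)) ->
  zmode fc * fexp_alpha = (uhmono F0 1 k 0 + uhmono F0 b k' 1) * fexp_alpha * zmode fc.
Proof.
move=> cS; rewrite -mulrA; apply: fserP => p w.
rewrite mul_fconst mulrDl fvalD !uhmono_mul !fconst_mul scale1r hmul_hmono0.
apply/funext => m.
rewrite -[RHS]/(exp_alpha0 (zmode fc (p - k) w m) + b *: hmul _ _ m) hmul_hmono.
have E l : fpart (fun x => c x p l) (exp_alpha0 (w (m - l)%N)) =
    exp_alpha0 (fpart (fun x => c x (p - k) l) (w (m - l)%N)) +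
    b *: (if l is l'.+1 then exp_alpha0 (fpart (fun x => c x (p - k') l') (w (m - l)%N)) else 0).
  rewrite fun_partial_exp_alpha0; have [eD eZ] := exp_alpha0_lin K.
  have -> : (fun x => c (x + 1) p l) = (fun x => c x (p - k) l +
      b * (if l is l'.+1 then c x (p - k') l' else 0)) by apply/funext => x.
  rewrite fun_partial_linl eD eZ; congr (_ + b *: _).
  case: l => //; rewrite fun_partial0l; exact: (vlin0 (exp_alpha0_lin K)).
transitivity (\sum_(l < m.+1) fpart (fun x => c x p l) (exp_alpha0 (w (m - l)%N))); first by [].
rewrite (eq_bigr _ (fun (l : 'I_m.+1) _ => E l)) big_split /= -scaler_sumr.
apply: (f_equal2 (fun x y : F0 => x + b *: y)); first by rewrite (vlin_sum _ _ (exp_alpha0_lin K)).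
rewrite big_ord_recl /= add0r; case: m {E} => [|m]; first by rewrite big_ord0.
by rewrite /= subn1 /= [RHS](vlin_sum _ _ (exp_alpha0_lin K)); apply: eq_bigr => l _.
Qed.
End ZeroModes.

(** * Commuting coefficients *)

Section CoefComm.
Variables (K : numFieldType) (V : lmodType K).
Implicit Types (A B C : fser V).

(** In two independent variables, [A(u) B(v) = B(v) A(u)]. *)
Definition ccomm A B := forall p q w, A p (B q w) = B q (A p w).

Lemma ccomm_sym A B : ccomm A B -> ccomm B A. Proof. by move=> AB p q w. Qed.

Lemma ccommP A B : ccomm A B <-> forall p, GRing.comm (fconst (@coefP _ _ A p)) B.
Proof.
split=> AB p; first by apply: fconst_comm => q w; exact: AB.
by move=> q w; exact: (fconst_commE _ _ (AB p)).
Qed.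

(** Reindex the convolution. *)
Lemma ccomm_comm A B : ccomm A B -> GRing.comm A B.
Proof.
move=> AB; apply: fserP => p w; rewrite !fvalM /smul.
rewrite (eq_hsum (fun q => AB q (p - q) w)).
have e q : p - (p - q) = q by rewrite opprB addrC subrK.
rewrite (@hsum_bij _ _ _ _ (fun q => p - q) (fun q => p - q) _ e e).
  by apply: eq_hsum => q; rewrite e.
apply: (eq_hsummable (g := fun q => A q (B (p - q) w))); first by move=> q; exact: AB.
exact: smul_summable.
Qed.

Lemma ccommM A B C : ccomm A B -> ccomm A C -> ccomm A (B * C).
Proof. by move=> /ccommP b /ccommP c; apply/ccommP => p; apply: commrM. Qed.
Lemma ccommD A B C : ccomm A B -> ccomm A C -> ccomm A (B + C).
Proof. by move=> /ccommP b /ccommP c; apply/ccommP => p; apply: commrD. Qed.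
Lemma ccommN A B : ccomm A B -> ccomm A (- B).
Proof. by move=> /ccommP b; apply/ccommP => p; apply: commrN. Qed.
Lemma ccomm_fexp A B (nB : pronil B) : ccomm A B -> ccomm A (fexp nB).
Proof. by move=> /ccommP b; apply/ccommP => p; apply: comm_fexp. Qed.
End CoefComm.

(** * Exchange of [t(u)] with [M(v) e^alpha] *)

Section FockComm.
Variables (K : numFieldType) (i : 'I_2).
Local Notation F0 := (Fock0 K).
Implicit Types (w : Fock K) (A B : fser F0) (b : K) (c : K -> K -> nat -> K).

Lemma annih_comm S : hlin S ->
  (forall j n w, S (lev (hpos j n) w) = lev (hpos j n) (S w)) ->
  forall j b p w, S (annih j b p w) = annih j b p (S w).
Proof.
move=> hS SH j b p w.
exact: (osc_comm b (fun n => - n.+1%:R) p w (@heis_pos_lin K j) (@heis_pos_fin K j) hS (SH j)).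
Qed.

Lemma annih_annih j b j' b' : ccomm (annih j b : fser F0) (annih j' b').
Proof.
move=> p q w; apply: annih_comm => [|j1 n w']; first exact: coefP.
apply/esym/annih_comm => [|j2 n' w'']; first exact: lev_hlin (heis_pos_lin K j1 n).
by apply/funext => m; exact: heis_pos_comm.
Qed.

Lemma annih_zmode j b c (fc : xfin c) : ccomm (annih j b) (zmode i fc).
Proof.
move=> p q w; apply: zmode_comm => [|phi w']; first exact: coefP.
apply/esym/annih_comm => [|j' n w'']; first exact: lev_hlin (fun_partial_lin _ _ _).
by apply/funext => m; exact: fun_partial_pos_comm.
Qed.

Lemma zmode_zmode c c' (fc : xfin c) (fc' : xfin c') : ccomm (zmode i fc) (zmode i fc').
Proof.
move=> p q w; apply: zmode_comm => [|phi w']; first exact: coefP.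
apply/esym/zmode_comm => [|phi' w'']; first exact: lev_hlin (fun_partial_lin _ _ _).
by apply/funext => m; exact: fun_partial_comm.
Qed.

Lemma fexp_alpha_annih j b : GRing.comm (fexp_alpha K) (annih j b).
Proof.
apply: fconst_comm => p w; apply: annih_comm => [|j' n w']; first exact: lev_hlin (exp_alpha0_lin K).
by apply/funext => m; exact: exp_alpha0_pos_comm.
Qed.

Lemma fexp_alpha_fEplus : GRing.comm (fexp_alpha K) (fEplus K).
Proof. by apply: comm_fexp; apply: commrB; exact: fexp_alpha_annih. Qed.
Lemma fexp_alpha_fEbarplus : GRing.comm (fexp_alpha K) (fEbarplus K).
Proof. by apply: comm_fexp; apply: commrD; exact: fexp_alpha_annih. Qed.

Lemma ccomm_fEplus A : (forall j b, ccomm A (annih j b)) -> ccomm A (fEplus K).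
Proof. by move=> h; apply: ccomm_fexp; apply: ccommD; [|apply: ccommN]; exact: h. Qed.
Lemma ccomm_fEbarplus A : (forall j b, ccomm A (annih j b)) -> ccomm A (fEbarplus K).
Proof. by move=> h; apply: ccomm_fexp; apply: ccommD; exact: h. Qed.

Lemma fvminus_zmode q c (fc : xfin c) : GRing.comm (fvminus q) (zmode i fc).
Proof.
apply: fconst_comm => p w; apply: zmode_comm => [|phi w']; first exact: vminus_lin.
apply/esym/vminus_comm => [|j n w'']; first exact: lev_hlin (fun_partial_lin _ _ _).
by apply/funext => m; exact: fun_partial_neg_comm.
Qed.

Local Notation ea' := (lev (@exp_alpha0 K)).

Lemma vminus_exp_alpha q w : ea' (vminus q w) = vminus q (ea' w).
Proof.
apply: vminus_comm => [|j n w']; first exact: lev_hlin (exp_alpha0_lin K).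
by apply/funext => m; exact: exp_alpha0_neg_comm.
Qed.

Definition zmode0 := zmode i (@upow_xfin K 0).
Definition zmode1 := zmode i (@upow_xfin K 1).
Definition zmode2 := zmode i (@vpow_xfin K (-1)).
Definition zmodes := zmode0 * zmode1 * zmode2.

(** The series [t(u)] of annihilation and zero modes in [Xbar(u) = M(u) e^alpha t(u)]. *)
Definition vannih := vplus K * zmodes.

Lemma ccomm_vannih A : (forall j b, ccomm A (annih j b)) ->
  (forall c (fc : xfin c), ccomm A (zmode i fc)) -> ccomm A vannih.
Proof.
move=> aP aD; apply: ccommM; first by apply: ccommM; [exact: ccomm_fEplus|exact: ccomm_fEbarplus].
by apply: ccommM; [apply: ccommM|]; exact: aD.
Qed.

(** Annihilation modes and zero modes all commute, hence so do the series made of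
    them; first in one argument, and then by symmetry in the other. *)
Lemma vannihC : ccomm vannih vannih.
Proof.
have Pt j b : ccomm (annih j b) vannih.
  by apply: ccomm_vannih => *; [exact: annih_annih|exact: annih_zmode].
have Dt c (fc : xfin c) : ccomm (zmode i fc) vannih.
  by apply: ccomm_vannih => *; [apply: ccomm_sym; exact: annih_zmode|exact: zmode_zmode].
by apply: ccomm_vannih => *; apply: ccomm_sym.
Qed.

Lemma fvminus_zmodes q : GRing.comm (fvminus q) zmodes.
Proof. by apply: commrM; [apply: commrM|]; exact: fvminus_zmode. Qed.

Lemma uhmono_comm b k l A : GRing.comm (uhmono F0 b k l) A. Proof. exact: fscal_comm. Qed.

Lemma uhmono0 k l : uhmono F0 0 k l = 0.
Proof.
apply: fserP => p w; rewrite -[RHS](hmul0l w); apply: eq_hmul => m.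
exact: if_same.
Qed.

Lemma zmode0_fexp_alpha : zmode0 * fexp_alpha K = (uhmono F0 1 1 0 + uhmono F0 0 0 1) * fexp_alpha K * zmode0.
Proof. by apply: zmode_fexp_alpha => x p l; rewrite subr0; exact: upow_pascal. Qed.
Lemma zmode1_fexp_alpha : zmode1 * fexp_alpha K = uplus F0 1 * fexp_alpha K * zmode1.
Proof. by apply: zmode_fexp_alpha => x p l; rewrite subr0; exact: upow_pascal. Qed.
Lemma zmode2_fexp_alpha : zmode2 * fexp_alpha K = (uhmono F0 1 0 0 + uhmono F0 (-1) (-1) 1) * fexp_alpha K * zmode2.
Proof. by apply: zmode_fexp_alpha => x p l; rewrite subr0 opprK; exact: vpow_pascal. Qed.

Lemma uplus_comm b A : GRing.comm A (uplus F0 b).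
Proof. by apply: commrD; apply: commr_sym; exact: uhmono_comm. Qed.

Lemma zmodes_reorder (R : pzRingType) (e d0 d1 d2 z0 z1 z2 : R) :
  d0 * e = z0 * e * d0 -> d1 * e = z1 * e * d1 -> d2 * e = z2 * e * d2 ->
  GRing.comm (d0 * d1) z2 -> GRing.comm d0 z1 ->
  d0 * d1 * d2 * e = z2 * z1 * z0 * e * (d0 * d1 * d2).
Proof.
move=> h0 h1 h2 c2 c1; rewrite -mulrA h2 !mulrA c2 -!mulrA; congr (_ * _).
by rewrite [d1 * _]mulrA h1 !mulrA c1 -!mulrA; congr (_ * _); rewrite !mulrA h0.
Qed.

(** The scalar [u^2 - h^2], see [u2h2E]. *)
Definition u2h2 := uplus F0 1 * uplus F0 (-1).

Lemma uhmonoD b b' k l : uhmono F0 b k l + uhmono F0 b' k l = uhmono F0 (b + b') k l.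
Proof.
apply: fserP => p w; rewrite fvalD /= /smono -hmulDl; apply: eq_hmul => m.
by rewrite -[LHS]/(_ + _); case: ifP; rewrite ?addr0.
Qed.

(** The three zero-mode factors contribute [u], [u + h] and [1 - h/u]. *)
Lemma zmodes_fexp_alpha : zmodes * fexp_alpha K = u2h2 * fexp_alpha K * zmodes.
Proof.
have zc A : GRing.comm A (uhmono F0 1 0 0 + uhmono F0 (-1) (-1) 1).
  by apply: commrD; apply: commr_sym; exact: uhmono_comm.
have h := zmodes_reorder zmode0_fexp_alpha zmode1_fexp_alpha zmode2_fexp_alpha (zc _) (uplus_comm _ _).
suff E : (uhmono F0 1 0 0 + uhmono F0 (-1) (-1) 1) * uplus F0 1 * (uhmono F0 1 1 0 + uhmono F0 0 0 1) = u2h2.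
  by rewrite E in h; exact: h.
rewrite (uplus_comm 1 (uhmono F0 1 0 0 + uhmono F0 (-1) (-1) 1)) -mulrA.
apply: (f_equal2 *%R) => //.
rewrite uhmono0 addr0 mulrDl !uhmonoM !mulr1 add0r addn0 addNr.
by rewrite addn0.
Qed.

Lemma u2h2E : u2h2 = uhmono F0 1 2%:R 0 + uhmono F0 (-1) 0 2.
Proof.
rewrite /u2h2 /uplus mulrDl !mulrDr !uhmonoM !mulr1 !mul1r !addr0 !add0r !addn0 !add0n.
rewrite addrA -[X in X + _]addrA uhmonoD addNr uhmono0 addr0.
by congr (_ + _); congr uhmono.
Qed.

Lemma add_cancel (R : zmodType) (x y z t : R) : x + x = t -> y + z = 0 -> (x + y) + (x + z) = t.
Proof. by move=> h1 h2; rewrite addrACA h1 h2 addr0. Qed.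

Lemma uplus_sum : uplus F0 1 + uplus F0 (-1) = uhmono F0 2%:R 1 0.
Proof.
have h1 := uhmonoD 1 1 1 0; have h2 := uhmonoD 1 (-1) 0 1.
rewrite subrr uhmono0 in h2.
exact: (add_cancel h1 h2).
Qed.

Lemma uplus_fupow b : uplus F0 b * fupow F0 b (-1) = 1.
Proof. by rewrite -fupowD1 addNr fupow0. Qed.

Lemma fvminus_nonnat (q : K) : (forall n : nat, q <> n%:R) -> fvminus q = 0.
Proof.
move=> qn; apply: fserP => p w; rewrite /= /sconst; case: ifP => // _.
by case: (@vminus_nat_supp K q) => [[n /qn] //|]; exact.
Qed.

Lemma lag_fvminus (I : fser F0) n : lag I (fun n => fvminus n%:R) n = fvminus n%:R - I * fvminus (n%:R - 1).
Proof.
case: n => [|n].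
  2: by have -> : n.+1%:R - 1 = n%:R :> K by rewrite -natr1 addrK.
rewrite /lag.
rewrite [fvminus (_ - 1)]fvminus_nonnat ?mulr0 ?subr0 // => n /eqP.
by rewrite subr_eq natr1 eqr_nat.
Qed.

(** Since [M_n = 0] unless [n] is natural, the coefficients of
    [(1 - I v) (1 - J v) M(v)] have a uniform expression. *)
Lemma lag2_fvminus (I J : fser F0) n : lag J (lag I (fun n => fvminus n%:R)) n =
  fvminus n%:R - I * fvminus (n%:R - 1) - J * (fvminus (n%:R - 1) - I * fvminus (n%:R - 2%:R)).
Proof.
case: n => [|n].
  rewrite /= ![fvminus (_ - _)]fvminus_nonnat ?mulr0 ?subr0 ?mulr0 ?subr0 // => n /eqP.
    by rewrite subr_eq -natrD eqr_nat; case: n.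
  by rewrite subr_eq natr1 eqr_nat.
rewrite -[LHS]/(lag I (fun n => fvminus n%:R) n.+1 - J * lag I (fun n => fvminus n%:R) n) !lag_fvminus.
have -> : n.+1%:R - 1 = n%:R :> K by rewrite -natr1 addrK.
by have -> : n.+1%:R - 2%:R = n%:R - 1 :> K by rewrite -natr1; ring.
Qed.

Lemma vplus_fexp_alpha : vplus K * fexp_alpha K = fexp_alpha K * vplus K.
Proof. by apply: commr_sym; apply: commrM; [exact: fexp_alpha_fEplus|exact: fexp_alpha_fEbarplus]. Qed.

Lemma u2h2_comm A : GRing.comm A u2h2.
Proof. by apply: commrM; exact: uplus_comm. Qed.

(** With [z1 = I^-1] and [z2 = J^-1], this is [z1 z2] times the coefficient in
    [lag2_fvminus]. *)
Lemma clear_denominators (R : pzRingType) (a b c I J z1 z2 : R) :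
  z1 * I = 1 -> z2 * J = 1 -> GRing.comm z1 z2 ->
  z1 * z2 * (a - I * b - J * (b - I * c)) = z1 * z2 * a - (z1 + z2) * b + c.
Proof.
move=> h1 h2 c12.
have e1 x : z1 * z2 * (I * x) = z2 * x by rewrite c12 -mulrA [z1 * _]mulrA h1 mul1r.
have e2 x : z1 * z2 * (J * x) = z1 * x by rewrite -mulrA [z2 * _]mulrA h2 mul1r.
rewrite !mulrBr e1 !e2 [z1 * (I * c)]mulrA h1 mul1r mulrDl.
by rewrite opprB [c - _]addrC addrA opprD addrA [_ - z2 * b - _]addrAC.
Qed.

Lemma normal_order (R : pzRingType) (t d m e z g : R) :
  GRing.comm m d -> t * m = g * t -> d * e = z * e * d ->
  GRing.comm t z -> GRing.comm g z -> t * e = e * t ->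
  t * d * m * e = z * g * e * (t * d).
Proof.
move=> md tm de tz gz te.
by rewrite -(mulrA t) -md mulrA tm -!mulrA de !mulrA -(mulrA g) tz mulrA gz -!mulrA (mulrA t) te -!mulrA.
Qed.

(** In generating series, [t(u) M(v) e^alpha = ((u - v)^2 - h^2) M(v) e^alpha t(u)]:
    the denominator in [vplus_fvminus] is cleared by the factor [u^2 - h^2] from
    [zmodes_fexp_alpha]. *)
Lemma vannih_fvminus_fexp_alpha q : vannih * fvminus q * fexp_alpha K =
  (u2h2 * fvminus q - uhmono F0 2%:R 1 0 * fvminus (q - 1) + fvminus (q - 2%:R)) * fexp_alpha K * vannih.
Proof.
have [[n ->]|nq] := pselect (exists n : nat, q = n%:R); last first.
  have h0 : fvminus q = 0 by apply: fvminus_nonnat => n E; apply: nq; exists n.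
  have h1 : fvminus (q - 1) = 0.
    by apply: fvminus_nonnat => n /eqP; rewrite subr_eq natr1 => /eqP E; apply: nq; exists n.+1.
  have h2 : fvminus (q - 2%:R) = 0.
    by apply: fvminus_nonnat => n /eqP; rewrite subr_eq -natrD => /eqP E; apply: nq; exists (n + 2)%N.
  by rewrite h0 h1 h2 !(mulr0, mul0r, subr0, addr0).
have hT := vplus_fvminus K n; rewrite lag2_fvminus in hT.
have h := normal_order (fvminus_zmodes n%:R) hT zmodes_fexp_alpha (u2h2_comm _) (u2h2_comm _) vplus_fexp_alpha.
have c := clear_denominators (fvminus n%:R) (fvminus (n%:R - 1)) (fvminus (n%:R - 2%:R))
  (uplus_fupow 1) (uplus_fupow (-1)) (uplus_comm _ _).
rewrite uplus_sum in c.
exact: (etrans h (congr1 (fun x => x * fexp_alpha K * vannih) c)).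
Qed.
End FockComm.

(** * Substitution of [u + b h] for [v] *)

Lemma hlin4 (K : numFieldType) (V : lmodType K) (S : hser V -> hser V) (hS : hlin S)
    (a b d f : hser V) (c : nat -> K) (x : K) :
  S (a - hmul c b - x *: d + f) = S a - hmul c (S b) - x *: S d + S f.
Proof. by rewrite (hlinD hS) !(hlinB hS) (hlinZ hS) (hlinM hS). Qed.

Lemma hsum4 (K : numFieldType) (V : lmodType K) (I : choiceType) (T1 T2 T3 T4 : I -> hser V) :
  hsummable T1 -> hsummable T2 -> hsummable T3 -> hsummable T4 ->
  let T := fun z => T1 z - hmul (hmono K 2) (T2 z) - 2%:R *: T3 z + T4 z in
  hsummable T /\ hsum T = hsum T1 - hmul (hmono K 2) (hsum T2) - 2%:R *: hsum T3 + hsum T4.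
Proof.
move=> s1 s2 s3 s4 T.
have l2 : hlin (fun w : hser V => - hmul (hmono K 2) w) by apply: hlinNf; exact: hlin_hmul.
have l3 : hlin (fun w : hser V => - (2%:R *: w)) by apply: hlinNf; exact: hlinZf (@hlin_id _ _).
have s2' : hsummable (fun z => - hmul (hmono K 2) (T2 z)) := hsummable_lin (fun=> l2) s2.
have s3' : hsummable (fun z => - (2%:R *: T3 z)) := hsummable_lin (fun=> l3) s3.
have s12 := hsummableD s1 s2'; have s123 := hsummableD s12 s3'.
split; first exact: (hsummableD s123 s4).
by rewrite (hsum_lin l2 s2) (hsum_lin l3 s3) -(hsumD s1 s2') -(hsumD s12 s3') -(hsumD s123 s4).
Qed.

Section FormalLimit.
Variables (K : numFieldType) (V : lmodType K).
Variables (N : K -> K -> hser V) (b : K).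
Hypothesis Nsupp : forall n, exists D : seq (K * K), forall p q,
  (forall z (i j : nat), z \in D -> p = z.2 + i%:R -> q = z.1 + j%:R -> False) ->
  vanish n (N p q).
Hypothesis b2 : b * b = 1.
Local Notation h2 := (hmul (hmono K 2)).

(** The contribution of the coefficient [N p q] after replacing [v^q] with
    [(u + b h)^(q+c)], in the power [u^(s+c')]. *)
Definition limit_term s (c c' : K) (z : K * K) := hmul (upow b (z.2 + c) (s - z.1 + c')) (N z.1 z.2).

(** The hypothesis on [N] bounds [p] and [q] below in finitely many classes modulo
    integers, and a given power of [u] modulo [h^n] leaves finitely many values of
    [p + q]. *)
Lemma limit_term_summable s c c' : hsummable (limit_term s c c').
Proof.
apply/hsummableP => n; have [D DP] := Nsupp n.
(* With [p = z.2 + i] and [q = z.1 + j], a nonzero coefficient of [h^l] forces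
   [i + j = kap (z, l)]. *)
pose kap (x : K * K * nat) := s + c' - c + x.2%:R - x.1.1 - x.1.2.
have /choice[f fP] : forall x, exists k : nat, forall i : nat, i%:R = kap x -> i = k.
  move=> x; have [[k kE]|nk] := pselect (exists k : nat, k%:R = kap x).
    by exists k => i; rewrite -kE => /eqP; rewrite eqr_nat => /eqP.
  by exists 0%N => i iE; case: nk; exists i.
(* The exponents [(p, q)] allowed by [z] and [l]. *)
pose L (x : K * K * nat) := [seq (x.1.2 + k%:R, x.1.1 + (f x - k)%N%:R) | k <- iota 0 (f x).+1].
exists (flatten [seq L (z, l) | z <- D, l <- iota 0 n]) => -[p q] pq.
have [[z [i [j [zD pE qE]]]]|nz] := pselect (exists z (i j : nat),
    [/\ z \in D, p = z.2 + i%:R & q = z.1 + j%:R]); last first.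
  apply: (hlin_vanish (hlin_hmul V _)); apply: DP => z i j zD pE qE.
  by apply: nz; exists z, i, j.
move=> m mn; rewrite /limit_term /hmul big1 // => l _ /=; rewrite /upow; case: eqP => [E|_]; last by rewrite scale0r.
case/negP: pq; apply/flattenP; exists (L (z, l : nat)).
  apply/allpairsP; exists (z, l : nat); split => //=.
  by rewrite mem_iota /= add0n (leq_trans (ltn_ord l)).
have fE : (i + j)%N = f (z, l : nat).
  apply: fP; rewrite /kap /= natrD.
  have -> : s = q + c - l%:R - c' + p by rewrite -E; ring.
  by rewrite pE qE; ring.
apply/mapP; exists i; first by rewrite mem_iota ltnS -fE leq_addr.
by rewrite /= -fE addKn pE qE.
Qed.

Lemma shift_hsum (g : K * K -> hser V) (x y : K) : hsummable g ->
  hsummable (fun z => g (z.1 - x, z.2 - y)) /\ hsum (fun z => g (z.1 - x, z.2 - y)) = hsum g.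
Proof.
pose h (z : K * K) := (z.1 - x, z.2 - y); pose h' (z : K * K) := (z.1 + x, z.2 + y).
have e1 : cancel h h' by case=> u v; rewrite /h /h' /= !subrK.
have e2 : cancel h' h by case=> u v; rewrite /h /h' /= !addrK.
by move=> sg; split; [exact: (hsummable_inj e1 sg)|rewrite (hsum_bij e1 e2 sg)].
Qed.

Lemma hmul_hmono2 (c : nat -> K) (w : hser V) : h2 (hmul c w) =
  hmul (fun l => if l is l'.+2 then c l' else 0) w.
Proof. by rewrite hmul_hmono_hmul; apply: eq_hmul => -[|[|l]] //=; rewrite subn2. Qed.

(** The relation between [F] and [N] says [F(u, v) = ((u - v)^2 - h^2) N(u, v)]. After
    reindexing, the coefficient of each [N p q] is the expansion of
    [((u - v)^2 - h^2) v^q] at [v = u + b h], which vanishes when [b^2 = 1]. *)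
Lemma formal_limit0 (F : K -> K -> hser V) s :
  (forall p q, F p q = N (p - 2%:R) q - h2 (N p q) - 2%:R *: N (p - 1) (q - 1) + N p (q - 2%:R)) ->
  let g (z : K * K) := hmul (upow b z.2 (s - z.1)) (F z.1 z.2) in
  hsummable g /\ hsum g = 0.
Proof.
move=> FE g.
pose T1 (z : K * K) := hmul (upow b z.2 (s - z.1)) (N (z.1 - 2%:R) z.2).
pose T2 (z : K * K) := hmul (upow b z.2 (s - z.1)) (N z.1 z.2).
pose T3 (z : K * K) := hmul (upow b z.2 (s - z.1)) (N (z.1 - 1) (z.2 - 1)).
pose T4 (z : K * K) := hmul (upow b z.2 (s - z.1)) (N z.1 (z.2 - 2%:R)).
have gE z : T1 z - h2 (T2 z) - 2%:R *: T3 z + T4 z = g z.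
  by rewrite /g FE (hlin4 (hlin_hmul V _)).
have G1 := limit_term_summable s 0 (- 2%:R); have G2 := limit_term_summable s 0 0.
have G3 := limit_term_summable s 1 (-1); have G4 := limit_term_summable s 2%:R 0.
have [s1 e1] : hsummable T1 /\ hsum T1 = hsum (limit_term s 0 (- 2%:R)).
  have [h1 <-] := shift_hsum 2%:R 0 G1.
  have E : T1 =1 (fun z => limit_term s 0 (- 2%:R) (z.1 - 2%:R, z.2 - 0)).
    move=> z; rewrite /T1 /limit_term /= subr0 addr0; congr (hmul (upow _ _ _) _); ring.
  by split; [apply: eq_hsummable h1 => z; rewrite E|exact: eq_hsum].
have [s2 e2] : hsummable T2 /\ hsum T2 = hsum (limit_term s 0 0).
  have E : T2 =1 limit_term s 0 0 by move=> z; rewrite /T2 /limit_term !addr0.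
  by split; [apply: eq_hsummable G2 => z; rewrite E|exact: eq_hsum].
have [s3 e3] : hsummable T3 /\ hsum T3 = hsum (limit_term s 1 (-1)).
  have [h1 <-] := shift_hsum 1 1 G3.
  have E : T3 =1 (fun z => limit_term s 1 (-1) (z.1 - 1, z.2 - 1)).
    by move=> z; rewrite /T3 /limit_term /= subrK; congr (hmul (upow _ _ _) _); ring.
  by split; [apply: eq_hsummable h1 => z; rewrite E|exact: eq_hsum].
have [s4 e4] : hsummable T4 /\ hsum T4 = hsum (limit_term s 2%:R 0).
  have [h1 <-] := shift_hsum 0 2%:R G4.
  have E : T4 =1 (fun z => limit_term s 2%:R 0 (z.1 - 0, z.2 - 2%:R)).
    by move=> z; rewrite /T4 /limit_term /= subrK subr0 addr0.
  by split; [apply: eq_hsummable h1 => z; rewrite E|exact: eq_hsum].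
have [sT eT] := hsum4 s1 s2 s3 s4.
split; first by apply: eq_hsummable sT.
rewrite -(eq_hsum gE) eT e1 e2 e3 e4.
have [_ <-] := hsum4 G1 G2 G3 G4.
rewrite -[RHS](hsum0 V (K * K)%type); apply: eq_hsum => -[p q] /=.
rewrite /limit_term /= hmul_hmono2 hmulZl -!(hlinN (hlin_hmul V _)) /=.
have NE (c : nat -> K) (w : hser V) : hmul c (- w) = hmul (- c) w.
  by apply/funext => m; apply: eq_bigr => l _; rewrite scalerN scaleNr.
rewrite !NE -!hmulDl -[RHS](hmul0l (N p q)); apply: eq_hmul => l.
rewrite !fctE !addr0.
have u1 P k : upow b (q + 1) P k = upow b q (P - 1) k +
   b * (if k is k'.+1 then upow b q P k' else 0) by exact: upow_pascal.
have u2 P k : upow b (q + 2%:R) P k = upow b (q + 1) (P - 1) k +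
   b * (if k is k'.+1 then upow b (q + 1) P k' else 0).
  by rewrite -upow_pascal; congr upow; ring.
have P2 : s - p - 1 - 1 = s - p - 2%:R by ring.
(* The coefficients of [h^l] for [l = 0] and [l = 1] miss some of the terms. *)
case: l => [|[|l]]; rewrite ?u2 ?u1 P2.
all: ring: b2.
Qed.
End FormalLimit.

(** * The product [Xbar(u) Xbar(v)] *)

Lemma sub4_sym (R : zmodType) (x y z d : R) : x - y - z + d = d - y - z + x.
Proof. by rewrite addrC !addrA [RHS]addrAC [d - y + x]addrAC. Qed.

Section Assembly.
Variables (K : numFieldType) (i : 'I_2).
Local Notation F0 := (Fock0 K).
Implicit Types (w f : Fock K) (p q : K).
Local Notation E := (lev (@exp_alpha0 K)).
Local Notation t := (vannih K i).
Local Notation M := (@vminus K).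

Lemma Xbar_reorder (R : pzRingType) (ep epb e d0 d1 d2 : R) :
  e * ep = ep * e -> GRing.comm epb d0 -> GRing.comm epb d1 ->
  ep * e * d0 * d1 * epb * d2 = e * (ep * epb * (d0 * d1 * d2)).
Proof.
move=> he c0 c1; rewrite -he !mulrA -[e * ep * epb * d0]mulrA c0 mulrA.
by rewrite -[_ * epb * d1]mulrA c1 mulrA.
Qed.

Lemma vminus_smulA (A B : fser F0) : smul (smul M A) B = smul M (A * B).
Proof. by rewrite smulA_lin //; exact: vminus_lin. Qed.

(** Only [M(u)] has infinitely many powers of [u], and it stands on the left, so
    that all products can be reassociated. *)
Lemma XbarE : Xbar i = smul M (fexp_alpha K * t).
Proof.
have h : fEplus K * fexp_alpha K * zmode0 K i * zmode1 K i * fEbarplus K * zmode2 K i = fexp_alpha K * t.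
  apply: Xbar_reorder; first exact: fexp_alpha_fEplus.
    by apply: commr_sym; apply: ccomm_comm; apply: ccomm_fEbarplus => j b; apply: ccomm_sym; exact: annih_zmode.
  by apply: commr_sym; apply: ccomm_comm; apply: ccomm_fEbarplus => j b; apply: ccomm_sym; exact: annih_zmode.
rewrite -h -!vminus_smulA /Xbar /Xalpha EplusE EbarplusE EminusE.
by [].
Qed.

Lemma XbarpE p w : Xbar i p w = hsum (fun p' => M (p - p') (E (t p' w))).
Proof.
rewrite XbarE /smul.
have e q : p - (p - q) = q by rewrite opprB addrC subrK.
have sg := smul_summable p w (@vminus_lin K) (fvalP (fexp_alpha K * t)).
apply: etrans (hsum_bij (h := fun q => p - q) (h' := fun q => p - q) e e sg) _.
apply: eq_hsum => q; rewrite e.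
by congr (M _ _); exact: fconst_mul.
Qed.

Local Notation h2 := (hmul (hmono K 2)).

Lemma normal_order_expand (R : pzRingType) (z1 z2 z3 m1 m2 m3 e s : R) :
  ((z1 + z2) * m1 - z3 * m2 + m3) * e * s =
  z1 * (m1 * (e * s)) + z2 * (m1 * (e * s)) - z3 * (m2 * (e * s)) + m3 * (e * s).
Proof. by rewrite !(mulrDl, mulrBl, mulNr) -!mulrA. Qed.

Lemma vannih_vminus p q f : t p (M q (E f)) =
  M q (E (t (p - 2%:R) f)) - h2 (M q (E (t p f)))
  - 2%:R *: M (q - 1) (E (t (p - 1) f)) + M (q - 2%:R) (E (t p f)).
Proof.
transitivity ((t * fvminus q * fexp_alpha K) p f).
  by apply: esym; apply: etrans (mul_fconst _ (t * fvminus q) p f) _; exact: mul_fconst.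
rewrite vannih_fvminus_fexp_alpha u2h2E normal_order_expand.
have B q' r : (fvminus q' * (fexp_alpha K * t)) r f = M q' (E (t r f)).
  apply: etrans (fconst_mul _ (fexp_alpha K * t) r f) _.
  by apply: (congr1 (M q')); exact: fconst_mul.
have B1 := uhmono_mul 1 2%:R 0 (fvminus q * (fexp_alpha K * t)) p f.
have B2 := uhmono_mul (-1) 0 2 (fvminus q * (fexp_alpha K * t)) p f.
have B3 := uhmono_mul 2%:R 1 0 (fvminus (q - 1) * (fexp_alpha K * t)) p f.
rewrite B scale1r hmul_hmono0 in B1; rewrite B subr0 scaleN1r in B2; rewrite B hmul_hmono0 in B3.
have B4 := B (q - 2%:R) p.
exact: (f_equal2 +%R (f_equal2 (fun x y => x - y) (f_equal2 +%R B1 B2) B3) B4).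
Qed.

(** The coefficient of [u^p v^q] in [M(u) M(v) e^(2 alpha) t(u) t(v) w]. *)
Definition ordered w p q := hsum (fun z : K * K => M (p - z.2) (M (q - z.1) (E (E (t z.2 (t z.1 w)))))).

Lemma vminus2_lin p q : hlin (fun w => M p (M q (E (E w)))).
Proof.
apply: hlin_comp; first exact: vminus_lin.
apply: hlin_comp; first exact: vminus_lin.
by apply: hlin_comp; exact: (lev_hlin (exp_alpha0_lin K)).
Qed.

Lemma ordered_summable (P Q A B : K * K -> K) w (h h' : K * K -> K * K) :
  cancel h h' -> (forall z, h z = (B z, A z)) ->
  hsummable (fun z => M (P z) (M (Q z) (E (E (t (A z) (t (B z) w)))))).
Proof.
move=> hK hE; apply: (@hsummable_lin _ _ _ (fun z w => M (P z) (M (Q z) (E (E w)))) (fun z => t (A z) (t (B z) w))) => [z|].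
  exact: vminus2_lin.
apply: (eq_hsummable (g := fun z => t (h z).2 (t (h z).1 w))); first by move=> z; rewrite hE.
exact: (hsummable_inj hK (smul2_summable w (fvalP t) (fvalP t))).
Qed.

Lemma ordered_shift w p q (a b : K) :
  hsum (fun z : K * K => M (p - z.2) (M (q - b - z.1) (E (E (t (z.2 - a) (t z.1 w)))))) =
  ordered w (p - a) (q - b).
Proof.
pose sh (z : K * K) := (z.1, z.2 + a); pose sh' (z : K * K) := (z.1, z.2 - a).
have e1 : cancel sh sh' by case=> x y; rewrite /sh /sh' /= addrK.
have e2 : cancel sh' sh by case=> x y; rewrite /sh /sh' /= subrK.
have sg := ordered_summable (fun z => p - z.2) (fun z => q - b - z.1) w e2 (fun z => erefl (sh' z)).
apply: etrans (hsum_bij e1 e2 sg) _.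
apply: eq_hsum => -[x y]; rewrite /sh /= addrK.
have -> : p - (y + a) = p - a - y by rewrite opprD addrA addrAC.
by [].
Qed.

Definition ordered_term w (p q : K) (A Q : K -> K) (z : K * K) : Fock K :=
  M (p - z.2) (M (Q z.1) (E (E (t (A z.2) (t z.1 w))))).

(** A term of [Xbar_Xbar] before reindexing; the functions [A] and [Q] give the
    indices of [t(u)] and of [M(v)]. *)
Lemma ordered_termE w p q a b A Q : (forall y, A y = y - a) -> (forall x, Q x = q - x - b) ->
  hsummable (ordered_term w p q A Q) /\ hsum (ordered_term w p q A Q) = ordered w (p - a) (q - b).
Proof.
move=> hA hQ; split; last first.
  rewrite -ordered_shift; apply: eq_hsum => z; rewrite /ordered_term hA hQ.
  by have -> : q - z.1 - b = q - b - z.1 by rewrite addrAC.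
apply: (ordered_summable (fun z => p - z.2) (fun z => Q z.1) w (h := fun z => (z.1, A z.2)) (h' := fun z => (z.1, z.2 + a))) => //.
by case=> x y; rewrite /= hA subrK.
Qed.

(** In generating series, [vannih_fvminus_fexp_alpha] turns [M(u) e^alpha t(u) M(v) e^alpha t(v)]
    into [((u - v)^2 - h^2) M(u) M(v) e^(2 alpha) t(u) t(v)]. *)
Lemma Xbar_Xbar p q w : Xbar i p (Xbar i q w) =
  ordered w (p - 2%:R) q - h2 (ordered w p q) - 2%:R *: ordered w (p - 1) (q - 1) + ordered w p (q - 2%:R).
Proof.
have lE : hlin E := lev_hlin (exp_alpha0_lin K).
have lS p' : hlin (fun x => M p' (E x)) := hlin_comp (@vminus_lin K p') lE.
have [_ st] := fvalP t.
have sX p' w' : hsummable (fun z => M (p' - z) (E (t z w'))).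
  exact: (@hsummable_lin _ _ _ (fun z w => M (p' - z) (E w)) (fun z => t z w') (fun z => lS _)).
pose g (z : K * K) := M (p - z.2) (E (t z.2 (M (q - z.1) (E (t z.1 w))))).
pose T1 := ordered_term w p q (fun y => y - 2%:R) (fun x => q - x).
pose T2 := ordered_term w p q (fun y => y) (fun x => q - x).
pose T3 := ordered_term w p q (fun y => y - 1) (fun x => q - x - 1).
pose T4 := ordered_term w p q (fun y => y) (fun x => q - x - 2%:R).
have gE z : g z = T1 z - h2 (T2 z) - 2%:R *: T3 z + T4 z.
  have S Q y : M (p - z.2) (E (M Q (E y))) = M (p - z.2) (M Q (E (E y))).
    by congr (M _ _); exact: vminus_exp_alpha.
  apply: etrans (congr1 (fun x => M (p - z.2) (E x)) (vannih_vminus z.2 (q - z.1) (t z.1 w))) _.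
  apply: etrans (hlin4 (lS _) _ _ _ _ _ _) _.
  by apply: (f_equal2 +%R (f_equal2 (fun x y => x - y) (f_equal2 (fun x y => x - h2 y) _ _)
    (congr1 (fun x => 2%:R *: x) _)) _); exact: S.
have [s1 e1] : hsummable T1 /\ hsum T1 = ordered w (p - 2%:R) (q - 0).
  by apply: ordered_termE => x; rewrite ?subr0.
have [s2 e2] : hsummable T2 /\ hsum T2 = ordered w (p - 0) (q - 0).
  by apply: ordered_termE => x; rewrite ?subr0.
have [s3 e3] : hsummable T3 /\ hsum T3 = ordered w (p - 1) (q - 1) by exact: ordered_termE.
have [s4 e4] : hsummable T4 /\ hsum T4 = ordered w (p - 0) (q - 2%:R).
  by apply: ordered_termE => x; rewrite ?subr0.
rewrite !subr0 in e1 e2 e4.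
have [sT eT] := hsum4 s1 s2 s3 s4.
rewrite -e1 -e2 -e3 -e4 -eT.
have sg : hsummable g by apply: eq_hsummable sT => z; rewrite gE.
rewrite -(eq_hsum gE) (hsum_pair sg) (XbarpE q w).
have lX : hlin (Xbar i p) by rewrite XbarE; apply: smul_lin; [exact: vminus_lin|exact: fvalP].
rewrite (hsum_lin lX (sX q w)); apply: eq_hsum => x; exact: XbarpE.
Qed.

Lemma ordered_sym w p q : ordered w p q = ordered w q p.
Proof.
pose sw (z : K * K) := (z.2, z.1).
have e : cancel sw sw by case.
have eid : cancel (@id (K * K)) id by [].
have e2 (z : K * K) : id z = (z.1, z.2) by case: z.
have sN := ordered_summable (fun z => p - z.2) (fun z => q - z.1) w eid e2.
apply: etrans (hsum_bij e e sN) _; apply: eq_hsum => -[x y] /=.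
apply: etrans (vminusC _ _ _) _.
exact: (congr1 (fun v => M (q - y) (M (p - x) (E (E v)))) (@vannihC K i x y w)).
Qed.

(** Finitely many coefficients of [t(u) t(v) w] matter modulo [h^n], and [M(u) M(v)]
    has only nonnegative powers. *)
Lemma ordered_supp w n : exists D : seq (K * K), forall p q,
  (forall z (i j : nat), z \in D -> p = z.2 + i%:R -> q = z.1 + j%:R -> False) ->
  vanish n (ordered w p q).
Proof.
have /hsummableP/(_ n)[D DP] := smul2_summable w (fvalP t) (fvalP t).
exists D => p q npq m mn; rewrite /ordered (@hsum_seq _ _ _ _ [::]) ?big_nil // => z _.
have [zD|/DP h] := boolP (z \in D); last exact: (hlin_vanish (vminus2_lin _ _) h mn).
case: (@vminus_nat_supp K (p - z.2)) => [[x xE]|->] //.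
case: (@vminus_nat_supp K (q - z.1)) => [[y yE]|->]; last by rewrite (hlin0 (@vminus_lin K _)).
by case: (npq z x y zD); rewrite -?xE -?yE addrC subrK.
Qed.

Lemma Xbar_comm p q w : Xbar i p (Xbar i q w) = Xbar i q (Xbar i p w).
Proof.
rewrite !Xbar_Xbar (ordered_sym w (q - 2%:R)) (ordered_sym w q p) (ordered_sym w (q - 1)) (ordered_sym w q (p - 2%:R)).
exact: sub4_sym.
Qed.

Lemma Xbar_limit b : b * b = 1 ->
  is_formal_limit b (sprod2 (Xbar i) (Xbar i)) (@szero K F0).
Proof.
move=> b2 s w.
exact: (formal_limit0 (ordered_supp w) b2 s (fun p q => Xbar_Xbar p q w)).
Qed.

End Assembly.

Theorem proposition3p2 (R : realType) (i : 'I_2) :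
  let X : ser (Fock0 R[i]) := Xbar i in
  [/\ forall p q w, sprod2 X X p q w = sswap (sprod2 X X) p q w,
      is_formal_limit (-1) (sprod2 X X) (@szero _ _)
    & is_formal_limit 1 (sprod2 X X) (@szero _ _)].
Proof.
split=> [p q w||].
- exact: Xbar_comm.
- by apply: Xbar_limit; rewrite mulrNN mulr1.
by apply: Xbar_limit; rewrite mulr1.
Qed.
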